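(* Fix $1\le n\le\omega$. Let $E$ be an equivalence relation on $X_n$ which is classifiable by countable structures and extends $F_n$ (i.e. $F_n\subseteq E$). Then either (i) $F_n\le_B E$, or (ii) there are $k<n$ and a comeager set $C\subseteq X_n$ such that for all $x,y\in C$, if $(x\restriction k)\mathrel{F_k}(y\restriction k)$ then $x\mathrel{E}y$ (for $k=0$ this says that $C$ is contained in a single $E$-class).
   Context: Let $\mathbb N=\{0,1,2,\dots\}$ and identify $2^{\mathbb N}$ with $\mathcal P(\mathbb N)$. For $1\le m\le\omega$ and $x\in((2^{\mathbb N})^{\mathbb N})^m$ define recursively: $A^x_1=\{x(0)(k):k\in\mathbb N\}\subseteq 2^{\mathbb N}$; for $1\le j<m$ and $l\in\mathbb N$, $a^{x,l}_1=\{x(0)(k):x(1)(l)(k)=1\}$ and $a^{x,l}_{j}=\{a^{x,k}_{j-1}:x(j)(l)(k)=1\}$ for $j\ge 2$; and $A^x_{j+1}=\{a^{x,k}_j:k\in\mathbb N\}$ for $1\le j<m$. Let $X_1=(2^{\mathbb N})^{\mathbb N}$, and for $2\le n\le\omega$ let $X_n$ be the set of $x\in((2^{\mathbb N})^{\mathbb N})^n$ such that for every $1\le i<n$: (1) for every $m$ there is $k$ with $x(i)(k)(m)=1$; (2) for every $k$ there is $m$ with $x(i)(k)(m)=1$; (3) for all $k,l_1,l_2$, if $x(i-1)(l_1)=x(i-1)(l_2)$ then $x(i)(k)(l_1)=x(i)(k)(l_2)$. For $1\le n<\omega$, $F_n$ on $X_n$ is $x\mathrel{F_n}y\iff A^x_n=A^y_n$;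 $F_\omega$ on $X_\omega$ is $x\mathrel{F_\omega}y\iff A^x_j=A^y_j$ for all $1\le j<\omega$. $X_0$ is a one-point space and $F_0$ the equivalence relation with one class. Classifiable by countable structures: Borel reducible to isomorphism of countable $\mathcal L$-structures for some countable language $\mathcal L$. *)

(* Defs.v *)
From mathcomp Require Import all_boot.
Set Implicit Arguments. Unset Strict Implicit. Unset Printing Implicit Defensive.

Inductive natinf := Fin of nat | Omega.

Definition ltinf (k : nat) (n : natinf) : Prop :=
  match n with Fin m => (k < m)%N | Omega => True end.

(** Ambient space: x : nat -> nat -> nat -> bool, read x i l k = x(i)(l)(k).
    A point of ((2^N)^N)^n (n <= omega) is represented by padding the
    coordinates i >= n with the constant zero function. *)
Definition Pt := nat -> nat -> nat -> bool.
Definition zero2 : nat -> nat -> bool := fun _ _ => false.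

Definition restr (k : nat) (x : Pt) : Pt :=
  fun i => if (i < k)%N then x i else zero2.

Definition Xn (n : natinf) (x : Pt) : Prop :=
  (forall i, ~ ltinf i n -> x i = zero2) /\
  (forall i, (1 <= i)%N -> ltinf i n ->
     (forall m, exists k, x i k m = true) /\
     (forall k, exists m, x i k m = true) /\
     (forall k l1 l2, x i.-1 l1 = x i.-1 l2 -> x i k l1 = x i k l2)).

Fixpoint V (j : nat) : Type :=
  match j with 0 => nat -> bool | S j' => V j' -> Prop end.

Fixpoint a (x : Pt) (j : nat) (l : nat) : V j.+1 :=
  match j return V j.+1 with
  | 0 => fun z : nat -> bool => exists k, x 1 l k = true /\ z = x 0 k
  | S j' => fun z : V j'.+1 => exists k, x j'.+2 l k = true /\ z = @a x j' k
  end.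

Arguments a x j l : clear implicits.

Definition AA (x : Pt) (j : nat) : V j.+1 :=
  match j return V j.+1 with
  | 0 => fun z : nat -> bool => exists k, z = x 0 k
  | S j' => fun z : V j'.+1 => exists k, z = a x j' k
  end.

Arguments AA x j : clear implicits.

Definition Frel (n : natinf) (x y : Pt) : Prop :=
  match n with
  | Fin 0 => True
  | Fin (S m) => AA x m = AA y m
  | Omega => forall j, AA x j = AA y j
  end.

Inductive borel {T : Type} (G : (T -> Prop) -> Prop) : (T -> Prop) -> Prop :=
  | borel_gen S : G S -> borel G S
  | borel_compl S : borel G S -> borel G (fun t => ~ S t)
  | borel_cup (S : nat -> T -> Prop) :
      (forall m, borel G (S m)) -> borel G (fun t => exists m, S m t).

Definition cylPt (S : Pt -> Prop) : Prop :=
  exists i l k b, S = (fun x => x i l k = b).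

Definition openPt (U : Pt -> Prop) : Prop :=
  forall x, U x -> exists s : seq (nat * nat * nat),
    forall y, (forall c, c \in s -> x c.1.1 c.1.2 c.2 = y c.1.1 c.1.2 c.2) -> U y.

Definition dense_in (X U : Pt -> Prop) : Prop :=
  forall W, openPt W -> (exists x, X x /\ W x) -> exists x, [/\ X x, W x & U x].

Definition comeager_in (X C : Pt -> Prop) : Prop :=
  (forall x, C x -> X x) /\
  exists U : nat -> Pt -> Prop,
    (forall m, openPt (U m) /\ dense_in X (U m)) /\
    (forall x, X x -> (forall m, U m x) -> C x).

Definition borel_fun_on {Y : Type} (GY : (Y -> Prop) -> Prop)
    (X : Pt -> Prop) (g : Pt -> Y) : Prop :=
  forall S, borel GY S ->
    exists B, borel cylPt B /\ forall x, X x -> (S (g x) <-> B x).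

(** Countable (relational) structures with universe N for the language with
    relation symbols indexed by nat, symbol i of arity ar i *)
Definition Str (ar : nat -> nat) : Type := forall i : nat, (ar i).-tuple nat -> bool.

Definition cylStr (ar : nat -> nat) (S : Str ar -> Prop) : Prop :=
  exists i (t : (ar i).-tuple nat) b, S = (fun M => M i t = b).

Definition iso_str (ar : nat -> nat) (M N : Str ar) : Prop :=
  exists pi : nat -> nat, bijective pi /\
    forall i (t : (ar i).-tuple nat), N i (map_tuple pi t) = M i t.

Definition equiv_on (X : Pt -> Prop) (E : Pt -> Pt -> Prop) : Prop :=
  [/\ forall x, X x -> E x x,
      forall x y, X x -> X y -> E x y -> E y x &
      forall x y z, X x -> X y -> X z -> E x y -> E y z -> E x z].

Definition classifiable (X : Pt -> Prop) (E : Pt -> Pt -> Prop) : Prop :=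
  exists (ar : nat -> nat) (g : Pt -> Str ar),
    borel_fun_on (@cylStr ar) X g /\
    forall x y, X x -> X y -> (E x y <-> iso_str (g x) (g y)).

Definition borel_reducible (X : Pt -> Prop) (F E : Pt -> Pt -> Prop) : Prop :=
  exists f : Pt -> Pt,
    borel_fun_on cylPt X f /\ (forall x, X x -> X (f x)) /\
    forall x y, X x -> X y -> (F x y <-> E (f x) (f y)).

(* Main.v *)
Require Import Defs.
From mathcomp Require Import all_boot boolp.
From HB Require Import structures.
From Stdlib Require Eqdep_dec PeanoNat.
Set Implicit Arguments. Unset Strict Implicit. Unset Printing Implicit Defensive.

(* Let g reduce E to isomorphism of countable structures.  Fix k < n and call two points of X_n
   based if they agree on the levels below k.  If based mutually generic points have back-and-forth
   equivalent structures at every countable rank, they are E-equivalent, and alternative (ii) holds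
   for k.  Otherwise let w be the least rank at which this fails.  Below w the classes occurring in
   g(x) depend only on the base, so a tuple of g(x) is described up to w-equivalence by a real, and
   E-equivalent based points have the same countable set of these reals.  A category argument over
   re-enumerations of x shows that each such real is determined by finitely many rows of level k,
   and since rank w fails, some of these reals are not locally constant in the rows anywhere below
   some condition.  Hence two based points, each of them generic, whose rows of level k are
   suitably different are not E-equivalent, whatever their levels above k are.

   If (ii) fails for all k < n, the reduction of F_n to E replaces the hereditary set coded by x by
   a set with independent elements: an element is a finite list of parameters from the transitive
   closure together with a finite table, which decides membership from the finite information that
   the parameters give, and the reals of level 0 are taken from a perfect set of mutually generic
   reals.  Such a set has generic enumerations.  If x and y first differ at level k, then the images
   of x and y have generic enumerations with the same base, in which the relevant rows of level k
   belong to the first image only. *)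

(** * Baire category *)

(** Isomorphism is reached only through back-and-forth relations of a fixed countable rank: their
    Baire property is a plain induction, and their classes can be named by the tuples of one fixed
    structure. The obstacle to the reduction is that the images of x and y may share most of their
    elements, so their enumerations cannot be chosen mutually generic. The criterion for
    inequivalence therefore asks for joint genericity of very little: the common base, M0 rows of
    level k from one point and M' rows from the other. In the construction those M0 rows carry a
    parameter that x has and y lacks, so the merged rows are pairwise distinct elements and can
    still be made generic. A second obstacle is that an element of level 0 becomes a complete real
    as soon as it is chosen. Finite approximations to a generic enumeration then exist only if any
    finitely many of these reals are mutually generic for dense sets fixed beforehand; hence the
    perfect set. Category is set up over abstract countable sets of conditions because it is applied
    to codes, to re-enumerations, to products of these, and to codes of which only some coordinates
    count. *)

Record cspace := CSpace {
  pt :> Type;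
  cd : countType;
  sat : cd -> pt -> Prop;
  top : cd;
  satT : forall u, sat top u;
  meet : cd -> cd -> cd;
  satI : forall s t u, sat (meet s t) u <-> sat s u /\ sat t u;
  complete : forall s : nat -> cd,
    (forall i, exists u, sat (s i) u) ->
    (forall i u, sat (s i.+1) u -> sat (s i) u) ->
    exists u, forall i, sat (s i) u }.
Arguments sat {c} : simpl never.
Arguments cd : simpl never.
Arguments top {c}.
Arguments meet {c}.

Section Category.
Variable A : cspace.
Implicit Types (s t r : cd A) (u : A) (S : A -> Prop).

Definition ne s := exists u, sat s u.
Definition sub t s := forall u, sat t u -> sat s u.
Definition dense (D : cd A -> Prop) :=
  forall s, ne s -> exists t, [/\ ne t, sub t s & D t].
Definition comeager S := exists D : nat -> cd A -> Prop,
  (forall i, dense (D i)) /\ forall u, (forall i, exists t, D i t /\ sat t u) -> S u.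
Definition forces s S := comeager (fun u => sat s u -> S u).
(** The Baire property in forcing form: the conditions deciding [S] are dense. It passes through
    complements and countable unions, which is all that Borel sets and back-and-forth relations
    require. *)
Definition bp S := forall s, ne s -> exists t,
  [/\ ne t, sub t s & forces t S \/ forces t (fun u => ~ S u)].

Lemma sub_trans s t r : sub t s -> sub r t -> sub r s.
Proof. by move=> st tr u /tr /st. Qed.

Lemma cm_mono S1 S2 : (forall u, S1 u -> S2 u) -> comeager S1 -> comeager S2.
Proof. by move=> S12 [D [dD DS]]; exists D; split=> // u /DS /S12. Qed.

Lemma cm_all (I : countType) (S : I -> A -> Prop) :
  (forall i, comeager (S i)) -> comeager (fun u => forall i, S i u).
Proof.
move=> /choice[D DP].
exists (fun m => if @unpickle (I * nat)%type m is Some ij then D ij.1 ij.2 else xpredT).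
split=> [m|u uD i].
  case: unpickle => [[i j]|] /=; first exact: (DP i).1.
  by move=> s nes; exists s; split.
apply: (DP i).2 => j; have := uD (pickle (i, j)).
by rewrite pickleK.
Qed.

Lemma cm_true S : (forall u, S u) -> comeager S.
Proof.
move=> St; exists (fun _ _ => True); split=> // _ s nes.
by exists s; split.
Qed.

Lemma cm_and S1 S2 : comeager S1 -> comeager S2 -> comeager (fun u => S1 u /\ S2 u).
Proof.
move=> c1 c2; have := @cm_all bool (fun b => if b then S1 else S2).
move=> /(_ (fun b => match b with true => c1 | false => c2 end)).
by apply: cm_mono => u h; split; [exact: (h true)|exact: (h false)].
Qed.

Lemma cm_app S1 S2 : comeager S1 -> comeager (fun u => S1 u -> S2 u) -> comeager S2.
Proof. by move=> c1 c2; apply: cm_mono (cm_and c1 c2) => u [? ]; apply. Qed.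

Lemma baire s S : ne s -> comeager S -> exists2 u, sat s u & S u.
Proof.
move=> nes [D [dD DS]].
pose st := {t : cd A | ne t}.
have /choice[nx nxP] : forall p : nat * st, exists t : st,
    sub (proj1_sig t) (proj1_sig p.2) /\ D p.1 (proj1_sig t).
  move=> [i [t net]]; have [t' [net' tt' Dt']] := dD i t net.
  by exists (exist _ t' net').
pose c := fix c (i : nat) : st := if i is j.+1 then nx (j, c j) else exist _ s nes.
have [|i u|u uP] := @complete A (fun i => proj1_sig (c i)).
- by move=> i; exact: (proj2_sig (c i)).
- exact: (nxP (i, c i)).1.
exists u; first exact: (uP 0).
apply: DS => i; exists (proj1_sig (c i.+1)); split; [exact: (nxP (i, c i)).2|exact: uP].
Qed.

Lemma ne_top : forall S, comeager S -> (exists u : A, True) -> exists u, S u.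
Proof.
by move=> S cS [u _]; have [|v _ Sv] := @baire top S _ cS;
  [exists u; exact: satT|exists v].
Qed.

Lemma dense_cm (D : cd A -> Prop) : dense D ->
  comeager (fun u => exists t, D t /\ sat t u).
Proof. by move=> dD; exists (fun _ => D); split=> // u /(_ 0). Qed.

Lemma neI s t u : sat s u -> sat t u -> ne (meet s t).
Proof. by exists u; apply/satI. Qed.

Lemma sub_meetl s t : sub (meet s t) s. Proof. by move=> u /satI[]. Qed.
Lemma sub_meetr s t : sub (meet s t) t. Proof. by move=> u /satI[]. Qed.

Lemma dense_below_cm q (D : cd A -> Prop) :
  (forall s, ne s -> sub s q -> exists t, [/\ ne t, sub t s & D t]) ->
  comeager (fun u => sat q u -> exists t, D t /\ sat t u).
Proof.
move=> dD.
have := @dense_cm (fun t => D t \/ forall u, sat t u -> ~ sat q u); case.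
  move=> s nes; have [[u uP]|nu] := pselect (exists u, sat (meet s q) u).
    have [|t [net ts Dt]] := dD (meet s q) _ (@sub_meetr _ _); first by exists u.
    by exists t; split; [|exact: sub_trans (@sub_meetl _ _) ts|left].
  exists s; split=> //; right=> u su qu; apply: nu; exists u; exact/satI.
move=> D' [dD' D'P]; exists D'; split=> // u /D'P[t [[Dt|nt] tu] qu].
  by exists t.
by case: (nt u).
Qed.

Lemma forces_sub s t S : sub t s -> forces s S -> forces t S.
Proof. by move=> ts; apply: cm_mono => u h /ts. Qed.

Lemma forces_mono s S1 S2 : (forall u, S1 u -> S2 u) -> forces s S1 -> forces s S2.
Proof. by move=> S12; apply: cm_mono => u h /h /S12. Qed.

Lemma forces_contra s S : ne s -> forces s S -> forces s (fun u => ~ S u) -> False.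
Proof.
by move=> nes f1 f2; have [u su [h1 h2]] := baire nes (cm_and f1 f2); apply: h2 (h1 su).
Qed.

Lemma bp_ext S1 S2 : comeager (fun u => S1 u <-> S2 u) -> bp S1 -> bp S2.
Proof.
move=> c12 b1 s /b1[t [net ts h]]; exists t; split=> //.
case: h => f; [left|right]; apply: cm_mono (cm_and c12 f) => u [e h] /h.
  by move/e.
by move=> n1 /e.
Qed.

Lemma bp_eq S1 S2 : (forall u, S1 u <-> S2 u) -> bp S1 -> bp S2.
Proof. by move=> e; apply: bp_ext; exact: cm_true. Qed.

Lemma bp_compl S : bp S -> bp (fun u => ~ S u).
Proof.
move=> b s /b[t [net ts h]]; exists t; split=> //.
by case: h => f; [right|left]; apply: forces_mono f => u ?; [case|].
Qed.

(** If no condition below [s] forces any [S i], then for each [i] the conditions forcing [S i] to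
    fail are dense below [s], so the union is meager there. *)
Lemma bp_cup (I : countType) (S : I -> A -> Prop) :
  (forall i, bp (S i)) -> bp (fun u => exists i, S i u).
Proof.
move=> b s nes.
have [[i [t [net ts f]]]|h] := pselect (exists i t, [/\ ne t, sub t s & forces t (S i)]).
  by exists t; split=> //; left; apply: forces_mono f => u; exists i.
exists s; split=> //; right.
have : comeager (fun u => forall i, sat s u -> ~ S i u).
  apply: cm_all => i.
  have := @dense_below_cm s (fun t => sub t s /\ forces t (fun u => ~ S i u)).
  have : comeager (fun u => forall t, forces t (fun u => ~ S i u) -> sat t u -> ~ S i u).
    apply: cm_all => t.
    have [f|f] := pselect (forces t (fun u => ~ S i u)).
      by apply: cm_mono f => u.
    exact: cm_true.
  move=> c1 c2; apply: cm_app (cm_and c1 (c2 _)) _.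
    move=> t net ts; have [t' [net' tt' [f|f]]] := b i t net.
      by case: h; exists i, t'; split=> //; exact: sub_trans tt'.
    by exists t'; split=> //; split=> //; exact: sub_trans tt'.
  by apply: cm_true => u [h1 h2] /h2[t [[_ ft] tu]]; exact: h1 tu.
by apply: cm_mono => u hu su [i Siu]; exact: (hu i).
Qed.

Lemma bp_cap (I : countType) (S : I -> A -> Prop) :
  (forall i, bp (S i)) -> bp (fun u => forall i, S i u).
Proof.
move=> b; have /bp_compl := @bp_cup I _ (fun i => bp_compl (b i)).
apply: bp_eq => u; split=> [h i|h [i]]; last exact.
by apply: contrapT => n; apply: h; exists i.
Qed.

Lemma bp_and S1 S2 : bp S1 -> bp S2 -> bp (fun u => S1 u /\ S2 u).
Proof.
move=> b1 b2; have := @bp_cap bool (fun b => if b then S1 else S2).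
move=> /(_ (fun b => match b with true => b1 | false => b2 end)).
apply: bp_eq => u; split=> [h|[? ?] []] //.
by split; [exact: (h true)|exact: (h false)].
Qed.

Lemma bp_iff S1 S2 : bp S1 -> bp S2 -> bp (fun u => S1 u <-> S2 u).
Proof.
move=> b1 b2.
have h := bp_compl (bp_and b1 (bp_compl b2)).
have h' := bp_compl (bp_and b2 (bp_compl b1)).
apply: bp_eq (bp_and h h') => u; split.
  by move=> [n1 n2]; split=> x; apply: contrapT => y; [exact: n1|exact: n2].
by move=> e; split=> -[/e].
Qed.

Lemma bp_sat s : bp (sat s).
Proof.
move=> r ner; have [[u uP]|nu] := pselect (ne (meet r s)).
  exists (meet r s); split; [by exists u|exact: sub_meetl|left].
  by apply: cm_true => v /satI[].
exists r; split=> //; right; apply: cm_true => u ru su; apply: nu; exact: neI ru su.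
Qed.

Lemma bp_const (P : Prop) : bp (fun _ => P).
Proof.
move=> s nes; exists s; split=> //.
by have [p|p] := pselect P; [left|right]; apply: cm_true.
Qed.

Lemma borel_bp T (C : (T -> Prop) -> Prop) (h : A -> T) (B : T -> Prop) :
  (forall S : T -> Prop, C S -> bp (S \o h)) -> borel C B -> bp (B \o h).
Proof.
move=> hC; elim=> [S /hC //|S _ /bp_compl //|S _ IH]; exact: (@bp_cup nat).
Qed.

(** What holds at a generic point is forced by a condition satisfied there. This turns a fact about
    one point into a fact about comeagerly many. *)
Lemma decide S : bp S ->
  comeager (fun u => (S u -> exists t, sat t u /\ forces t S) /\
                     (~ S u -> exists t, sat t u /\ forces t (fun v => ~ S v))).
Proof.
move=> b.
have c1 : comeager (fun u => forall t, forces t S -> sat t u -> S u).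
  by apply: cm_all => t; have [f|f] := pselect (forces t S);
    [apply: cm_mono f|apply: cm_true].
have c2 : comeager (fun u => forall t, forces t (fun v => ~ S v) -> sat t u -> ~ S u).
  by apply: cm_all => t; have [f|f] := pselect (forces t (fun v => ~ S v));
    [apply: cm_mono f|apply: cm_true].
have c3 := @dense_cm (fun t => forces t S \/ forces t (fun v => ~ S v)) _.
apply: cm_mono (cm_and (cm_and c1 c2) (c3 b)) => u [[h1 h2] [t [[f|f] tu]]].
- split=> [_|n]; [by exists t|by case: n; exact: h1 tu].
- split=> [s|_]; [by case: (h2 t f tu)|by exists t].
Qed.

Lemma forces_true S : comeager (fun u => forall t, forces t S -> sat t u -> S u).
Proof.
by apply: cm_all => t; have [f|f] := pselect (forces t S);
  [apply: cm_mono f|apply: cm_true].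
Qed.
End Category.

(** Every refinement of the condition [t] attached to [s] is reached by [h] from below [s], so dense
    families pull back to dense families. *)
Lemma cm_map (A B : cspace) (h : A -> B) (S : B -> Prop) :
  (forall s : cd A, ne s -> exists t : cd B, ne t /\
     forall t', ne t' -> sub t' t ->
       exists s', [/\ ne s', sub s' s & forall u, sat s' u -> sat t' (h u)]) ->
  comeager S -> comeager (S \o h).
Proof.
move=> hP [D [dD DS]].
exists (fun i s => exists2 t, D i t & forall u, sat s u -> sat t (h u)).
split=> [i s nes|u uD].
  have [t [net tP]] := hP s nes.
  have [t' [net' tt' Dt']] := dD i t net.
  by have [s' [nes' ss' s'P]] := tP t' net' tt'; exists s'; split=> //; exists t'.
apply: DS => i; have [s [[t Dt st] su]] := uD i.
by exists t; split=> //; exact: st.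
Qed.

(** * Products and the Kuratowski-Ulam theorem *)

Section Prod.
Variables A B : cspace.

Definition psat (s : cd A * cd B) (u : A * B) := sat s.1 u.1 /\ sat s.2 u.2.

Lemma psatT u : psat (top, top) u.
Proof. by split; exact: satT. Qed.

Lemma psatI s t u :
  psat (meet s.1 t.1, meet s.2 t.2) u <-> psat s u /\ psat t u.
Proof.
split; first by case=> /satI[? ?] /satI[? ?].
by move=> [[? ?] [? ?]]; split; apply/satI.
Qed.

Lemma pcomplete (s : nat -> cd A * cd B) :
  (forall i, exists u, psat (s i) u) ->
  (forall i u, psat (s i.+1) u -> psat (s i) u) ->
  exists u, forall i, psat (s i) u.
Proof.
move=> nes mon.
have [|i u h|x xP] := @complete A (fun i => (s i).1).
- by move=> i; have [u [? ?]] := nes i; exists u.1.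
- by have [v [? ?]] := nes i.+1; have [] := mon i (u, v.2).
have [|i u h|y yP] := @complete B (fun i => (s i).2).
- by move=> i; have [u [? ?]] := nes i; exists u.2.
- by have [v [? ?]] := nes i.+1; have [] := mon i (v.1, u).
by exists (x, y) => i; split; [exact: xP|exact: yP].
Qed.

Definition prod_cspace : cspace :=
  @CSpace (A * B)%type (cd A * cd B)%type psat (top, top) psatT
    (fun s t => (meet s.1 t.1, meet s.2 t.2)) psatI pcomplete.

Lemma ne_prod (s : cd A) (t : cd B) : ne s -> ne t -> @ne prod_cspace (s, t).
Proof. by move=> [u ?] [v ?]; exists (u, v). Qed.

(** For each of the countably many pairs [(i, t)], the first components of members of [D i] whose
    second component refines [t] are dense. A generic [x] meets them all, which makes its sections
    of the [D i] dense. *)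
Lemma kuratowski_ulam (S : A * B -> Prop) : @comeager prod_cspace S ->
  comeager (fun x => comeager (fun y => S (x, y))).
Proof.
move=> [D [dD DS]].
pose C (i : nat) (t : cd B) (s : cd A) := exists t', [/\ ne t', sub t' t & D i (s, t')].
have: comeager (fun x => forall it : nat * cd B, ne it.2 -> exists s, C it.1 it.2 s /\ sat s x).
  apply: cm_all => -[i t] /=; have [net|n] := pselect (ne t); last exact: cm_true.
  apply: cm_mono (dense_cm (_ : dense (C i t))) => [u h _ //|s nes].
  have [[s' t'] [nest sst Dst]] := dD i (s, t) (ne_prod nes net).
  have [[x y] [/= sx ty]] := nest.
  exists s'; split; first by exists x.
    by move=> u su; have [] := sst (u, y).
  exists t'; split=> //; first by exists y.
  by move=> u tu; have [] := sst (x, u).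
apply: cm_mono => x xP.
exists (fun i t => exists s, D i (s, t) /\ sat s x); split=> [i t net|y yP].
  have [s [[t' [net' tt' Dt']] sx]] := xP (i, t) net.
  by exists t'; split=> //; exists s.
apply: DS => i; have [t [[s [Ds sx]] ty]] := yP i.
by exists (s, t).
Qed.

Lemma cm_fst (S : A -> Prop) : comeager S -> @comeager prod_cspace (fun u => S u.1).
Proof.
apply: (@cm_map prod_cspace A fst) => -[s t] [[x y] [/= sx ty]].
exists s; split; first by exists x.
move=> s' nes' ss'; exists (s', t); split=> //.
- by apply: ne_prod => //; exists y.
- by move=> u [/= /ss' ? ?].
- by move=> u [].
Qed.

Lemma cm_snd (S : B -> Prop) : comeager S -> @comeager prod_cspace (fun u => S u.2).
Proof.
apply: (@cm_map prod_cspace B snd) => -[s t] [[x y] [/= sx ty]].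
exists t; split; first by exists y.
move=> t' net' tt'; exists (s, t'); split=> //.
- by apply: ne_prod => //; exists x.
- by move=> u [/= ? /tt' ?].
- by move=> u [].
Qed.

Lemma forces_prod (s : cd A) (t : cd B) (S : A * B -> Prop) :
  @forces prod_cspace (s, t) S ->
  comeager (fun x => sat s x -> forces t (fun y => S (x, y))).
Proof.
move=> /kuratowski_ulam; apply: cm_mono => x h sx.
by apply: cm_mono h => y h ty; apply: h.
Qed.
End Prod.

Lemma cm_swap (A B : cspace) (S : A * B -> Prop) :
  @comeager (prod_cspace A B) S -> @comeager (prod_cspace B A) (fun u => S (u.2, u.1)).
Proof.
apply: (@cm_map (prod_cspace B A) (prod_cspace A B) (fun u => (u.2, u.1))).
move=> [t s] [[y x] [/= ty sx]]; exists (s, t); split; first by exists (x, y).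
move=> [s' t'] [[x' y'] [/= sx' ty']] h; exists (t', s'); split.
- by exists (y', x').
- by move=> [v u] [/= tv su]; have [] := h (u, v) (conj su tv).
- by move=> [v u] [].
Qed.

(** * Function spaces with finite conditions *)

Section FunSpace.
Variables (I V : countType) (mask : pred I) (T : Type) (ev : T -> I -> V)
  (mk : (I -> V) -> T) (v0 : V).
Hypothesis evmk : forall f c, ev (mk f) c = f c.

(** Constraints outside [mask] are ignored, so a space that sees only some coordinates keeps the
    same type of points. *)
Definition fsat (s : seq (I * V)) (u : T) : Prop :=
  all (fun cv => mask cv.1 ==> (ev u cv.1 == cv.2)) s.

Lemma fsatP s u : fsat s u <-> forall c v, (c, v) \in s -> mask c -> ev u c = v.
Proof.
split=> [/allP h c v /h /=|h]; first by move=> /implyP hh /hh /eqP.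
by apply/allP => -[c v] cs /=; apply/implyP => mc; apply/eqP; exact: h.
Qed.

Lemma fsatI s t u : fsat (s ++ t) u <-> fsat s u /\ fsat t u.
Proof. by rewrite /fsat all_cat; split=> /andP. Qed.

Lemma fcomplete (s : nat -> seq (I * V)) :
  (forall i, exists u, fsat (s i) u) ->
  (forall i u, fsat (s i.+1) u -> fsat (s i) u) ->
  exists u, forall i, fsat (s i) u.
Proof.
move=> nes mon.
have monl i j u : i <= j -> fsat (s j) u -> fsat (s i) u.
  by elim: j => [|j IH]; [case: i|rewrite leq_eqVlt => /orP[/eqP->//|/IH h /mon /h]].
have /choice[f fP] : forall c, exists v, forall i v', (c, v') \in s i -> mask c -> v = v'.
  move=> c; have [[i [v cs]]|n] := pselect (exists i v, (c, v) \in s i).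
    exists v => j v' cs' mc; have [u us] := nes (maxn i j).
    have /fsatP/(_ _ _ cs mc) <- := monl _ _ u (leq_maxl i j) us.
    by have /fsatP/(_ _ _ cs' mc) := monl _ _ u (leq_maxr i j) us.
  by exists v0 => i v' h; case: n; exists i, v'.
exists (mk f) => i; apply/fsatP => c v cs mc; rewrite evmk; exact: fP cs mc.
Qed.

Definition fun_cspace : cspace :=
  @CSpace T (seq (I * V)) fsat [::] (fun _ => isT) cat fsatI fcomplete.
End FunSpace.

(** * Back-and-forth equivalences of countable structures *)

Section BackAndForth.
Variable ar : nat -> nat.
Implicit Types (M N K : Str ar) (p q r : seq nat).

Definition atom M i (s : seq nat) : bool :=
  if insub s is Some t then M i t else false.

(** The quantifier-free type of a tuple under one countable index: tag 0 codes its length, tag 1 an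
    equality of entries, all other tags an atomic formula. *)
Definition qbit M p (c : nat * nat * seq nat) : bool :=
  let: (tag, i, s) := c in
  match tag with
  | 0 => size p == i
  | 1 => [&& i < size p, head 0 s < size p & nth 0 p i == nth 0 p (head 0 s)]
  | _ => all (fun j => j < size p) s && atom M i (map (nth 0 p) s)
  end.

Definition qf M p N q := forall c, qbit M p c = qbit N q c.

(** Countable ordinals as well-founded trees: [OS f] is a rank above every [f n], which covers
    successors and countable suprema alike. *)
Inductive ord := OZ | OS of nat -> ord.

Fixpoint bf w M p N q : Prop :=
  match w with
  | OZ => True
  | OS f => qf M p N q /\ forall n, [/\ bf (f n) M p N q,
      forall a, exists b, bf (f n) M (rcons p a) N (rcons q b) &
      forall b, exists a, bf (f n) M (rcons p a) N (rcons q b)]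
  end.

Lemma bf_sym w M p N q : bf w M p N q -> bf w N q M p.
Proof.
elim: w M p N q => [//|f IH] M p N q [h1 h2]; split=> [c|n]; first by rewrite h1.
have [ha hb hc] := h2 n; split; first exact: IH.
- by move=> a; have [b /IH] := hc a; exists b.
- by move=> a; have [b /IH] := hb a; exists b.
Qed.

Lemma bf_trans w M p N q K r : bf w M p N q -> bf w N q K r -> bf w M p K r.
Proof.
elim: w M p N q K r => [//|f IH] M p N q K r [h1 h2] [k1 k2].
split=> [c|n]; first by rewrite h1.
have [ha hb hc] := h2 n; have [ka kb kc] := k2 n; split.
- exact: IH ha ka.
- by move=> a; have [b hab] := hb a; have [c hbc] := kb b; exists c; exact: IH hab hbc.
- by move=> a; have [b hab] := kc a; have [c hbc] := hc b; exists c; exact: IH hbc hab.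
Qed.

Lemma iso_bf w M N p : iso_str M N -> exists q, bf w M p N q.
Proof.
move=> [f [bf0 fP]]; exists (map f p).
have finj := bij_inj bf0; have [g fK gK] := bf0.
have atomE i s : atom N i (map f s) = atom M i s.
  rewrite /atom; case: (@insubP _ _ _ s) => [t st ts|nst].
    rewrite -fP; case: insubP => [t' _ ts'|]; last by rewrite size_map st.
    by congr (N i _); apply: val_inj; rewrite /= ts' ts.
  by case: insubP => // t'; rewrite size_map => h; rewrite h in nst.
elim: w p => [//|h IH] p; split=> [[[tag i] s]|n].
  case: tag => [|[|_]] /=; rewrite size_map //.
    case: (ltnP i (size p)) => //= ip; case: (ltnP (head 0 s) (size p)) => //= sp.
    by rewrite !(nth_map 0) // (inj_eq finj).
  have [/allP sp|] := boolP (all _ s) => //=; rewrite -atomE -map_comp.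
  by congr (atom _ _ _); apply/eq_in_map => j /sp jp /=; rewrite (nth_map 0).
split; first exact: IH.
- by move=> a; exists (f a); rewrite -map_rcons; exact: IH.
- by move=> b; exists (g b); rewrite -{2}(gK b) -map_rcons; exact: IH.
Qed.

Lemma back_forth_iso M N (R : seq nat -> seq nat -> Prop) :
  R [::] [::] -> (forall p q, R p q -> qf M p N q) ->
  (forall p q, R p q -> forall a, exists b, R (rcons p a) (rcons q b)) ->
  (forall p q, R p q -> forall b, exists a, R (rcons p a) (rcons q b)) ->
  iso_str M N.
Proof.
move=> R0 Rqf forth back.
have Rsz p q : R p q -> size p = size q.
  by move=> /Rqf /(_ (0, size p, [::])) /=; rewrite eqxx => /esym/eqP.
pose st := {pq : seq nat * seq nat | R pq.1 pq.2}.
(* Round [n] answers [n] on the left and then [n] on the right, so entry 2n of [P] and entry 2n+1 of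
   [Q] are both [n]. The isomorphism and its inverse are read off at these positions. *)
have /choice[nx nxP] : forall x : nat * st, exists y : st, exists a b,
    (proj1_sig y).1 = rcons (rcons (proj1_sig x.2).1 x.1) a /\
    (proj1_sig y).2 = rcons (rcons (proj1_sig x.2).2 b) x.1.
  move=> [n [[p q] /= Rpq]].
  have [b Rb] := forth _ _ Rpq n; have [a Ra] := back _ _ Rb n.
  by exists (exist _ (rcons (rcons p n) a, rcons (rcons q b) n) Ra), a, b.
pose c := fix c i : st := if i is j.+1 then nx (j, c j) else exist _ ([::], [::]) R0.
pose P n := (proj1_sig (c n)).1; pose Q n := (proj1_sig (c n)).2.
have RPQ n : R (P n) (Q n) := proj2_sig (c n).
have [stepP stepQ] : (forall n, exists a, P n.+1 = rcons (rcons (P n) n) a) /\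
                     (forall n, exists b, Q n.+1 = rcons (rcons (Q n) b) n).
  by split=> n; have [a [b [h1 h2]]] := nxP (n, c n); [exists a|exists b].
have szP n : size (P n) = n.*2.
  by elim: n => // n IH; have [a ->] := stepP n; rewrite !size_rcons IH.
have szQ n : size (Q n) = n.*2 by rewrite -(Rsz _ _ (RPQ n)).
have stabP m n j : m <= n -> j < m.*2 -> nth 0 (P n) j = nth 0 (P m) j.
  move=> + jm; elim: n => [|n IH]; first by rewrite leqn0 => /eqP ->.
  rewrite leq_eqVlt => /orP[/eqP -> //|mn]; have [a ->] := stepP n.
  have jn : j < n.*2 by rewrite (leq_trans jm) // leq_double.
  by rewrite !nth_rcons size_rcons szP ltnS (ltnW jn) jn IH.
have stabQ m n j : m <= n -> j < m.*2 -> nth 0 (Q n) j = nth 0 (Q m) j.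
  move=> + jm; elim: n => [|n IH]; first by rewrite leqn0 => /eqP ->.
  rewrite leq_eqVlt => /orP[/eqP -> //|mn]; have [a ->] := stepQ n.
  have jn : j < n.*2 by rewrite (leq_trans jm) // leq_double.
  by rewrite !nth_rcons size_rcons szQ ltnS (ltnW jn) jn IH.
pose p j := nth 0 (P j.+1) j; pose q j := nth 0 (Q j.+1) j.
have jj j : j < j.+1.*2 by rewrite -addnn; exact: leq_addr.
have pE n j : j < n -> nth 0 (P n) j = p j by move=> jn; rewrite (stabP j.+1).
have qE n j : j < n -> nth 0 (Q n) j = q j by move=> jn; rewrite (stabQ j.+1).
have pev j : p j.*2 = j.
  have jd : j <= j.*2 by rewrite -addnn leq_addr.
  rewrite /p (stabP j.+1) ?ltnS //.
  by have [a ->] := stepP j; rewrite !nth_rcons size_rcons szP ltnSn ltnn eqxx.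
have qod j : q j.*2.+1 = j.
  have jd : j <= j.*2 by rewrite -addnn leq_addr.
  rewrite /q (stabQ j.+1) ?doubleS ?ltnS //; last by rewrite ltnW.
  by have [a ->] := stepQ j; rewrite nth_rcons size_rcons szQ ltnn eqxx.
have pqeq i j : (p i == p j) = (q i == q j).
  pose n := (maxn i j).+1.
  have lei : i < n by rewrite ltnS leq_maxl.
  have lej : j < n by rewrite ltnS leq_maxr.
  have nn : n <= n.*2 by rewrite -addnn leq_addr.
  have := Rqf _ _ (RPQ n) (1, i, [:: j]).
  rewrite /qbit /= szP szQ !(leq_trans _ nn) //=.
  by rewrite !pE // !qE.
pose f m := q m.*2; pose g m := p m.*2.+1.
have fp j : f (p j) = q j by apply/eqP; rewrite /f -pqeq pev.
have gq j : g (q j) = p j by apply/eqP; rewrite /g pqeq qod.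
exists f; split; first exists g => m.
- by rewrite /f gq pev.
- by rewrite /g fp qod.
move=> i t.
pose n := (\max_(j <- t) j.*2).+1.
have tn j : j \in tval t -> j.*2 < n by move=> jt; rewrite ltnS; exact: (@leq_bigmax_seq _ _ predT double).
have nn : n <= n.*2 by rewrite -addnn leq_addr.
have := Rqf _ _ (RPQ n) (2, i, map double t).
rewrite /qbit szP szQ.
have -> : all (fun j => j < n.*2) (map double t).
  by apply/allP => _ /mapP[j /tn jn ->]; exact: leq_trans nn.
rewrite -!map_comp /=.
have -> : [seq (nth 0 (P n) \o double) j | j <- t] = t.
  by rewrite -[RHS]map_id; apply/eq_in_map => j /tn jn /=; rewrite pE.
have -> : [seq (nth 0 (Q n) \o double) j | j <- t] = map_tuple f t.
  by apply/eq_in_map => j /tn jn /=; rewrite qE.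
by rewrite /atom !valK.
Qed.
End BackAndForth.

(** * Points, truncation and renaming of rows *)

Definition ltb (i : nat) (n : natinf) : bool := if n is Fin m then i < m else true.

Lemma ltbP i n : ltinf i n <-> ltb i n.
Proof. by case: n. Qed.

Lemma ltb_leq i j n : i <= j -> ltb j n -> ltb i n.
Proof. by case: n => //= m; exact: leq_ltn_trans. Qed.

Definition tr n (x : Pt) : Pt := fun i => if ltb i n then x i else zero2.
Definition glc (b : pred (nat * nat * nat)) (x y : Pt) : Pt :=
  fun j l m => if b (j, l, m) then x j l m else y j l m.
Definition glue k := glc (fun c => c.1.1 < k).

Lemma glue_lt k x y j : j < k -> glue k x y j = x j.
Proof. by move=> jk; apply/funext => l; apply/funext => m; rewrite /glue /glc /= jk. Qed.

Lemma glue_ge k x y j : k <= j -> glue k x y j = y j.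
Proof.
by move=> kj; apply/funext => l; apply/funext => m; rewrite /glue /glc /= ltnNge kj.
Qed.
(** The columns of a level are the rows of the level below and are renamed with them; the columns of
    level 0 are the bits of reals and stay. *)
Definition pre (tau : nat -> nat -> nat) (j m : nat) := if j is j'.+1 then tau j' m else m.
Definition ren (tau : nat -> nat -> nat) (x : Pt) : Pt :=
  fun j l m => x j (tau j l) (pre tau j m).
Definition surj (f : nat -> nat) := forall m, exists l, f l = m.

(** Unlike [a], this has the reals as its level 0, so inductions treat all levels alike. *)
Fixpoint hval (x : Pt) j (l : nat) : V j :=
  match j return V j with
  | 0 => x 0 l
  | j'.+1 => fun z => exists k, x j'.+1 l k = true /\ z = hval x j' k
  end.
Arguments hval x j l : clear implicits.

Lemma a_val x j l : a x j l = hval x j.+1 l.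
Proof.
by elim: j l => [//|j IH] l; apply/funext => z /=; apply/propext; split=> -[k [xk ->]];
  exists k; split=> //; rewrite -?IH ?IH.
Qed.

Lemma AA_val x j z : AA x j z <-> exists k, z = hval x j k.
Proof. by case: j z => [//|j] z; split=> -[k ->]; exists k; rewrite a_val. Qed.

Lemma AA_eq x y j :
  (forall k, exists l, hval x j k = hval y j l) ->
  (forall k, exists l, hval y j k = hval x j l) -> AA x j = AA y j.
Proof.
move=> h1 h2; apply/funext => z; apply/propext; split=> /AA_val[k ->]; apply/AA_val.
  exact: h1.
exact: h2.
Qed.

Lemma AA_ex x y j k : AA x j = AA y j -> exists l, hval x j k = hval y j l.
Proof. by move=> e; apply/AA_val; rewrite -e; apply/AA_val; exists k. Qed.

Lemma val_ren tau x j l : (forall j, surj (tau j)) ->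
  hval (ren tau x) j l = hval x j (tau j l).
Proof.
move=> su; elim: j l => [//|j IH] l /=; apply/funext => z; apply/propext.
split=> -[k [xk ->]]; first by exists (tau j k); rewrite -IH.
by have [k' kE] := su j k; exists k'; rewrite IH /ren /= kE.
Qed.

Lemma AA_ren tau x j : (forall j, surj (tau j)) -> AA (ren tau x) j = AA x j.
Proof.
move=> su; apply: AA_eq => k.
  by exists (tau j k); rewrite val_ren.
by have [l lk] := su j k; exists l; rewrite val_ren // lk.
Qed.

Lemma val_cong x y j l : (forall i, i <= j -> x i = y i) -> hval x j l = hval y j l.
Proof.
elim: j l => [|j IH] l h /=; first by rewrite h.
apply/funext => z; apply/propext; split=> -[k [xk ->]]; exists k; rewrite IH ?(h j.+1) //.
- by split=> //; rewrite -h.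
- by move=> i ij; apply: h; exact: leqW.
- by move=> i ij; rewrite h // leqW.
Qed.

Lemma AA_cong x y j : (forall i, i <= j -> x i = y i) -> AA x j = AA y j.
Proof. by move=> h; apply: AA_eq => k; exists k; rewrite (val_cong k h). Qed.

Lemma AA_tr n x j : ltb j n -> AA (tr n x) j = AA x j.
Proof. by move=> jn; apply: AA_cong => i ij; rewrite /tr (ltb_leq ij jn). Qed.

Lemma AA_restr k x j : j < k -> AA (restr k x) j = AA x j.
Proof. by move=> jk; apply: AA_cong => i ij; rewrite /restr (leq_ltn_trans ij jk). Qed.

Lemma tr_out n x i : ~~ ltb i n -> tr n x i = zero2.
Proof. by rewrite /tr => /negbTE ->. Qed.

Lemma tr_id n x : Xn n x -> tr n x = x.
Proof.
move=> [z _]; apply/funext => i; rewrite /tr; case: ifP => // /negbT nin.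
by rewrite z // => /ltbP; exact/negP.
Qed.

Section XnFacts.
Variables (n : natinf) (x : Pt).
Hypothesis Xx : Xn n x.

Lemma Xn_up i m : ltb i.+1 n -> exists k, x i.+1 k m = true.
Proof. by case: Xx => _ h /ltbP /(h i.+1 isT) [h1 _]. Qed.

Lemma Xn_col i k l1 l2 : ltb i.+1 n -> x i l1 = x i l2 -> x i.+1 k l1 = x i.+1 k l2.
Proof. by case: Xx => _ h /ltbP /(h i.+1 isT) [_ [_ h1]]; exact: h1. Qed.

Lemma val_row i l1 l2 : ltb i n -> hval x i l1 = hval x i l2 -> x i l1 = x i l2.
Proof.
elim: i l1 l2 => [//|i IH] l1 l2 lin e.
have lin' : ltb i n by exact: ltb_leq lin.
have h l l' k : hval x i.+1 l = hval x i.+1 l' -> x i.+1 l k -> x i.+1 l' k.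
  move=> el xk; have : hval x i.+1 l (hval x i k) by exists k.
  by rewrite el => -[k' [xk' /(IH _ _ lin') /(Xn_col l' lin) ->]].
by apply/funext => k; apply/idP/idP; exact: h.
Qed.

Lemma val_mem i l k : ltb i.+1 n -> hval x i.+1 l (hval x i k) <-> x i.+1 l k.
Proof.
move=> lin; split=> [[k' [xk' /val_row e]]|xk]; last by exists k.
by rewrite (Xn_col l lin (e (ltb_leq (leqnSn i) lin))).
Qed.
End XnFacts.

(** Condition (1) puts every set of level [j] into a set of level [j.+1], so each level determines
    the ones below. *)
Lemma AA_down n x y j : Xn n x -> Xn n y -> ltb j.+1 n ->
  AA x j.+1 = AA y j.+1 -> AA x j = AA y j.
Proof.
have h u v k : Xn n u -> ltb j.+1 n -> AA u j.+1 = AA v j.+1 ->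
    exists l, hval u j k = hval v j l.
  move=> Xu lj e; have [l xl] := Xn_up Xu k lj; have [l' le] := AA_ex l e.
  have : hval u j.+1 l (hval u j k) by exists k.
  by rewrite le => -[k' [_ ->]]; exists k'.
by move=> Xx Xy lj e; apply: AA_eq => k; [exact: h e|exact: h (esym e)].
Qed.

Lemma AA_le n x y j i : Xn n x -> Xn n y -> ltb j n -> i <= j ->
  AA x j = AA y j -> AA x i = AA y i.
Proof.
move=> Xx Xy; elim: j => [|j IH] lj; first by rewrite leqn0 => /eqP ->.
rewrite leq_eqVlt => /orP[/eqP -> //|ij] e.
by apply: IH => //; [exact: ltb_leq (leqnSn j) lj|exact: (AA_down Xx Xy lj e)].
Qed.

Lemma FrelP n x y : Xn n x -> Xn n y ->
  Frel n x y <-> forall j, ltb j n -> AA x j = AA y j.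
Proof.
move=> Xx Xy; case: n Xx Xy => [[|m]|] Xx Xy /=; [by split| |by split=> h j //; exact: h].
split=> [e j|h]; last exact: h.
by rewrite ltnS => jn; apply: (AA_le Xx Xy) e => /=.
Qed.

(** Conditions (1) and (2) at all levels, with (3) strengthened to distinct rows. These codes are
    comeager among all codes and list each set exactly once. *)
Definition std (x : Pt) :=
  [/\ forall i m, exists k, x i.+1 k m = true,
      forall i k, exists m, x i.+1 k m = true &
      forall i l1 l2, x i l1 = x i l2 -> l1 = l2].

Lemma tr_ren n tau x : tr n (ren tau x) = ren tau (tr n x).
Proof.
by apply/funext => i; rewrite /ren /tr; case: (ltb i n).
Qed.

Lemma ren_Xn n tau x : std x -> (forall j, surj (tau j)) -> Xn n (tr n (ren tau x)).
Proof.
move=> [h1 h2 h3] su; split=> [i /ltbP/negP|[//|i] _ /ltbP lin]; first exact: tr_out.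
have lin' : ltb i n by exact: ltb_leq lin.
rewrite /tr /= lin lin' /ren /=; split; [|split].
- move=> m; have [k xk] := h1 i (tau i m); have [k' kE] := su i.+1 k.
  by exists k'; rewrite kE.
- move=> k; have [m xm] := h2 i (tau i.+1 k); have [m' mE] := su i m.
  by exists m'; rewrite mE.
- move=> k l1 l2 e; have -> // : tau i l1 = tau i l2.
  apply: (h3 i); apply/funext => m.
  have [m' mE] : exists m', pre tau i m' = m by case: (i) => [|i']; [exists m|exact: su].
  by have /(congr1 (@^~ m')) := e; rewrite mE.
Qed.

Lemma ren_id x : ren (fun _ l => l) x = x.
Proof. by apply/funext => -[|i]. Qed.

Lemma std_Xn n x : std x -> Xn n (tr n x).
Proof. by move=> sx; rewrite -(ren_id x); apply: ren_Xn => // j m; exists m. Qed.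

Lemma ren_Frel n tau x : std x -> (forall j, surj (tau j)) ->
  Frel n (tr n x) (tr n (ren tau x)).
Proof.
move=> sx su; apply/FrelP; [exact: std_Xn|exact: ren_Xn|] => j _.
by rewrite tr_ren AA_ren.
Qed.

(** * The space of all codes *)

Section PtSpace.
Definition I3 : countType := (nat * nat * nat)%type.
Implicit Types (mask : pred I3).
Definition evPt (x : Pt) (c : I3) : bool := x c.1.1 c.1.2 c.2.
Definition mkPt (f : I3 -> bool) : Pt := fun i l k => f (i, l, k).

Lemma evmkPt f c : evPt (mkPt f) c = f c.
Proof. by case: c => [[i l] k]. Qed.

Definition ptS mask : cspace := fun_cspace mask false evmkPt.
Definition PS := ptS predT.

Lemma psatP (s : cd PS) x : sat s x <-> forall c v, (c, v) \in s -> evPt x c = v.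
Proof. by split=> [/fsatP h c v /h|h]; [exact|apply/fsatP => c v /h]. Qed.

Definition dom (s : seq (I3 * bool)) : seq I3 := map fst s.
Definition cond_of (x : Pt) (cs : seq I3) : seq (I3 * bool) := [seq (c, evPt x c) | c <- cs].

Lemma cond_ofP x cs y : @sat PS (cond_of x cs) y <-> forall c, c \in cs -> evPt y c = evPt x c.
Proof.
rewrite psatP; split=> [h c cin|h c v /mapP[d din [-> ->]]]; last exact: h.
by apply: h; apply: map_f.
Qed.

Lemma sat_cond_of x cs : @sat PS (cond_of x cs) x.
Proof. exact/cond_ofP. Qed.

Lemma cond_of_sub x cs s : sat (s : cd PS) x -> {subset dom s <= cs} ->
  @sub PS (cond_of x cs) s.
Proof.
move=> /psatP sx ds y /cond_ofP h; apply/psatP => c v cs'.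
by rewrite h; [exact: sx|apply: ds; apply/mapP; exists (c, v)].
Qed.

Lemma sat_eq s x y : sat (s : cd PS) x -> (forall c, c \in dom s -> evPt y c = evPt x c) ->
  @sat PS s y.
Proof.
move=> /psatP sx e; apply/psatP => c v cs; rewrite e; first exact: sx.
by apply/mapP; exists (c, v).
Qed.

Lemma bp_coord (A : cspace) (h : A -> Pt) (B : Pt -> Prop) :
  (forall i l k b, bp (fun u => h u i l k = b)) -> borel cylPt B -> bp (B \o h).
Proof. by move=> hc; apply: borel_bp => S [i [l [k [b ->]]]]; exact: hc. Qed.

Lemma bp_pt i l k b : @bp PS (fun x => x i l k = b).
Proof.
apply: bp_eq (@bp_sat PS [:: ((i, l, k), b)]) => x.
by rewrite psatP; split=> [h|<- c v]; [exact: h (mem_head _ _)|rewrite inE => /eqP[-> ->]].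
Qed.

(** A condition refining the glued one splits into its coordinates in [b], which constrain the first
    factor, and the others, which constrain the second. *)
Lemma cm_glue mask (b : pred I3) (S : Pt -> Prop) :
  (forall c, b c -> mask c) -> @comeager PS S ->
  @comeager (prod_cspace (ptS mask) PS) (fun u => S (glc b u.1 u.2)).
Proof.
move=> bm; apply: (@cm_map (prod_cspace (ptS mask) PS) PS (fun u => glc b u.1 u.2)).
move=> [s t] [[x y] [/= sx ty]].
pose r := cond_of (glc b x y) (dom s ++ dom t).
exists r; split; first by exists (glc b x y); exact: sat_cond_of.
move=> t' [w wt'] sub'; have /cond_ofP wr := sub' _ wt'.
exists (s ++ [seq cv <- t' | b cv.1], t ++ [seq cv <- t' | ~~ b cv.1]); split.
- have evg u v c : evPt (glc b u v) c = if b c then evPt u c else evPt v c.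
    by case: c => [[i l] m].
  exists (glc b w x, glc b y w); split; apply/fsatI; split=> /=.
  + move/fsatP: sx => sx; apply/fsatP => c v cs mc; rewrite evg.
    rewrite -(sx _ _ cs mc); case: ifP => // bc; rewrite wr ?evg ?bc //.
    by rewrite mem_cat; apply/orP; left; apply/mapP; exists (c, v).
  + apply/fsatP => c v; rewrite mem_filter /= => /andP[bc ct] _.
    by rewrite evg bc; move/psatP: wt' => /(_ _ _ ct).
  + move/fsatP: ty => ty; apply/fsatP => c v cs mc; rewrite evg.
    rewrite -(ty _ _ cs mc); case: ifP => // bc; rewrite wr ?evg ?bc //.
    by rewrite mem_cat; apply/orP; right; apply/mapP; exists (c, v).
  + apply/fsatP => c v; rewrite mem_filter /= => /andP[bc ct] _.
    by rewrite evg (negbTE bc); move/psatP: wt' => /(_ _ _ ct).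
- by move=> [u v] [/= /fsatI[? _] /fsatI[? _]].
- move=> [u v] [/= /fsatI[_ /fsatP hu] /fsatI[_ /psatP hv]].
  apply/psatP => -[[i l] m] z cz; rewrite /evPt /= /glc; case: ifPn => bc.
    by apply: (hu (i, l, m)); [rewrite mem_filter /= bc|exact: bm].
  by apply: (hv (i, l, m)); rewrite mem_filter /= bc.
Qed.

Lemma cm_ren tau tau' (S : Pt -> Prop) :
  (forall j, cancel (tau j) (tau' j)) -> (forall j, cancel (tau' j) (tau j)) ->
  @comeager PS S -> @comeager PS (fun x => S (ren tau x)).
Proof.
move=> k1 k2; apply: (@cm_map PS PS (ren tau)).
pose h t (c : I3) : I3 := (c.1.1, t c.1.1 c.1.2, pre t c.1.1 c.2).
have hK : cancel (h tau) (h tau').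
  by move=> [[[|i] l] k]; rewrite /h /= ?k1.
have hK' : cancel (h tau') (h tau).
  by move=> [[[|i] l] k]; rewrite /h /= ?k2.
have evr x c : evPt (ren tau x) c = evPt x (h tau c) by [].
pose H t (s : seq (I3 * bool)) := [seq (h t cv.1, cv.2) | cv <- s].
have satH s x : @sat PS (H tau s) x <-> @sat PS s (ren tau x).
  rewrite !psatP; split=> [hh c v cs|hh c v /mapP[[d w] dw [-> ->]] /=].
    by rewrite evr; apply: hh; apply/mapP; exists (c, v).
  by rewrite -evr; exact: hh.
have HK s : H tau (H tau' s) = s.
  by rewrite /H -map_comp -[RHS]map_id; apply/eq_map => -[c v] /=; rewrite hK'.
move=> s [x sx]; exists (H tau' s); split.
  by exists (ren tau x); apply/satH; rewrite HK.
move=> t' [y yt'] sub'; exists (H tau t'); split.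
- exists (ren tau' y); apply/satH.
  have -> // : ren tau (ren tau' y) = y.
  by apply/funext => -[|j]; apply/funext => l; apply/funext => m; rewrite /ren /= ?k1.
- by move=> u /satH /sub' /satH; rewrite HK.
- by move=> u /satH.
Qed.

Lemma cm_dense1 (P : Pt -> Prop) :
  (forall s, @ne PS s -> exists t, [/\ @ne PS t, sub t s & forall x, @sat PS t x -> P x]) ->
  @comeager PS P.
Proof.
move=> h; exists (fun _ t => forall x, @sat PS t x -> P x); split=> [_ //|x].
by move=> /(_ 0)[t [tP /tP]].
Qed.

Definition set1 (x : Pt) (c : I3) v : Pt := mkPt (fun d => if d == c then v else evPt x d).

Lemma ev_set1 x c v d : evPt (set1 x c v) d = if d == c then v else evPt x d.
Proof. by rewrite evmkPt. Qed.

Definition bound (s : seq I3) : nat := (\max_(c <- s) (c.1.1 + c.1.2 + c.2)).+1.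

Lemma boundP s c : c \in s -> [/\ c.1.1 < bound s, c.1.2 < bound s & c.2 < bound s].
Proof.
move=> cs; have : c.1.1 + c.1.2 + c.2 <= \max_(c <- s) (c.1.1 + c.1.2 + c.2).
  exact: (@leq_bigmax_seq _ _ predT (fun c : I3 => c.1.1 + c.1.2 + c.2)).
move=> h; rewrite /bound !ltnS; split; apply: leq_trans h.
- by rewrite -addnA leq_addr.
- by rewrite -addnA addnCA leq_addr.
- exact: leq_addl.
Qed.

Lemma add1_cond s x c v : @sat PS s x -> c \notin dom s ->
  @ne PS ((c, v) :: s) /\ @sub PS ((c, v) :: s) s.
Proof.
move=> sx cs; split; last by move=> y /andP[].
exists (set1 x c v); apply/psatP => d w.
rewrite inE ev_set1 => /orP[/eqP[-> ->]|ds]; first by rewrite eqxx.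
case: eqP => [e|_]; last by move/psatP: sx; exact.
by case/negP: cs; rewrite -e; apply/mapP; exists (d, w).
Qed.

Lemma cm_std : @comeager PS std.
Proof.
have far s i l : (i, l, bound (dom s)) \notin dom s.
  by apply/negP => /boundP[_ _] /=; rewrite ltnn.
have far' s i l : (i, bound (dom s), l) \notin dom s.
  by apply/negP => /boundP[_] /=; rewrite ltnn.
have c1 : @comeager PS (fun x => forall im : nat * nat, exists k, x im.1.+1 k im.2 = true).
  apply: cm_all => -[i m]; apply: cm_dense1 => s [x sx].
  have [net ts] := add1_cond true sx (far' s i.+1 m).
  exists (((i.+1, bound (dom s), m), true) :: s); split=> // y /psatP h.
  by exists (bound (dom s)); exact: (h (i.+1, bound (dom s), m) true (mem_head _ _)).
have c2 : @comeager PS (fun x => forall im : nat * nat, exists k, x im.1.+1 im.2 k = true).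
  apply: cm_all => -[i m]; apply: cm_dense1 => s [x sx].
  have [net ts] := add1_cond true sx (far s i.+1 m).
  exists (((i.+1, m, bound (dom s)), true) :: s); split=> // y /psatP h.
  by exists (bound (dom s)); exact: (h (i.+1, m, bound (dom s)) true (mem_head _ _)).
have c3 : @comeager PS (fun x => forall ill : nat * nat * nat,
    x ill.1.1 ill.1.2 = x ill.1.1 ill.2 -> ill.1.2 = ill.2).
  apply: cm_all => -[[i l1] l2] /=; apply: cm_dense1 => s [x sx].
  have [->|ll] := eqVneq l1 l2; first by exists s; split=> //; exists x.
  have [[x' sx'] ts] := add1_cond true sx (far s i l1).
  pose s' := ((i, l1, bound (dom s)), true) :: s.
  have nin : (i, l2, bound (dom s)) \notin dom s'.
    by rewrite /s' /= inE negb_or far andbT; apply/eqP => -[e]; rewrite e eqxx in ll.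
  have [net ts'] := add1_cond false sx' nin.
  exists (((i, l2, bound (dom s)), false) :: s'); split=> //.
    exact: sub_trans ts ts'.
  move=> y /psatP h e.
  have h1 := h (i, l1, bound (dom s)) true.
  have h2 := h (i, l2, bound (dom s)) false.
  move: h1 h2; rewrite /evPt /= e !inE !eqxx orbT => /(_ isT) -> /(_ isT) //.
apply: cm_mono (cm_and c1 (cm_and c2 c3)) => x [h1 [h2 h3]]; split.
- by move=> i m; exact: (h1 (i, m)).
- by move=> i m; exact: (h2 (i, m)).
- by move=> i l1 l2; exact: (h3 (i, l1, l2)).
Qed.
End PtSpace.

(** * Generic analysis at one level *)

Lemma val_inj_std x i l1 l2 : std x -> hval x i l1 = hval x i l2 -> l1 = l2.
Proof.
move=> sx; have := @std_Xn Omega x sx; rewrite -/x => X.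
have e : tr Omega x = x by [].
by rewrite e in X; move=> /(val_row X (isT : ltb i Omega)); case: sx => _ _; apply.
Qed.

Lemma val_mem_std x i l k : std x -> hval x i.+1 l (hval x i k) <-> x i.+1 l k.
Proof.
move=> sx; have X := @std_Xn Omega x sx.
have e : tr Omega x = x by [].
by rewrite e in X; exact: (val_mem X l k (isT : ltb i.+1 Omega)).
Qed.

(** Standard codes list without repetition, so equal levels below [k] are matched by bijections.
    These also permute the columns of level [k], which is why [y] is renamed by the inverse. *)
Lemma same_levels_ren k w w' : std w -> std w' ->
  (forall j, j < k -> AA w j = AA w' j) ->
  exists tau tau' : nat -> nat -> nat,
    [/\ forall j, cancel (tau j) (tau' j), forall j, cancel (tau' j) (tau j) &
    forall y, glue k w y = ren tau (glue k w' (ren tau' y))].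
Proof.
move=> sw sw' e.
have ex u v : (forall j, j < k -> AA u j = AA v j) -> exists tau : nat -> nat -> nat,
    forall j l, (j < k -> hval u j l = hval v j (tau j l)) /\ (k <= j -> tau j l = l).
  move=> h; have /choice[F FP] : forall jl : nat * nat, exists l',
      (jl.1 < k -> hval u jl.1 jl.2 = hval v jl.1 l') /\ (k <= jl.1 -> l' = jl.2).
    move=> [j l] /=; case: (ltnP j k) => jk; last by exists l.
    by have [l' ->] := AA_ex l (h j jk); exists l'.
  by exists (fun j l => F (j, l)) => j l; have := FP (j, l).
have [tau tauP] := ex _ _ e.
have [tau' tauP'] := ex w' w (fun j jk => esym (e j jk)).
have c1 j : cancel (tau j) (tau' j).
  move=> l; case: (ltnP j k) => jk; last by rewrite (tauP' _ _).2 // (tauP _ _).2.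
  by apply: (@val_inj_std w j) => //; rewrite -(tauP' _ _).1 // -(tauP _ _).1.
have c2 j : cancel (tau' j) (tau j).
  move=> l; case: (ltnP j k) => jk; last by rewrite (tauP _ _).2 // (tauP' _ _).2.
  by apply: (@val_inj_std w' j) => //; rewrite -(tauP _ _).1 // -(tauP' _ _).1.
exists tau, tau'; split=> // y.
apply/funext => j; apply/funext => l; apply/funext => m; rewrite /ren.
case: (ltnP j k) => jk; last first.
  rewrite !glue_ge // /ren c1; congr (y j l _); case: (j) => [//|i] /=.
  by rewrite c1.
rewrite !glue_lt //; case: j jk => [|j] jk /=.
  by have := (tauP 0 l).1 jk; rewrite /= => ->.
have jk' : j < k by exact: ltnW.
have e1 := (tauP j.+1 l).1 jk; have e2 := (tauP j m).1 jk'.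
apply/idP/idP.
  by move/(val_mem_std j l m sw).2; rewrite e1 e2 => /(val_mem_std _ _ _ sw').
by move/(val_mem_std _ _ _ sw').2; rewrite -e1 -e2 => /(val_mem_std _ _ _ sw).
Qed.

Section Reduction.
Variables (n : natinf) (E : Pt -> Pt -> Prop) (ar : nat -> nat) (g : Pt -> Str ar).
Hypothesis Eeq : equiv_on (Xn n) E.
Hypothesis gB : borel_fun_on (@cylStr ar) (Xn n) g.
Hypothesis gE : forall x y, Xn n x -> Xn n y -> (E x y <-> iso_str (g x) (g y)).
Hypothesis EF : forall x y, Xn n x -> Xn n y -> Frel n x y -> E x y.

Definition str_of x := g (tr n x).

Definition PS2 := prod_cspace PS PS.

(* Maps along which str_of can be evaluated with the Baire property. *)
Definition tame (A : cspace) (h : A -> Pt) :=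
  (forall i l k b, bp (fun u => h u i l k = b)) /\ comeager (fun u => Xn n (tr n (h u))).

Lemma bp_qbit (A : cspace) (h : A -> Pt) p c : tame h -> bp (fun u => qbit (str_of (h u)) p c = true).
Proof.
move=> [hc hX]; case: c => [[tag i] s].
case: tag => [|[|tag]] /=; try exact: bp_const.
case: (all _ s) => /=; last exact: bp_const.
rewrite /atom; case: insub => [t|]; last exact: bp_const.
have [B [bB BP]] := gB (borel_gen (ex_intro _ i (ex_intro _ t (ex_intro _ true erefl)))).
apply: bp_ext (@bp_coord _ (fun u => tr n (h u)) B _ bB); last first.
  move=> j l k b; rewrite /tr; case: (ltb j n); [exact: hc|exact: bp_const].
by apply: cm_mono hX => u /BP e; split=> /e.
Qed.

Lemma bp_bf (A : cspace) (h1 h2 : A -> Pt) w p q : tame h1 -> tame h2 ->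
  bp (fun u => bf w (str_of (h1 u)) p (str_of (h2 u)) q).
Proof.
move=> t1 t2; elim: w p q => [|f IH] p q /=; first exact: bp_const.
apply: bp_and.
  apply: bp_cap => c.
  apply: bp_eq (bp_iff (bp_qbit p c t1) (bp_qbit q c t2)) => u.
  split=> [[h1' h2']|-> //]; first by apply/idP/idP.
apply: bp_cap => m; apply: bp_eq
  (bp_and (IH m p q) (bp_and (bp_cap (fun a => bp_cup (fun b => IH m (rcons p a) (rcons q b))))
    (bp_cap (fun b => bp_cup (fun a => IH m (rcons p a) (rcons q b)))))) => u.
by split=> [[? [? ?]]|[]].
Qed.

Lemma tame_id : @tame PS id.
Proof. by split; [exact: bp_pt|apply: cm_mono cm_std => x; exact: std_Xn]. Qed.

Lemma tame_fst (B : cspace) : @tame (prod_cspace PS B) fst.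
Proof.
split; last by apply: (@cm_fst PS B (fun x => Xn n (tr n x))); exact: tame_id.2.
move=> i l k b; apply: bp_eq (@bp_sat (prod_cspace PS B) ([:: ((i, l, k), b)], top)) => -[x y].
split=> [[/psatP h _]|h]; first exact: (h (i, l, k) b (mem_head _ _)).
split; last exact: satT.
by apply/psatP => c v; rewrite inE => /eqP[-> ->].
Qed.

Lemma bp_snd (B : cspace) i l k b : @bp (prod_cspace B PS) (fun u => u.2 i l k = b).
Proof.
apply: bp_eq (@bp_sat (prod_cspace B PS) (top, [:: ((i, l, k), b)])) => -[x y].
split=> [[_ /psatP h]|h]; first exact: (h (i, l, k) b (mem_head _ _)).
split; first exact: satT.
by apply/psatP => c v; rewrite inE => /eqP[-> ->].
Qed.

Lemma cm_gluePP k S : @comeager PS S -> @comeager PS2 (fun u => S (glue k u.1 u.2)).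
Proof. exact: cm_glue. Qed.

Lemma tame_glue k : @tame PS2 (fun u => glue k u.1 u.2).
Proof.
split; last by apply: (@cm_gluePP k (fun x => Xn n (tr n x))); exact: tame_id.2.
move=> i l m b; case: (ltnP i k) => ik.
  by apply: (@bp_eq PS2 _ _ _ ((tame_fst PS).1 i l m b)) => u; rewrite glue_lt.
by apply: (@bp_eq PS2 _ _ _ (@bp_snd PS i l m b)) => u; rewrite glue_ge.
Qed.

(** * The least rank of generic inequivalence *)

Section Level.
Variable k : nat.
Hypothesis kn : ltb k n.

Definition gen_equiv w := @comeager PS2 (fun u =>
  forall p, exists q, bf w (str_of u.1) p (str_of (glue k u.1 u.2)) q).

(** A uniform Scott rank: conditions with pairs of tuples are countably many, so one [w0] lies
    above, for each of them, some rank at which it forces inequivalence, whenever there is one.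
    Generically one rank more then adds nothing, and [bf w0] is a back-and-forth system. *)
Lemma T_iso : (forall w, gen_equiv w) ->
  @comeager PS2 (fun u => iso_str (str_of u.1) (str_of (glue k u.1 u.2))).
Proof.
move=> aT.
pose data : countType := (cd PS2 * (seq nat * seq nat))%type.
pose bad w (d : data) := @forces PS2 d.1
  (fun u => ~ bf w (str_of u.1) d.2.1 (str_of (glue k u.1 u.2)) d.2.2).
have /choice[W WP] : forall d, exists w, forall w', bad w' d -> bad w d.
  move=> d; have [[w bw]|nb] := pselect (exists w, bad w d); first by exists w.
  by exists OZ => w' bw'; case: nb; exists w'.
pose w0 := OS (fun m => if @unpickle data m is Some d then W d else OZ).
have w0bad w d : bad w d -> bad w0 d.
  move=> /WP; apply: forces_mono => u nb [_ /(_ (pickle d))].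
  by rewrite pickleK => -[/nb].
pose w1 := OS (fun _ => w0).
have tf := tame_fst PS; have tg := tame_glue k.
have stable : @comeager PS2 (fun u => forall p q,
    bf w0 (str_of u.1) p (str_of (glue k u.1 u.2)) q -> bf w1 (str_of u.1) p (str_of (glue k u.1 u.2)) q).
  have bA (pq : seq nat * seq nat) : @bp PS2 (fun u =>
      bf w0 (str_of u.1) pq.1 (str_of (glue k u.1 u.2)) pq.2 /\
      ~ bf w1 (str_of u.1) pq.1 (str_of (glue k u.1 u.2)) pq.2).
    by apply: bp_and; [exact: bp_bf|apply: bp_compl; exact: bp_bf].
  apply: cm_mono (cm_all (fun pq => decide (bA pq))) => u h p q b0.
  apply: contrapT => nb1.
  have [|c [cu fc]] := (h (p, q)).1; first by [].
  have b1 : bad w1 (c, (p, q)) by apply: forces_mono fc => v [].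
  apply: (@forces_contra PS2 c _ _ _ (w0bad _ _ b1)); first by exists u.
  by apply: forces_mono fc => v [].
apply: cm_mono (cm_and stable (aT w1)) => u [st /(_ [::])[q [qfq /(_ 0)[b0 _ _]]]].
have q0 : q = [::].
  by have := qfq (0, 0, [::]); rewrite /= => /esym/eqP/size0nil.
rewrite q0 in b0.
apply: (@back_forth_iso _ _ _
  (fun p q => bf w0 (str_of u.1) p (str_of (glue k u.1 u.2)) q)) => //.
- by move=> p' q' [].
- by move=> p' q' /st[_ /(_ 0)[]].
- by move=> p' q' /st[_ /(_ 0)[]].
Qed.

Hypothesis not_lower : ~ exists C, comeager_in (Xn n) C /\
  forall x y, C x -> C y -> Frel (Fin k) (restr k x) (restr k y) -> E x y.

(** Otherwise comeagerly many codes are equivalent to almost all codes over their base. Two of them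
    with equal levels below [k] have the same codes over their bases up to re-enumeration, so a
    common generic [y] links them and alternative (ii) holds. *)
Lemma cm_E : ~ @comeager PS2 (fun u => iso_str (str_of u.1) (str_of (glue k u.1 u.2))).
Proof.
move=> cI; apply: not_lower.
pose S x := std x /\ @comeager PS (fun y =>
  Xn n (tr n (glue k x y)) /\ E (tr n x) (tr n (glue k x y))).
have cS : @comeager PS S.
  apply: cm_and; first exact: cm_std.
  have := kuratowski_ulam (cm_and cI (cm_and (tame_fst PS).2 (tame_glue k).2)).
  by apply: cm_mono => x; apply: cm_mono => y /= [i [Xx Xg]]; split=> //; apply/gE.
(* Points of [Xn n] are padded with zeros from level [n] on, so the comeager set is formed in the
   space that ignores those levels. *)
pose lv : pred I3 := fun c => ltb c.1.1 n.
pose S' x := exists v, S (glc lv x v).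
have : @comeager (ptS lv) S'.
  have := kuratowski_ulam (@cm_glue lv lv S (fun _ => id) cS).
  apply: cm_mono => x /ne_top[|v Sv]; last by exists v.
  by exists (fun _ _ _ => false).
have trglc x v : tr n (glc lv x v) = tr n x.
  apply/funext => i; rewrite /tr; case: ifP => // lin.
  by apply/funext => l; apply/funext => m; rewrite /glc /lv /= lin.
move=> cS'; have [D [dD DS]] := cS'.
exists (fun x => Xn n x /\ S' x); split; last first.
  move=> x x' [Xx [v [sw cw]]] [Xx' [v' [sw' cw']]] fr.
  have agree j : j < k -> AA (glc lv x v) j = AA (glc lv x' v') j.
    move=> jk; have jn : ltb j n by exact: ltb_leq (ltnW jk) kn.
    rewrite -(AA_tr _ jn) -[RHS](AA_tr _ jn) !trglc !(AA_tr _ jn).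
    case: k kn jk fr => [//|k'] kn' jk /=; rewrite !AA_restr // => e.
    apply: (AA_le Xx Xx') e => //; exact: ltb_leq (leqnSn _) kn'.
  have [tau [tau' [c1 c2 tP]]] := same_levels_ren sw sw' agree.
  have cr := cm_ren c2 c1 cw'.
  have [|y [[Xy Ey] [Xy' Ey']]] := ne_top (cm_and cw cr).
    by exists (fun _ _ _ => false).
  rewrite trglc (tr_id Xx) in Ey; rewrite trglc (tr_id Xx') in Ey'.
  have Eyy : E (tr n (glue k (glc lv x' v') (ren tau' y)))
               (tr n (glue k (glc lv x v) y)).
    apply: EF => //; apply/(FrelP Xy' Xy) => j _.
    rewrite tP tr_ren AA_ren // => j' m; exists (tau' j' m); exact: c2.
  have [_ Es Et] := Eeq.
  have E1 := Et _ _ _ Xx' Xy' Xy Ey' Eyy.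
  exact: Et Ey (Es _ _ Xx' Xy E1).
split=> [x [] //|]; exists (fun i x => exists d, D i d /\ @sat (ptS lv) d x).
split=> [i|x Xx xD]; last by split=> //; exact: DS.
split=> [x [d [Dd dx]]|W Wo [x0 [Xx0 Wx0]]].
  exists (dom d) => y xy; exists d; split=> //.
  apply/fsatP => c v cd lc; move/fsatP: dx => /(_ _ _ cd lc) <-.
  by rewrite /evPt xy //; apply/mapP; exists (c, v).
have [s sP] := Wo x0 Wx0.
pose c0 := cond_of x0 s.
have nc0 : @ne (ptS lv) c0.
  by exists x0; apply/fsatP => c v /mapP[d _ [-> ->]].
have [u uc0 [[v [sv _]] [d [Dd du]]]] :=
  baire nc0 (cm_and cS' (dense_cm (dD i))).
exists (tr n u); split.
- by rewrite -(trglc u v); exact: std_Xn.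
- apply: sP => c cs; rewrite /tr; case: ifP => lc.
    by move/fsatP: uc0 => /(_ c (evPt x0 c) (map_f _ cs) lc); rewrite /evPt => ->.
  by rewrite -{1}(tr_id Xx0) tr_out ?lc.
- exists d; split=> //; apply/fsatP => c b cd lc.
  by rewrite /evPt /tr; move: (lc); rewrite /lv => ->; move/fsatP: du => /(_ _ _ cd lc).
Qed.

Lemma minimal_rank : exists f, (forall m, gen_equiv (f m)) /\ ~ gen_equiv (OS f).
Proof.
have [w nT] : exists w, ~ gen_equiv w.
  apply: contrapT => h; apply: cm_E; apply: T_iso => w; apply: contrapT => nT.
  by apply: h; exists w.
elim: w nT => [[]|f IH nT].
  by apply: (@cm_true PS2) => u p; exists p.
have [h|nh] := pselect (forall m, gen_equiv (f m)); first by exists f.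
have [m nTm] : exists m, ~ gen_equiv (f m).
  by apply: contrapT => h; apply: nh => m; apply: contrapT => nT'; apply: h; exists m.
exact: IH nTm.
Qed.

(** One [z0] serves comeagerly many [x]. The structure of [glue k x z0] depends on the base alone,
    and its tuples name the classes at the ranks [f m]. *)
Lemma fixed_copy (f : nat -> ord) : (forall m, gen_equiv (f m)) -> exists z0,
  @comeager PS (fun x => forall m p, exists q, bf (f m) (str_of x) p (str_of (glue k x z0)) q) /\
  @comeager PS (fun x => Xn n (tr n (glue k x z0))).
Proof.
move=> Tf; have := cm_and (cm_all Tf) (tame_glue k).2.
move=> /cm_swap /kuratowski_ulam /ne_top[|z0 h]; first by exists (fun _ _ _ => false).
by exists z0; split; apply: cm_mono h => x [].
Qed.

(* gam M B fixes the rows below M of the levels in [k, M) and moves the other rows below M + B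
   of the levels >= k out of the way, beyond M + B. *)
Definition gam M B j l :=
  let fx l := (j < k) || ((j < M) && (l < M)) in
  if fx l then l else if l < M + B then l + (M + B) else
  if (l < M + B + (M + B)) && ~~ fx (l - (M + B)) then l - (M + B) else l.

Lemma gam_low M B j l : j < k -> gam M B j l = l.
Proof. by rewrite /gam => ->. Qed.

Lemma gam_fix M B j l : j < M -> l < M -> gam M B j l = l.
Proof. by rewrite /gam => -> ->; rewrite orbT. Qed.

Lemma gam_move M B j l : k <= j -> ~~ ((j < M) && (l < M)) -> l < M + B ->
  gam M B j l = l + (M + B).
Proof. by move=> kj nf lD; rewrite /gam (ltnNge j) kj /= (negbTE nf) lD. Qed.

Lemma gamK M B j : involutive (gam M B j).
Proof.
move=> l; rewrite {2}/gam; case: ifPn => [h|]; first by rewrite /gam h.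
rewrite negb_or => /andP[jk nf]; case: ifPn => lD.
  rewrite /gam (negbTE jk) /=.
  have -> : (l + (M + B) < M) = false by rewrite addnCA -[X in _ < X]addn0 ltn_add2l.
  rewrite andbF -[X in _ + _ < X]add0n ltn_add2r ltn0.
  by rewrite ltn_add2r lD addnK nf.
rewrite (negbTE jk) /=; case: ifPn => [/andP[lDD nf']|nc]; last first.
  by rewrite /gam (negbTE jk) (negbTE nf) (negbTE lD) (negbTE nc).
rewrite /gam (negbTE jk) (negbTE nf') /=.
rewrite -leqNgt in lD.
by rewrite ltn_subLR // lDD subnK.
Qed.

Lemma gam_surj M B j : surj (gam M B j).
Proof. by move=> m; exists (gam M B j m); rewrite gamK. Qed.

Lemma cm_gam M B S : @comeager PS S -> @comeager PS (fun x => S (ren (gam M B) x)).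
Proof. by apply: cm_ren => j; exact: gamK. Qed.

Lemma ren_gam_low M B x j : j < k -> ren (gam M B) x j = x j.
Proof.
move=> jk; apply/funext => l; apply/funext => m; rewrite /ren gam_low //; congr (x j l _).
by case: j jk => [//|j] /= /ltnW /gam_low.
Qed.

(* The space of re-enumerations: sigma replaces row l of level j by row sigma j l. *)
Definition evS (s : nat -> nat -> nat) (c : nat * nat) := s c.1 c.2.
Definition mkS (h : nat * nat -> nat) : nat -> nat -> nat := fun j l => h (j, l).
Lemma evmkS h c : evS (mkS h) c = h c. Proof. by case: c. Qed.
Definition SS : cspace := fun_cspace (predT : pred (nat * nat)%type) 0 evmkS.
Definition lift (s : nat -> nat -> nat) j l := if j < k then l else s j l.

Lemma SSP (s : cd SS) (x : SS) : sat s x <-> forall c v, (c, v) \in s -> evS x c = v.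
Proof. by split=> [/fsatP h c v /h|h]; [exact|apply/fsatP => c v /h]. Qed.

Lemma cm_surj : @comeager SS (fun s => forall j, surj (s j)).
Proof.
have: @comeager SS (fun s => forall jm : nat * nat, exists l, s jm.1 l = jm.2).
  apply: cm_all => -[j m] /=.
  exists (fun _ t => forall x, @sat SS t x -> exists l, x j l = m); split; last first.
    by move=> x /(_ 0)[t [tP /tP]].
  move=> _ s [x /SSP sx].
  pose b := (\max_(cv <- (s : seq (nat * nat * nat))) cv.1.2).+1.
  have far v : ((j, b), v) \notin (s : seq _).
    apply/negP => h.
    have : b <= \max_(cv <- (s : seq (nat * nat * nat))) cv.1.2.
      exact: (@leq_bigmax_seq _ _ predT (fun cv : nat * nat * nat => cv.1.2) _ h).
    by rewrite ltnn.
  exists (((j, b), m) :: s); split.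
  - exists (mkS (fun c => if c == (j, b) then m else evS x c)); apply/SSP => c v.
    rewrite inE evmkS => /orP[/eqP[-> ->]|cs]; first by rewrite eqxx.
    by case: eqP => [e|_]; [rewrite e (negbTE (far v)) in cs|exact: sx].
  - by move=> y /andP[].
  - move=> y /SSP h; exists b; exact: (h (j, b) m (mem_head _ _)).
by apply: cm_mono => s h j m; exact: (h (j, m)).
Qed.

Lemma cm_gam_val M B (S : SS -> Prop) :
  @comeager SS S -> @comeager SS (fun s => S (fun j l => gam M B j (s j l))).
Proof.
pose h (s : SS) : SS := fun j l => gam M B j (s j l).
have hK : involutive h by move=> s; apply/funext => j; apply/funext => l; exact: gamK.
apply: (@cm_map SS SS h).
pose H (s : seq (nat * nat * nat)) := [seq (cv.1, gam M B cv.1.1 cv.2) | cv <- s].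
have HK s : H (H s) = s.
  by rewrite /H -map_comp -[RHS]map_id; apply/eq_map => -[c v] /=; rewrite gamK.
have satH1 s x : @sat SS s x -> @sat SS (H s) (h x).
  move=> /SSP hs; apply/SSP => c v /mapP[[d w] dw [-> ->]].
  by rewrite /evS /h -(hs _ _ dw).
have satH s x : @sat SS (H s) x -> @sat SS s (h x).
  by move=> /satH1; rewrite HK.
move=> s [x sx]; exists (H s); split; first by exists (h x); exact: satH1.
move=> t' [y yt'] sub'; exists (H t'); split.
- by exists (h y); exact: satH1.
- by move=> u /satH /sub' /satH1; rewrite HK hK.
- by move=> u /satH.
Qed.

Definition PSS := prod_cspace PS SS.

Lemma lift_low s x j : j < k -> ren (lift s) x j = x j.
Proof.
move=> jk; apply/funext => l; apply/funext => m; rewrite /ren /lift jk; congr (x j l _).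
by case: j jk => [//|j] /= /ltnW ->.
Qed.

Lemma lift_surj s : (forall j, surj (s j)) -> forall j, surj (lift s j).
Proof.
move=> h j m; rewrite /lift; case: (j < k); first by exists m.
exact: h.
Qed.

Lemma tame_lift : @tame PSS (fun u => ren (lift u.2) u.1).
Proof.
split; last first.
  have := cm_and (@cm_fst PS SS _ cm_std) (@cm_snd PS SS _ cm_surj).
  by apply: cm_mono => -[x s] [sx ss]; apply: ren_Xn => //; exact: lift_surj.
have bl j l v : @bp PSS (fun u => lift u.2 j l = v).
  rewrite /lift; case: (ltnP j k) => jk; first exact: bp_const.
  apply: (@bp_eq PSS _ _ _ (@bp_sat PSS ([::], [:: ((j, l), v)]))) => -[x s].
  split=> [[_ /SSP h]|h]; first exact: (h (j, l) v (mem_head _ _)).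
  by split=> //; apply/SSP => c w; rewrite inE => /eqP[-> ->].
have bpre j m w : @bp PSS (fun u => pre (lift u.2) j m = w).
  by case: j => [|j] /=; [exact: bp_const|exact: bl].
move=> j l m b.
have := @bp_cup PSS (nat * nat)%type _ (fun vw =>
  bp_and (bl j l vw.1) (bp_and (bpre j m vw.2) ((tame_fst SS).1 j vw.1 vw.2 b))).
apply: bp_eq => -[x s] /=; rewrite /ren; split=> [[[v w] /= [-> [-> //]]]|h].
by exists (lift s j l, pre (lift s) j m).
Qed.

(** * Codes of tuples: supports and separation *)

Section Rho.
Variables (f : nat -> ord) (z0 : Pt).
Hypothesis fz : @comeager PS (fun x =>
  forall m p, exists q, bf (f m) (str_of x) p (str_of (glue k x z0)) q).
Hypothesis Xz : @comeager PS (fun x => Xn n (tr n (glue k x z0))).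
Hypothesis nT : ~ gen_equiv (OS f).

Definition rcode : countType := (nat * nat * seq nat + bool * nat * seq nat)%type.

(* The real attached to the tuple p of str_of x; by fz it determines the bf (OS f)-class of p. *)
Definition rho x p (c : rcode) : Prop :=
  match c with
  | inl c => qbit (str_of x) p c = true
  | inr (b, m, s) => if b then exists a, bf (f m) (str_of x) (rcons p a) (str_of (glue k x z0)) s
                     else bf (f m) (str_of x) p (str_of (glue k x z0)) s
  end.

Definition same_code x p y q := forall c, rho x p c <-> rho y q c.
Definition same_base (x y : Pt) := forall j, j < k -> x j = y j.

Lemma R_sym x p y q : same_code x p y q -> same_code y q x p.
Proof. by move=> h c; rewrite h. Qed.
Lemma R_trans x p y q z r : same_code x p y q -> same_code y q z r -> same_code x p z r.
Proof. by move=> h1 h2 c; rewrite h1. Qed.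

Lemma glue_base x y : same_base x y -> glue k x z0 = glue k y z0.
Proof.
move=> b; apply/funext => j; case: (ltnP j k) => jk; last by rewrite !glue_ge.
by rewrite !glue_lt // b.
Qed.

Lemma R_of_bf x p y q : same_base x y -> bf (OS f) (str_of x) p (str_of y) q -> same_code x p y q.
Proof.
move=> /glue_base e [h1 h2] [c|[[[] m] s]] /=; rewrite ?e ?h1 //.
- have [_ hf hb] := h2 m; split=> -[a ha].
    by have [b hab] := hf a; exists b; exact: bf_trans (bf_sym hab) ha.
  by have [b hab] := hb a; exists b; exact: bf_trans hab ha.
- have [h _ _] := h2 m; split=> hs; last exact: bf_trans h hs.
  exact: bf_trans (bf_sym h) hs.
Qed.

Definition covered x := forall m p, exists q, bf (f m) (str_of x) p (str_of (glue k x z0)) q.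

Lemma bf_of_R x p y q : same_base x y -> covered x -> covered y -> same_code x p y q ->
  bf (OS f) (str_of x) p (str_of y) q.
Proof.
move=> /glue_base e cx cy h; split=> [c|m].
  by have := h (inl c) => /= hc; apply/idP/idP => /hc.
split.
- have [s hs] := cx m p; have /(_ hs) := (h (inr (false, m, s))).1.
  by rewrite /= -e => hs'; exact: bf_trans hs (bf_sym hs').
- move=> a; have [s hs] := cx m (rcons p a).
  have [|b hb] := (h (inr (true, m, s))).1; first by exists a.
  by exists b; rewrite -e in hb; exact: bf_trans hs (bf_sym hb).
- move=> b; have [s hs] := cy m (rcons q b).
  have [|a ha] := (h (inr (true, m, s))).2; first by exists b.
  by exists a; rewrite e in ha; exact: bf_trans ha (bf_sym hs).
Qed.

Lemma R_of_E x p y : same_base x y -> Xn n (tr n x) -> Xn n (tr n y) ->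
  E (tr n x) (tr n y) -> exists q, same_code x p y q.
Proof.
move=> b Xx Xy /(gE Xx Xy)/(iso_bf (OS f) p)[q hq].
by exists q; exact: R_of_bf.
Qed.

Lemma bp_rho (A : cspace) (h : A -> Pt) p c : tame h -> tame (fun u => glue k (h u) z0) ->
  bp (fun u => rho (h u) p c).
Proof.
move=> t1 t2; case: c => [c|[[[] m] s]] /=; first exact: bp_qbit.
- by apply: bp_cup => a; exact: bp_bf.
- exact: bp_bf.
Qed.

Lemma tame_z0 (B : cspace) : @tame (prod_cspace PS B) (fun u => glue k u.1 z0).
Proof.
split; last exact: (@cm_fst PS B (fun x => Xn n (tr n (glue k x z0)))).
move=> i l m b; case: (ltnP i k) => ik.
  by apply: (@bp_eq (prod_cspace PS B) _ _ _ ((tame_fst B).1 i l m b)) => u; rewrite glue_lt.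
by apply: (@bp_eq (prod_cspace PS B) _ _ _ (@bp_const (prod_cspace PS B) (z0 i l m = b))) => u; rewrite glue_ge.
Qed.

Lemma tame_z : @tame PS (fun x => glue k x z0).
Proof.
split; last exact: Xz.
move=> i l m b; case: (ltnP i k) => ik.
  by apply: bp_eq (bp_pt i l m b) => u; rewrite glue_lt.
by apply: bp_eq (@bp_const PS (z0 i l m = b)) => u; rewrite glue_ge.
Qed.

Lemma bp_rho1 p c : @bp PS (fun x => rho x p c).
Proof. exact: (@bp_rho PS id p c tame_id tame_z). Qed.

Lemma bp_R p p' : @bp PSS (fun u => same_code u.1 p (ren (lift u.2) u.1) p').
Proof.
apply: bp_cap => c; apply: bp_iff.
  by apply: (@bp_rho PSS fst); [exact: tame_fst|exact: tame_z0].
apply: (@bp_rho PSS (fun u => ren (lift u.2) u.1)); first exact: tame_lift.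
have -> : (fun u : PSS => glue k (ren (lift u.2) u.1) z0) = (fun u => glue k u.1 z0).
  by apply/funext => u; apply: glue_base => j; exact: lift_low.
exact: tame_z0.
Qed.

(** The code of [p] survives the removal of all rows that [gam M] does not fix. [B] is left free
    because how far the rows must go depends on conditions chosen later. *)
Definition supp q M p := @comeager PS (fun x => forall B,
  sat q x -> sat q (ren (gam M B) x) -> same_code x p (ren (gam M B) x) p).
(** Above level [k] the moves preserve only bits whose row and column are both below [M]. With these
    finitely many bits decided, only the base and the rows of level [k] can still carry
    information. *)
Definition full (q : cd PS) M := forall j l m, k < j -> j < M -> l < M -> m < M ->
  exists v, forall x : PS, sat q x -> evPt x (j, l, m) = v.

Lemma supp_sub q q' M p : sub q' q -> supp q M p -> supp q' M p.
Proof. by move=> s; apply: cm_mono => x h B /s hx /s; exact: h. Qed.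

Lemma full_sub q q' M : sub q' q -> full q M -> full q' M.
Proof.
by move=> s h j l m kj jM lM mM; have [v vP] := h j l m kj jM lM mM; exists v => x /s /vP.
Qed.

(** Re-enumerating [x] by [t] gives the same point as re-enumerating its moved copy by [t] followed
    by [gam]. So [p] has at both points the code that [p'] has at this common one; [s] survives
    because [gam] fixes the values it prescribes. *)
Lemma supp_of_forces q (s : cd SS) M p p' : ne s ->
  (forall c v, (c, v) \in s -> c.1 < M /\ v < M) ->
  @forces PSS (q, s) (fun u => same_code u.1 p (ren (lift u.2) u.1) p') -> supp q M p.
Proof.
move=> nes sM /forces_prod cf.
have := cm_and cf (cm_all (fun B => cm_gam M B cf)).
apply: cm_mono => x [h1 h2] B qx qgx.
have [t st [r1 r2]] := baire nes (cm_and (h1 qx) (cm_gam_val M B (h2 B qgx))).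
apply: R_trans (r1 st) _; apply: R_sym.
have st' : @sat SS s (fun j l => gam M B j (t j l)).
  move/SSP: st => st; apply/SSP => -[j l] v cs; rewrite /evS /=.
  by have := st _ _ cs; rewrite /evS /= => ->; have [? ?] := sM _ _ cs; rewrite gam_fix.
suff <- : ren (lift (fun j l => gam M B j (t j l))) (ren (gam M B) x) = ren (lift t) x.
  exact: r2.
have e j l : gam M B j (lift (fun j l => gam M B j (t j l)) j l) = lift t j l.
  by rewrite /lift; case: ifP => jk; [rewrite gam_low|rewrite gamK].
by apply/funext => -[|j]; apply/funext => l; apply/funext => m; rewrite /ren /= !e.
Qed.

(** A generic re-enumeration of [x] codes the same sets, hence is [E]-equivalent and has a tuple
    [p'] with the code of [p]. A condition on [x] and on the re-enumeration that forces this
    coincidence yields the support. *)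
Lemma supports : @comeager PS (fun x => forall p, exists q M,
  [/\ k < M, sat q x, supp q M p & full q M]).
Proof.
have c1 : @comeager PSS (fun u => forall p, exists p', same_code u.1 p (ren (lift u.2) u.1) p').
  have := cm_and (@cm_fst PS SS _ cm_std) (@cm_snd PS SS _ cm_surj).
  apply: cm_mono => -[x s] [/= sx ss] p; have ls := lift_surj ss.
  apply: R_of_E; first by move=> j jk; rewrite lift_low.
  - exact: std_Xn.
  - exact: ren_Xn.
  - by apply: EF; [exact: std_Xn|exact: ren_Xn|exact: ren_Frel].
have := cm_and c1 (cm_all (fun pp : seq nat * seq nat => decide (bp_R pp.1 pp.2))).
move=> /kuratowski_ulam; apply: cm_mono => x /ne_top[|s [h1 h2] p].
  by exists (fun _ _ => 0).
have [p' h] := h1 p; have [[q t] [[/= qx ts] ft]] := (h2 (p, p')).1 h.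
(* Above [k] and above every level and every value that occurs in [t], as [gam_fix] requires. *)
pose M := k.+1 + (\max_(cv <- (t : seq (nat * nat * nat))) (cv.1.1 + cv.2)).+1.
have tM c v : (c, v) \in (t : seq (nat * nat * nat)) -> c.1 < M /\ v < M.
  move=> ct.
  have le : c.1 + v <= \max_(cv <- (t : seq (nat * nat * nat))) (cv.1.1 + cv.2).
    exact: (@leq_bigmax_seq _ _ predT (fun cv : nat * nat * nat => cv.1.1 + cv.2) _ ct).
  rewrite /M addnS !ltnS; split; apply: leq_trans (leq_addl _ _); apply: leq_trans le.
    exact: leq_addr.
  exact: leq_addl.
pose cs := [seq (jl, m) | jl <- [seq (j, l) | j <- iota 0 M, l <- iota 0 M], m <- iota 0 M].
exists (q ++ cond_of x cs), M; split.
- by rewrite /M addSn ltnS leq_addr.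
- by apply/fsatI; split=> //; exact: sat_cond_of.
- apply: supp_sub (supp_of_forces _ tM ft); last by exists s.
  by move=> y /fsatI[].
- move=> j l m _ jM lM mM; exists (evPt x (j, l, m)) => y /fsatI[_ /cond_ofP]; apply.
  by apply: allpairs_f; rewrite ?mem_iota //; apply: allpairs_f; rewrite ?mem_iota.
Qed.

(** Coordinates that [gam M B] leaves in place. A row of level [k] below [M] is kept whole, since
    its columns are rows of the base. *)
Definition keep M (c : I3) := [|| c.1.1 < k, (c.1.1 == k) && (c.1.2 < M) |
  [&& k < c.1.1, c.1.1 < M, c.1.2 < M & c.2 < M]].

(** For large [B] the coordinates of [q] that are not kept come from places beyond everything
    decided so far, where the values that [q] asks for can still be chosen. The case [M = 0] keeps
    the base only. *)
Lemma move_into M (q : cd PS) : ne q -> k < M \/ M = 0 ->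
  @comeager PS (fun x => sat ([seq cv <- q | keep M cv.1] : cd PS) x ->
    exists B, sat q (ren (gam M B) x)).
Proof.
move=> [y qy] kM; apply: cm_dense1 => s nes.
pose qk : cd PS := [seq cv <- q | keep M cv.1].
have [[x [sx qx]]|nx] := pselect (exists x : Pt, sat s x /\ sat qk x); last first.
  by exists s; split=> // x sx qx; case: nx; exists x.
pose B := bound (dom s ++ dom q).
pose h (c : I3) : I3 := (c.1.1, gam M B c.1.1 c.1.2, pre (gam M B) c.1.1 c.2).
have hK : involutive h by move=> [[[|j] l] m]; rewrite /h /= ?gamK.
have BM : B <= M + B by exact: leq_addl.
have hkeep c : keep M c -> h c = c.
  case: c => [[j l] m]; rewrite /keep /h /= => hk; congr (_, _, _).
    case/or3P: hk => [jk|/andP[/eqP -> lM]|/and4P[kj jM lM mM]].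
    - exact: gam_low.
    - by apply: gam_fix => //; case: kM => // e; rewrite e ltn0 in lM.
    - exact: gam_fix.
  case: j hk => [//|j] /= /or3P[jk|/andP[/eqP jk _]|/and4P[kj jM lM mM]].
  - by apply: gam_low; exact: ltnW.
  - by apply: gam_low; rewrite -jk.
  - by apply: gam_fix => //; exact: ltnW.
have hfar c : c \in dom s ++ dom q -> ~~ keep M c -> h c \notin dom s ++ dom q.
  case: c => [[j l] m] /boundP[/= jB lB mB]; rewrite /keep /h /= !negb_or -leqNgt.
  move=> /and3P[kj nl nm].
  have [ll|ll] := boolP ((j < M) && (l < M)); last first.
    apply/negP => /boundP[_ /= + _]; rewrite gam_move // ?(leq_trans lB) //.
    by rewrite ltnNge (leq_trans BM) // leq_addl.
  have/andP[jM lM] := ll.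
  have kj' : k < j.
    by rewrite ltn_neqAle kj andbT; apply: contra nl => /eqP <-; rewrite eqxx lM.
  rewrite kj' jM lM /= -leqNgt in nm.
  apply/negP => /boundP[_ _ /=]; case: j kj' {jB kj nl ll jM} => [//|j] kj' /=.
  rewrite gam_move //; last by rewrite (leq_trans mB).
    by rewrite ltnNge (leq_trans BM) // leq_addl.
  by rewrite negb_and -!leqNgt nm orbT.
pose w : Pt := mkPt (fun d => if d \in dom s ++ dom qk then evPt x d else evPt y (h d)).
have sqk c : c \in dom qk -> c \in dom q.
  by move=> /mapP[[c' v]]; rewrite mem_filter => /andP[_ cq] ->; apply/mapP; exists (c', v).
exists (s ++ [seq (h cv.1, cv.2) | cv <- q] : cd PS); split.
- exists w; apply/fsatI; split.
    apply: sat_eq sx _ => c cs; rewrite evmkPt.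
    by rewrite mem_cat cs.
  apply/psatP => _ _ /mapP[[c v] cq [-> ->]] /=; rewrite evmkPt.
  have [kc|nkc] := boolP (keep M c).
    have cqk : (c, v) \in qk by rewrite mem_filter kc.
    rewrite hkeep // mem_cat (_ : c \in dom qk) ?orbT; last by apply/mapP; exists (c, v).
    by move/psatP: qx; apply.
  have cq' : c \in dom q by apply/mapP; exists (c, v).
  have := hfar c; rewrite mem_cat cq' orbT => /(_ isT nkc).
  rewrite !mem_cat !negb_or => /andP[/negbTE -> nq]; rewrite /= (negbTE (contra (@sqk _) nq)).
  by rewrite hK; move/psatP: qy; apply.
- by move=> u /fsatI[].
- move=> u /fsatI[_ /psatP hu] _; exists B; apply/psatP => c v cq.
  by apply: (hu (h c) v); apply/mapP; exists (c, v).
Qed.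

(** Below [q] the code of [p] is, generically, a function of the base. *)
Definition trivial q p := forall c (q1 q2 : cd PS), sub q1 q -> sub q2 q ->
  forces q1 (fun x => rho x p c) -> forces q2 (fun x => ~ rho x p c) ->
  ~ exists b1 b2 : PS, [/\ sat q1 b1, sat q2 b2 & same_base b1 b2].

Lemma cm_decided : @comeager PS (fun x => forall p c,
  (rho x p c -> exists t : cd PS, sat t x /\ forces t (fun y => rho y p c)) /\
  (~ rho x p c -> exists t : cd PS, sat t x /\ forces t (fun y => ~ rho y p c))).
Proof.
have := cm_all (fun pc : seq nat * rcode => decide (bp_rho1 pc.1 pc.2)).
by apply: cm_mono => x h p c; exact: (h (p, c)).
Qed.

(** If trivial conditions were dense below every support, the rows of [glue k x y] could be moved
    until the trivial condition of a tuple of [x] holds. That tuple then has the same code there,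
    and moving stays inside the [E]-class; this would make the rank [OS f] generically
    equivalent. *)
Lemma nontrivial_datum : exists q M p, [/\ ne q, k < M, supp q M p, full q M &
  forall q', ne q' -> sub q' q -> ~ trivial q' p].
Proof.
apply: contrapT => H; apply: nT.
have {}H q M p : ne q -> k < M -> supp q M p -> full q M ->
    exists q', [/\ ne q', sub q' q & trivial q' p].
  move=> neq kM sq fq; apply: contrapT => h; apply: H; exists q, M, p; split=> // q' n' s' t'.
  by apply: h; exists q'.
have ctr : @comeager PS (fun x => forall p, exists q, trivial q p /\ sat q x).
  have step (d : cd PS * nat * seq nat) : @comeager PS (fun x =>
      k < d.1.2 -> supp d.1.1 d.1.2 d.2 -> full d.1.1 d.1.2 -> sat d.1.1 x ->
      exists q, trivial q d.2 /\ sat q x).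
    case: d => [[q M] p] /=.
    have [[kM sq fq]|h] := pselect [/\ k < M, supp q M p & full q M]; last first.
      by apply: cm_true => x ? ? ?; case: h.
    have [|D [dD DP]] := @dense_below_cm PS q (fun t => trivial t p).
      move=> s nes sq'.
      by apply: (H s M) => //; [exact: supp_sub sq|exact: full_sub fq].
    by exists D; split=> // x /DP h _ _ _ /h.
  apply: cm_mono (cm_and supports (cm_all step)) => x [h1 h2] p.
  by have [q [M [kM qx sq fq]]] := h1 p; exact: (h2 (q, M, p)).
have cmove : @comeager PS (fun x => forall q : cd PS, ne q ->
    sat ([seq cv <- q | keep 0 cv.1] : cd PS) x -> exists B, sat q (ren (gam 0 B) x)).
  apply: cm_all => q; have [neq|h] := pselect (ne q); last by apply: cm_true => x /h.
  by apply: cm_mono (move_into neq (or_intror erefl)).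
have cdec := cm_all (fun B => cm_gam 0 B cm_decided).
have cP := cm_and (cm_and ctr cm_decided) (cm_and fz cm_std).
have cQ := cm_and (cm_and cmove cdec) (cm_and fz cm_std).
apply: (@cm_mono PS2) (cm_and (@cm_fst PS PS _ cP) (cm_gluePP k cQ)) => -[x y] [].
move=> [[tx dx] [cx stx]] [[mv dy] [cy sty]] p.
change (x, y).1 with x in tx, dx, cx, stx.
change (x, y).1 with x in mv, dy, cy, sty.
change (x, y).2 with y in mv, dy, cy, sty.
change (x, y).1 with x; change (x, y).2 with y.
set y1 := glue k x y in mv dy cy sty *.
have [q [tq qx]] := tx p.
have bxy : same_base x y1 by move=> j jk; rewrite /y1 glue_lt.
have [B qB] : exists B, sat q (ren (gam 0 B) y1).
  apply: mv; first by exists x.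
  apply/psatP => c v; rewrite mem_filter /keep ltn0 !andbF !orbF => /andP[/= ck cq].
  by move/psatP: qx => /(_ _ _ cq) <-; rewrite /evPt bxy.
set y2 := ren (gam 0 B) y1 in qB.
have b12 : same_base y1 y2 by move=> j jk; rewrite /y2 ren_gam_low.
have bx2 : same_base x y2 by move=> j jk; rewrite bxy // b12.
have Rx2 : same_code x p y2 p.
  move=> c; have [d1 d2] := dx p c; have [d3 d4] := dy B p c.
  split=> h; apply: contrapT => nh.
    have [q1 [xq1 f1]] := d1 h; have [q2 [yq2 f2]] := d4 nh.
    apply: (tq c (q1 ++ q) (q2 ++ q)).
    - exact: sub_meetr.
    - exact: sub_meetr.
    - exact: forces_sub (@sub_meetl _ _ _) f1.
    - exact: forces_sub (@sub_meetl _ _ _) f2.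
    - by exists x, y2; split=> //; apply/fsatI.
  have [q1 [yq1 f1]] := d3 h; have [q2 [xq2 f2]] := d2 nh.
  apply: (tq c (q1 ++ q) (q2 ++ q)).
  - exact: sub_meetr.
  - exact: sub_meetr.
  - exact: forces_sub (@sub_meetl _ _ _) f1.
  - exact: forces_sub (@sub_meetl _ _ _) f2.
  - by exists y2, x; split=> //; [apply/fsatI|apply/fsatI|move=> j jk; rewrite bx2].
have X1 : Xn n (tr n y1) by exact: std_Xn.
have X2 : Xn n (tr n y2) by apply: ren_Xn => // j; exact: gam_surj.
have [||q1 Rq1] := @R_of_E y2 p y1 _ X2 X1.
- by move=> j jk; rewrite b12.
- have [_ Es _] := Eeq; apply: Es => //; apply: EF => //.
  by apply: ren_Frel => // j; exact: gam_surj.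
exists q1; apply: bf_of_R => //; exact: R_trans Rx2 Rq1.
Qed.

Definition agr M s (v b : Pt) := same_base b v /\ forall l, l < M -> b k l = v k (s + l).

(** [v] shows the base, [M] rows of level [k] of one point, then [M'] rows of another. The witnesses
    [b] and [b'] are free elsewhere, so separation is a property of this finite set of rows over the
    base. *)
Definition separated q M p q' M' p' (v : Pt) :=
  (exists b b' : PS, [/\ sat q b, sat q' b', agr M 0 v b & agr M' M v b']) ->
  exists c (q1 q1' : cd PS) (b b' : PS), [/\ [/\ sub q1 q & sub q1' q'],
    [/\ sat q1 b, sat q1' b', agr M 0 v b & agr M' M v b'] &
    forces q1 (fun x => rho x p c) /\ forces q1' (fun x => ~ rho x p' c) \/
    forces q1 (fun x => ~ rho x p c) /\ forces q1' (fun x => rho x p' c)].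

Lemma agr_cong M s v w b : same_base v w ->
  (forall l, l < M -> v k (s + l) = w k (s + l)) -> agr M s v b -> agr M s w b.
Proof.
move=> vw lw [h1 h2]; split=> [j jk|l lM]; first by rewrite h1 // vw.
by rewrite h2 // lw.
Qed.

Lemma separated_cong q M p q' M' p' v w : same_base v w ->
  (forall l, l < M + M' -> v k l = w k l) ->
  separated q M p q' M' p' v -> separated q M p q' M' p' w.
Proof.
move=> vw lw sv [b [b' [qb qb' a1 a2]]].
have wv : same_base w v by move=> j jk; rewrite vw.
have l1 l : l < M -> v k (0 + l) = w k (0 + l).
  by move=> lM; apply: lw; apply: leq_trans (leq_addr _ _).
have l2 l : l < M' -> v k (M + l) = w k (M + l) by move=> lM; rewrite lw // ltn_add2l.
have [|c [q1 [q1' [d [d' [h1 [h2 h3 h4 h5] h6]]]]]] := sv.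
  exists b, b'; split=> //; first by apply: agr_cong a1 => // l /l1.
  by apply: agr_cong a2 => // l /l2.
exists c, q1, q1', d, d'; split=> //; split=> //; first exact: agr_cong h4.
exact: agr_cong h5.
Qed.

(** Nontriviality gives two conditions over a common base forcing opposite values of a bit [c]. A
    refinement on the other side decides [c] for [p']; the condition with the opposite value is
    kept, and both are written into [v]. *)
Lemma cm_separated q M p q' M' p' :
  (forall q1, ne q1 -> sub q1 q -> ~ trivial q1 p) ->
  @comeager PS (separated q M p q' M' p').
Proof.
move=> ntr; apply: cm_dense1 => s nes.
have [[v [b [b' [sv qb qb' [bb lb] [bb' lb']]]]]|no] := pselect (exists (v b b' : Pt),
    [/\ sat s v, sat q b, sat q' b', agr M 0 v b & agr M' M v b']); last first.
  exists s; split=> // v sv [b [b' [qb qb' a1 a2]]]; case: no.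
  by exists v, b, b'.
pose L := dom q ++ dom s ++ dom q'.
pose qt : cd PS := cond_of b L.
have qtq : sub qt q by apply: cond_of_sub qb _ => c cq; rewrite mem_cat cq.
have neqt : ne qt by exists b; exact: sat_cond_of.
have : ~ trivial qt p by exact: ntr.
move=> /existsNP[c /existsNP[q1 /existsNP[q2]]].
move=> /not_implyP[s1] /not_implyP[s2] /not_implyP[f1] /not_implyP[f2] /contrapT[b1 [b2 [h1 h2 b12]]].
have qb1 : sat qt b1 by exact: s1.
have qb2 : sat qt b2 by exact: s2.
pose b3 := glue k b1 b'.
(* Row [M + l] of [v] is row [l] of [b']; [sh], and [up] below, translate between them. *)
pose sh (cc : I3) : I3 := (cc.1.1, cc.1.2 - M, cc.2).
(* Includes the coordinates of [q1] and [q2]: whichever of them is kept, its bits in the base must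
   be respected by the refinement [q3] chosen next. *)
pose L3 := dom q' ++ dom s ++ map sh (dom s) ++ dom q1 ++ dom q2.
pose qt' : cd PS := cond_of b3 L3.
have ev_base (x y : Pt) (cc : I3) : cc.1.1 < k -> same_base x y -> evPt x cc = evPt y cc.
  by move=> ck xy; rewrite /evPt xy.
have inL1 cc : cc \in dom q -> cc \in L by rewrite mem_cat => ->.
have inL2 cc : cc \in dom s -> cc \in L by rewrite !mem_cat => ->; rewrite orbT.
have inL3 cc : cc \in dom q' -> cc \in L by rewrite !mem_cat => ->; rewrite !orbT.
have b3lo cc : cc.1.1 < k -> evPt b3 cc = evPt b1 cc by move=> ck; rewrite /evPt /b3 glue_lt.
have b3hi cc : k <= cc.1.1 -> evPt b3 cc = evPt b' cc by move=> ck; rewrite /evPt /b3 glue_ge.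
have q'b3 : sat q' b3.
  apply: sat_eq qb' _ => cc cq'; case: (ltnP cc.1.1 k) => ck; last exact: b3hi.
  rewrite b3lo // ((cond_ofP _ _ _).1 qb1 _ (inL3 _ cq')).
  by rewrite (ev_base b v) // (ev_base b' v).
have qt'q' : sub qt' q' by apply: cond_of_sub q'b3 _ => cc cq; rewrite mem_cat cq.
have neqt' : ne qt' by exists b3; exact: sat_cond_of.
have [q3 [[b4 q3b4] s3 h3]] := bp_rho1 p' c neqt'.
have b4b3 cc : cc \in L3 -> evPt b4 cc = evPt b3 cc by exact: ((cond_ofP _ _ _).1 (s3 _ q3b4)).
have [qe [be [sqe qebe qeL beb1 fe]]] : exists (qe : cd PS) (be : Pt),
    [/\ sub qe qt, sat qe be, {subset dom qe <= L3}, same_base be b1 &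
    forces qe (fun x => rho x p c) /\ forces q3 (fun x => ~ rho x p' c) \/
    forces qe (fun x => ~ rho x p c) /\ forces q3 (fun x => rho x p' c)].
  case: h3 => f3.
    exists q2, b2; split=> //; last by right.
      by move=> cc cq; rewrite !mem_cat cq !orbT.
    by move=> j jk; rewrite b12.
  exists q1, b1; split=> //; last by left.
  by move=> cc cq; rewrite !mem_cat cq !orbT.
have qtbe : sat qt be by exact: sqe.
(* On the base [be] and [b4] agree at the coordinates in [L3], which contain those of [qe], so the
   base of [b4] serves both sides. *)
pose v1 : Pt := fun j => if j < k then b4 j else if j == k then
  (fun l => if l < M then be k l else if l < M + M' then b4 k (l - M) else v k l) else v j.
pose up (cc : I3) : I3 := (cc.1.1, M + cc.1.2, cc.2).
pose L5 := dom s ++ dom qe ++ dom q3 ++ map up (dom q3).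
have sv1 : sat s v1.
  apply: sat_eq sv _ => -[[j l] m] cs; rewrite /v1.
  have cL3 : (j, l, m) \in L3 by rewrite !mem_cat cs !orbT.
  have cL := inL2 _ cs.
  case: (ltnP j k) => jk.
    transitivity (evPt b4 (j, l, m)); first by rewrite /evPt /= jk.
    by rewrite b4b3 // b3lo // ((cond_ofP _ _ _).1 qb1 _ cL) (ev_base b v).
  rewrite /evPt /= ltnNge jk /=; case: eqP => [ejk|//]; subst j.
  case: ifP => lM.
    rewrite -[LHS]/(evPt be (k, l, m)) ((cond_ofP _ _ _).1 qtbe _ cL).
    by rewrite /evPt /= lb.
  case: ifP => // lMM; have Ml : M <= l by rewrite leqNgt lM.
  have cL3' : (k, l - M, m) \in L3.
    rewrite !mem_cat; apply/orP; right; apply/orP; right; apply/orP; left.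
    by apply/mapP; exists (k, l, m).
  rewrite -[LHS]/(evPt b4 (k, l - M, m)) b4b3 // b3hi //.
  by rewrite /evPt /= lb' ?subnKC // ltn_subLR.
exists (cond_of v1 L5); split.
- by exists v1; exact: sat_cond_of.
- by apply: cond_of_sub sv1 _ => cc cs; rewrite mem_cat cs.
move=> w /cond_ofP wv1 _.
pose d : Pt := fun j => if j < k then w j else if j == k then
  (fun l => if l < M then w k l else be k l) else be j.
pose d' : Pt := fun j => if j < k then w j else if j == k then
  (fun l => if l < M' then w k (M + l) else b4 k l) else b4 j.
exists c, qe, q3, d, d'; split=> //.
  split; first exact: sub_trans qtq sqe.
  exact: sub_trans qt'q' s3.
split.
- apply: sat_eq qebe _ => -[[j l] m] cq.
  have cL5 : (j, l, m) \in L5 by rewrite !mem_cat cq !orbT.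
  have := wv1 _ cL5; rewrite /evPt /d /v1 /=; case: (ltnP j k) => jk.
    move=> ->; rewrite -[LHS]/(evPt b4 (j, l, m)) b4b3 ?qeL // b3lo //.
    by rewrite /evPt /= beb1.
  by case: eqP => [ejk|//]; subst j; case: ifP => // lM ->.
- apply: sat_eq q3b4 _ => -[[j l] m] cq.
  have cL5 : (j, l, m) \in L5 by rewrite !mem_cat cq !orbT.
  have := wv1 _ cL5; rewrite /evPt /d' /v1 /=; case: (ltnP j k) => jk // _.
  case: eqP => [ejk|//]; subst j; case: ifP => // lM.
  have cL6 : (k, M + l, m) \in L5.
    rewrite !mem_cat; apply/orP; right; apply/orP; right; apply/orP; right.
    by apply/mapP; exists (k, l, m).
  have := wv1 _ cL6; rewrite /evPt /v1 /= ltnn eqxx => ->.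
  by rewrite ltnNge leq_addr /= ltn_add2l lM addKn.
- by split=> [j jk|l lM]; rewrite /d ?jk // ltnn eqxx lM.
- by split=> [j jk|l lM]; rewrite /d' ?jk // ltnn eqxx lM.
Qed.

Definition good (x : Pt) := [/\ std x,
  forall p, exists q M, [/\ k < M, sat (q : cd PS) x, supp q M p & full q M],
  forall (q : cd PS) M p, supp q M p -> forall B,
    sat q x -> sat q (ren (gam M B) x) -> same_code x p (ren (gam M B) x) p,
  forall (q : cd PS) M, ne q -> k < M ->
    sat ([seq cv <- q | keep M cv.1] : cd PS) x -> exists B, sat q (ren (gam M B) x) &
  forall M B (q : cd PS) p c, let y := ren (gam M B) x in sat q y ->
    (forces q (fun x => rho x p c) -> rho y p c) /\
    (forces q (fun x => ~ rho x p c) -> ~ rho y p c)].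

Lemma cm_good : @comeager PS good.
Proof.
have c3 : @comeager PS (fun x => forall d : cd PS * nat * seq nat, supp d.1.1 d.1.2 d.2 ->
    forall B, sat d.1.1 x -> sat d.1.1 (ren (gam d.1.2 B) x) ->
    same_code x d.2 (ren (gam d.1.2 B) x) d.2).
  apply: cm_all => -[[q M] p] /=; have [s|ns] := pselect (supp q M p).
    by apply: cm_mono s.
  exact: cm_true.
have c4 : @comeager PS (fun x => forall d : cd PS * nat, ne d.1 -> k < d.2 ->
    sat ([seq cv <- d.1 | keep d.2 cv.1] : cd PS) x -> exists B, sat d.1 (ren (gam d.2 B) x)).
  apply: cm_all => -[q M] /=; have [[neq kM]|h] := pselect (ne q /\ k < M).
    by apply: cm_mono (move_into neq (or_introl kM)) => x.
  by apply: cm_true => x neq kM; case: h.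
have c5 := cm_all (fun pc : seq nat * rcode => cm_and
  (@forces_true PS (fun x => rho x pc.1 pc.2)) (@forces_true PS (fun x => ~ rho x pc.1 pc.2))).
have c6 := cm_all (fun MB : nat * nat => cm_gam MB.1 MB.2 c5).
apply: cm_mono (cm_and cm_std (cm_and supports (cm_and c3 (cm_and c4 c6)))).
move=> x [h1 [h2 [h3 [h4 h5]]]]; split=> //.
- by move=> q M p s B; exact: (h3 (q, M, p)).
- by move=> q M; exact: (h4 (q, M)).
- move=> M B q p c y qy; have [h h'] := h5 (M, B) (p, c).
  by split=> fq; [exact: (h q)|exact: (h' q)].
Qed.

(* By the support property, rho x p c is read off any forcing condition that agrees with x on
   the base and on the rows < M of level k. *)
Lemma read_code x q M p c (q1 : cd PS) b : good x -> k < M -> supp q M p -> full q M -> sat q x ->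
  sub q1 q -> sat q1 b -> same_base b x -> (forall l, l < M -> b k l = x k l) ->
  (forces q1 (fun x => rho x p c) -> rho x p c) /\
  (forces q1 (fun x => ~ rho x p c) -> ~ rho x p c).
Proof.
move=> [_ _ g3 g4 g5] kM sq fq qx s1 q1b bx lx.
have [||B qB] := g4 q1 M _ kM; first by exists b.
  apply/psatP => -[[j l] m] v; rewrite mem_filter /keep => /andP[/= kc cq].
  move/psatP: q1b => q1b; rewrite -(q1b _ _ cq) /evPt /=.
  case/or3P: kc => [jk|/andP[/eqP -> lM]|/and4P[kj jM lM mM]]; first by rewrite bx.
    by rewrite lx.
  have [w wP] := fq j l m kj jM lM mM.
  rewrite -[LHS]/(evPt x (j, l, m)) -[RHS]/(evPt b (j, l, m)) !wP //.
  by apply: s1; apply/psatP.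
have Rx := g3 q M p sq B qx (s1 _ qB) c.
have [h1 h2] := g5 M B q1 p c qB.
by split=> [/h1/Rx|/h2 h /Rx].
Qed.
End Rho.

Definition mrg M (x y : Pt) : Pt := fun j => if j < k then x j else
  fun l => if l < M then x j l else y j (l - M).

(** Joint genericity of [x] and [y] is demanded only through [mrg] and only on finitely many rows.
    There is one [sp M'] for each [M'] because [M'] comes from the support of the tuple of [y] that
    would match [p0], which is not known in advance. *)
Theorem level_witness :
  exists (gd : Pt -> Prop) (q0 : cd PS) (M0 : nat) (sp : nat -> Pt -> Prop),
  [/\ @comeager PS gd, forall x, gd x -> std x, ne q0,
    forall M', [/\ @comeager PS (sp M') &
      forall v w, (forall j, j < k -> v j = w j) ->
        (forall l, l < M0 + M' -> v k l = w k l) -> sp M' v -> sp M' w] &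
    forall x y, gd x -> gd y -> (forall j, j < k -> x j = y j) -> sat q0 x ->
      (forall M', sp M' (mrg M0 x y)) -> ~ E (tr n x) (tr n y)].
Proof.
have [f [Tf nT]] := minimal_rank.
have [z0 [fz Xz]] := fixed_copy Tf.
have [q0 [M0 [p0 [neq kM sq fq ntr]]]] := nontrivial_datum fz Xz nT.
exists (good f z0), q0, M0, (fun M' v => forall d : cd PS * seq nat,
  separated f z0 q0 M0 p0 d.1 M' d.2 v).
split=> //; first exact: cm_good.
- by move=> x [].
- move=> M'; split; first by apply: cm_all => d; exact: cm_separated.
  by move=> v w vw lw h d; exact: separated_cong (h d).
move=> x y gx gy xy qx sep Exy.
have [sx _ _ _ _] := gx; have [sy g2 _ _ _] := gy.
have [p' Rp] := R_of_E f z0 p0 xy (std_Xn n sx) (std_Xn n sy) Exy.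
have [q' [M' [kM' qy sq' fq']]] := g2 p'.
have sp : separated f z0 q0 M0 p0 q' M' p' (mrg M0 x y) := sep M' (q', p').
have [|c [q1 [q1' [b [b' [[s1 s1'] [q1b q1b' [bb lb] [bb' lb']] fr]]]]]] := sp.
  exists x, y; split=> //; split=> [j jk|l lM]; rewrite /mrg ?jk ?ltnn ?lM //.
    by rewrite xy.
  by rewrite ltnNge leq_addr /= addKn.
have [r1 r2] : (@forces PS q1 (fun x => rho f z0 x p0 c) -> rho f z0 x p0 c) /\
    (@forces PS q1 (fun x => ~ rho f z0 x p0 c) -> ~ rho f z0 x p0 c).
  apply: (read_code c gx kM sq fq qx s1 q1b) => [j jk|l lM]; first by rewrite bb // /mrg jk.
  by rewrite lb // /mrg ltnn lM.
have [r1' r2'] : (@forces PS q1' (fun x => rho f z0 x p' c) -> rho f z0 y p' c) /\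
    (@forces PS q1' (fun x => ~ rho f z0 x p' c) -> ~ rho f z0 y p' c).
  apply: (read_code c gy kM' sq' fq' qy s1' q1b') => [j jk|l lM]; first by rewrite bb' // /mrg jk xy.
  by rewrite lb' // /mrg ltnn ltnNge leq_addr /= addKn.
case: fr => -[/[dup] f1 _ f2].
  by apply: (r2' f2); apply/Rp; exact: r1.
by apply: (r2 f1); apply/Rp; exact: r1'.
Qed.
End Level.
End Reduction.

(** * A perfect set of mutually generic reals *)

Section Mycielski.
Definition key := (nat * seq bool)%type.
Definition ppre (ss ss' : seq (seq bool)) := all2 (@prefix bool) ss ss'.
Variable O : nat -> seq (seq bool) -> Prop.
Hypothesis O_mono : forall i ss ss', O i ss -> ppre ss ss' -> O i ss'.
Hypothesis O_dense : forall i ss, exists2 ss', ppre ss ss' & O i ss'.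
Variable start : nat -> seq bool.

Lemma ppre_map (T : Type) (f h : T -> seq bool) (ks : seq T) :
  (forall k, prefix (f k) (h k)) -> ppre (map f ks) (map h ks).
Proof. by move=> fh; elim: ks => //= k ks IH; rewrite /ppre /= fh. Qed.

Lemma ppre_nth ss ss' i : ppre ss ss' -> prefix (nth [::] ss i) (nth [::] ss' i).
Proof. by elim: ss ss' i => [|s ss IH] [|s' ss'] [|i] //= /andP[// _ /IH]. Qed.

Lemma meet_tasks (tasks : seq (nat * seq key)) (s : key -> seq bool) :
  (forall t, t \in tasks -> uniq t.2) ->
  exists s', (forall k, prefix (s k) (s' k)) /\
    forall t, t \in tasks -> O t.1 (map s' t.2).
Proof.
elim: tasks => [|[i ks] tasks IH] un; first by exists s; split=> // k; exact: prefix_refl.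
have [|s1 [s1P tP]] := IH; first by move=> t ts; apply: un; rewrite inE ts orbT.
have uks : uniq ks := un (i, ks) (mem_head _ _).
have [ss' pss Oss] := O_dense i (map s1 ks).
pose s2 k := if k \in ks then nth [::] ss' (index k ks) else s1 k.
have szss : size ss' = size ks.
  by move: pss; rewrite /ppre all2E size_map => /andP[/eqP ->].
have s12 k : prefix (s1 k) (s2 k).
  rewrite /s2; case: ifP => kks; last exact: prefix_refl.
  by have := ppre_nth (index k ks) pss; rewrite (nth_map k) ?index_mem // nth_index.
exists s2; split=> [k|t]; first exact: prefix_trans (s12 k).
rewrite inE => /orP[/eqP -> /=|/tP h]; last by apply: O_mono h _; exact: ppre_map.
suff -> : map s2 ks = ss' by [].
apply: (@eq_from_nth _ [::]) => [|j]; first by rewrite size_map szss.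
rewrite size_map => jks; rewrite (nth_map (0, [::])) // /s2 mem_nth //.
by rewrite index_uniq.
Qed.

Fixpoint bseqs N : seq (seq bool) :=
  if N is N'.+1 then [seq b :: l | b <- [:: true; false], l <- bseqs N'] else [:: [::]].

Lemma mem_bseqs s : s \in bseqs (size s).
Proof.
elim: s => [//|b s IH].
by apply: (@allpairs_f _ _ _ (fun b l => b :: l) [:: true; false]) => //; case: b.
Qed.

Fixpoint allseq (T : eqType) (K : seq T) m : seq (seq T) :=
  if m is m'.+1 then [seq x :: l | x <- K, l <- allseq K m'] else [:: [::]].

Lemma mem_allseq (T : eqType) (K : seq T) s : {subset s <= K} -> s \in allseq K (size s).
Proof.
elim: s => [//|x s IH] sK /=; apply: (@allpairs_f _ _ _ (fun x l => x :: l)).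
  by apply: sK; exact: mem_head.
by apply: IH => y ys; apply: sK; rewrite inE ys orbT.
Qed.

Definition nodes N : seq key := [seq (z, eta) | z <- iota 0 N, eta <- bseqs N].
Definition tasks N : seq (nat * seq key) :=
  [seq t <- [seq (i, ks) | i <- iota 0 N,
     ks <- flatten [seq allseq (nodes N) m | m <- iota 0 N]] | uniq t.2].

(** A fusion of countably many binary trees, one for each tag [z]. Stage [N] meets the first [N]
    requirements on short tuples of distinct nodes; these are finitely many, so they are met one
    after the other. *)
Lemma fusion : exists c : nat -> key -> seq bool,
  [/\ forall z, c 0 (z, [::]) = start z,
      forall N z eta, prefix (c N (z, take N eta)) (c N.+1 (z, eta)),
      forall N k, N <= size (c N k) &
      forall N t, t \in tasks N.+1 -> O t.1 (map (c N.+1) t.2)].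
Proof.
have /choice[F FP] : forall Ns : nat * (key -> seq bool), exists s',
    [/\ forall k, prefix (Ns.2 k) (s' k), forall k, Ns.1 <= size (s' k) &
     forall t, t \in tasks Ns.1 -> O t.1 (map s' t.2)].
  move=> [N s]; have [|s1 [p1 t1]] := @meet_tasks (tasks N) s.
    by move=> t; rewrite mem_filter => /andP[].
  (* The padding makes the strings grow along every branch even when no requirement does. *)
  exists (fun k => s1 k ++ nseq N false); split=> [k|k|t /t1 h].
  - by apply: prefix_trans (p1 k) _; exact: prefix_prefix.
  - by rewrite size_cat size_nseq leq_addl.
  - by apply: O_mono h _; apply: ppre_map => k; exact: prefix_prefix.
pose c := fix c N : key -> seq bool := if N is N'.+1
  then F (N'.+1, fun k => c N' (k.1, take N' k.2)) else fun k => start k.1.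
exists c; split=> [//|N z eta|[//|N] k|N t tN].
- by have [h _ _] := FP (N.+1, fun k => c N (k.1, take N k.2)); exact: (h (z, eta)).
- by have [_ h _] := FP (N.+1, fun k => c N (k.1, take N k.2)); exact: h.
- by have [_ _ h] := FP (N.+1, fun k => c N (k.1, take N k.2)); exact: h.
Qed.

Lemma separate (ks : seq (nat * (nat -> bool))) : uniq ks ->
  exists N0, forall N, N0 <= N -> uniq [seq (k.1, mkseq k.2 N) | k <- ks].
Proof.
have two (k k' : nat * (nat -> bool)) : k != k' ->
    exists N0, forall N, N0 <= N -> (k.1, mkseq k.2 N) != (k'.1, mkseq k'.2 N).
  case: k k' => [z xi] [z' xi'] /eqP kk.
  have [SS|SS] := eqVneq z z'; last by exists 0 => N _; apply/eqP => -[e]; rewrite e eqxx in SS.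
  have [t tP] : exists t, xi t <> xi' t.
    apply: contrapT => h; apply: kk; rewrite SS; congr (_, _); apply/funext => t.
    by apply: contrapT => h'; apply: h; exists t.
  exists t.+1 => N tN; apply/eqP => -[_ /= e]; apply: tP.
  by rewrite -(nth_mkseq false xi tN) e nth_mkseq.
elim: ks => [_|k ks IH /= /andP[kks uks]]; first by exists 0.
have [N1 N1P] := IH uks.
have [N2 N2P] : exists N2, forall N, N2 <= N -> forall k', k' \in ks ->
    (k.1, mkseq k.2 N) != (k'.1, mkseq k'.2 N).
  elim: ks kks {uks IH N1 N1P} => [_|k' ks IH]; first by exists 0.
  rewrite inE negb_or => /andP[/two[N3 N3P] /IH[N4 N4P]].
  exists (maxn N3 N4) => N; rewrite geq_max => /andP[l3 l4] k''.
  by rewrite inE => /orP[/eqP ->|]; [exact: N3P|exact: N4P].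
exists (maxn N1 N2) => N; rewrite geq_max => /andP[l1 l2].
rewrite N1P // andbT; apply/mapP => -[k' k'ks e].
by have := N2P N l2 k' k'ks; rewrite e eqxx.
Qed.

(** Distinct keys pass through distinct nodes from some depth on, so every requirement on their
    tuple is met at a deep enough stage. The tag [z] lets countably many initial segments be
    prescribed. *)
Theorem mycielski : exists phi : nat -> (nat -> bool) -> nat -> bool,
  [/\ forall z xi t, t < size (start z) -> phi z xi t = nth false (start z) t,
      forall z t, exists N, forall xi xi', (forall i, i < N -> xi i = xi' i) ->
        phi z xi t = phi z xi' t &
      forall (ks : seq (nat * (nat -> bool))) i, uniq ks ->
        exists N, O i [seq mkseq (phi k.1 k.2) N | k <- ks]].
Proof.
have [c [c0 cS csz ct]] := fusion.
have cmon z xi N N' : N <= N' -> prefix (c N (z, mkseq xi N)) (c N' (z, mkseq xi N')).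
  elim: N' => [|N' IH]; first by rewrite leqn0 => /eqP ->; exact: prefix_refl.
  rewrite leq_eqVlt => /orP[/eqP -> |/IH h]; first exact: prefix_refl.
  apply: prefix_trans h _; have := cS N' z (mkseq xi N'.+1).
  suff -> : take N' (mkseq xi N'.+1) = mkseq xi N' by [].
  by rewrite /mkseq -map_take take_iota (minn_idPl _).
pose phi z xi t := nth false (c t.+1 (z, mkseq xi t.+1)) t.
have phiE z xi N t : t < size (c N (z, mkseq xi N)) ->
    phi z xi t = nth false (c N (z, mkseq xi N)) t.
  move=> tN; rewrite /phi; case: (leqP N t.+1) => h.
    by have /prefixP[s' ->] := cmon z xi _ _ h; rewrite nth_cat tN.
  by have /prefixP[s' ->] := cmon z xi _ _ (ltnW h); rewrite nth_cat csz.
exists phi; split.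
- by move=> z xi t tS; rewrite (phiE z xi 0) c0.
- move=> z t; exists t.+1 => xi xi' e; rewrite /phi.
  suff -> : mkseq xi t.+1 = mkseq xi' t.+1 by [].
  by apply/eq_in_map => i; rewrite mem_iota => /andP[_ /e].
move=> ks i uks; have [N0 N0P] := separate uks.
(* Deep enough to separate the keys and to have [(i, nk)] among [tasks N.+1]. *)
pose N := (maxn N0 (maxn i (maxn (size ks) (\max_(k <- ks) k.1)))).
pose nk := [seq (k.1, mkseq k.2 N.+1) | k <- ks].
have Nle : [/\ N0 <= N, i <= N, size ks <= N & \max_(k <- ks) k.1 <= N].
  by rewrite /N; split; rewrite ?leq_max ?leqnn ?orbT.
have {Nle}[l0 li lk lS] := Nle.
have Onk : O i (map (c N.+1) nk).
  have unk : uniq nk by apply: N0P; exact: leqW.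
  apply: (ct N (i, nk)); rewrite mem_filter unk andTb.
  apply: (@allpairs_f _ _ _ (fun i (ks : seq key) => (i, ks))).
    by rewrite mem_iota.
  apply/flatten_mapP; exists (size nk); first by rewrite mem_iota size_map.
  apply: mem_allseq => _ /mapP[k kks ->].
  apply: (@allpairs_f _ _ _ (fun z (eta : seq bool) => (z, eta))).
    rewrite mem_iota add0n ltnS /=; apply: leq_trans lS.
    exact: (@leq_bigmax_seq _ _ predT (fun k : nat * (nat -> bool) => k.1)).
  by rewrite -{2}(size_mkseq k.2 N.+1) mem_bseqs.
pose M := \max_(k <- ks) size (c N.+1 (k.1, mkseq k.2 N.+1)).
exists M; apply: O_mono Onk _; rewrite /nk -map_comp.
have kM k : k \in ks -> size (c N.+1 (k.1, mkseq k.2 N.+1)) <= M.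
  by move=> kks; exact: (@leq_bigmax_seq _ _ predT
    (fun k : nat * (nat -> bool) => size (c N.+1 (k.1, mkseq k.2 N.+1)))).
elim: (ks) kM => //= k r IH kM; rewrite /ppre /= -/(ppre _ _).
rewrite IH ?andbT; last by move=> k' k'r; apply: kM; rewrite inE k'r orbT.
rewrite prefixE; apply/eqP/(@eq_from_nth _ false).
  by rewrite size_takel // size_mkseq kM // mem_head.
move=> t; rewrite size_take size_mkseq => tlt.
have tc : t < size (c N.+1 (k.1, mkseq k.2 N.+1)).
  move: tlt; case: ifP => // /negbT; rewrite -leqNgt => h h'.
  exact: leq_trans h' h.
rewrite nth_take // nth_mkseq; last by apply: leq_trans tc (kM _ (mem_head _ _)).
exact: phiE.
Qed.
End Mycielski.

(** * Hereditary sets and independent elements *)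

(* Hereditary sets over the reals, tagged by their level: level 0 is the reals themselves. *)
Definition hset := {i : nat & V i}.
HB.instance Definition _ := gen_eqMixin hset.

Definition lev (u : hset) : nat := projT1 u.
Definition rbit (u : hset) (t : nat) : bool :=
  match u with existT i v => match i return V i -> bool with
    | 0 => fun r => r t | _ => fun _ => false end v end.
Definition umemP (u w : hset) : Prop := exists i (v : V i.+1) (v' : V i),
  [/\ u = existT V i.+1 v, w = existT V i v' & v v'].
Definition umem u w : bool := `[< umemP u w >].

Lemma existT_inj i (v w : V i) : existT V i v = existT V i w -> v = w.
Proof. exact: (Eqdep_dec.inj_pair2_eq_dec nat PeanoNat.Nat.eq_dec). Qed.

Definition uval x i l : hset := existT V i (hval x i l).

Lemma umem_exist i (v : V i.+1) (w : V i) :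
  umem (existT V i.+1 v) (existT V i w) = `[< v w >].
Proof.
apply/asboolP/asboolP => [[j [v' [w' [e1 e2 h]]]]|h]; last by exists i, v, w.
have /= e := congr1 (@projT1 _ _) e2; subst j; move: e1 e2.
by move=> /existT_inj -> /existT_inj ->.
Qed.

Lemma umem_uval n x i l k : Xn n x -> ltb i.+1 n ->
  umem (uval x i.+1 l) (uval x i k) = x i.+1 l k.
Proof. by move=> Xx lin; rewrite umem_exist; apply/asboolP/idP => /(val_mem Xx l k lin). Qed.

Lemma umem_lev u w : umem u w -> lev u = (lev w).+1.
Proof. by move=> /asboolP[i [v [v' [-> -> _]]]]. Qed.

Definition world n x (u : hset) : Prop := exists i l, ltb i n /\ u = uval x i l.

(** Extensionality relative to [W]. It holds for a world, and for the union of two, because these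
    are closed under taking members. *)
Definition separates (W : hset -> Prop) := forall u u', W u -> W u' -> lev u = lev u' -> u != u' ->
  (lev u = 0 /\ exists t, rbit u t != rbit u' t) \/
  exists w, [/\ W w, (lev w).+1 = lev u & umem u w != umem u' w].

Lemma rbit_inj u u' : lev u = 0 -> lev u' = 0 -> u != u' -> exists t, rbit u t != rbit u' t.
Proof.
case: u u' => [i r] [i' r'] /= e e'; subst i i'; move=> /eqP ne.
apply: contrapT => h; apply: ne; congr existT; apply/funext => t.
by apply/eqP; apply: contrapT => /negP nt; apply: h; exists t.
Qed.

Lemma separates_world2 n x y : separates (fun u => world n x u \/ world n y u).
Proof.
move=> u u' Wu Wu' e ne.
case: (posnP (lev u)) => [l0|]; first by left; split=> //; apply: rbit_inj => //; rewrite -e.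
move=> lpos; right; case: u u' Wu Wu' e ne lpos => [[//|i] v] [i' v'] Wu Wu' /= e; subst i'.
move=> /eqP ne _.
have [w] : exists w, (v w <> v' w).
  apply: contrapT => h; apply: ne; congr existT; apply/funext => w.
  by apply: contrapT => h'; apply: h; exists w.
have mem z s : world n x (existT V i.+1 z) \/ world n y (existT V i.+1 z) -> z s ->
    world n x (existT V i s) \/ world n y (existT V i s).
  have one u0 : world n u0 (existT V i.+1 z) -> z s -> world n u0 (existT V i s).
    move=> [j [l [lj]]] ez; have ej := congr1 (@projT1 _ _) ez; rewrite /= in ej; subst j.
    move/existT_inj: ez => -> [k [_ ->]]; exists i, k; split=> //.
    exact: ltb_leq (leqnSn i) lj.
  by case=> h zs; [left|right]; exact: one.
move=> vw; exists (existT V i w); split=> //.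
  have [h|h] := pselect (v w); first exact: mem Wu h.
  have h' : v' w by apply: contrapT => h'; apply: vw; apply/propext; split.
  exact: mem Wu' h'.
rewrite !umem_exist; apply/eqP => h; apply: vw; apply/propext.
by split=> /asboolP hh; apply/asboolP; rewrite ?h // -h.
Qed.

Lemma separates_world n x : separates (world n x).
Proof.
move=> u u' Wu Wu' e ne.
have [|[w [Ww l m]]] := @separates_world2 n x x u u' (or_introl Wu) (or_introl Wu') e ne.
  by left.
by right; exists w; split=> //; case: Ww.
Qed.

Definition infoT : countType := (nat * nat * seq (nat * seq bool * seq bool))%type.
Definition body : countType := (nat * seq bool * seq infoT * seq infoT)%type.
(* An element: a finite list of parameters, a rank, and a body (N, start, up, down) with two
   finite tables; the element of higher rank decides membership between two elements by
   looking up what it sees of the other one. *)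
Definition elt := (seq hset * (nat * body))%type.

Definition par (e : elt) := e.1.
Definition rank (e : elt) := e.2.1.
Definition prec (e : elt) : nat := e.2.2.1.1.1.
Definition start (e : elt) : seq bool := e.2.2.1.1.2.
Definition up (e : elt) : seq infoT := e.2.2.1.2.
Definition down (e : elt) : seq infoT := e.2.2.2.

(** A finite view of [a]: coarse enough to be listed in a table and to depend on finitely many bits
    of a code, fine enough, for suitable [N] and [Q], to tell finitely many elements apart. *)
Definition info (N : nat) (Q : seq hset) (a : elt) : infoT :=
  (rank a, pickle (a.2.2 : body),
   [seq (lev w, mkseq (rbit w) N, [seq umem w v | v <- Q]) | w <- par a]).

(** [e] stands one level below [a]. The one of higher rank decides, so an element of new rank can be
    added with its relations upwards and downwards prescribed at will. *)
Definition memEl (e a : elt) : bool :=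
  if rank a <= rank e then info (prec e) (par e) a \in up e
  else info (prec a) (par a) e \in down a.

Definition inL j (W : hset -> Prop) (e : elt) := forall u, u \in par e -> W u /\ lev u <= j.

Lemma inL_leq i j W e : i <= j -> inL i W e -> inL j W e.
Proof. by move=> ij h u /h[? l]; split=> //; exact: leq_trans ij. Qed.

Lemma inL_sub j (W W' : hset -> Prop) e : (forall u, W u -> lev u <= j -> W' u) ->
  inL j W e -> inL j W' e.
Proof. by move=> WW h u /h[w l]; split=> //; exact: WW. Qed.

(** * Independence of the elements *)

Section Extension.
Variable W : hset -> Prop.
Hypothesis sepW : separates W.

(** Two parameters of level at most [j.+1] differ in a bit or in a member of level at most [j].
    Hence an element whose parameters lie one level lower can still distinguish [a] from [a']. *)
Lemma info_neq j (a a' : elt) : inL j.+1 W a -> inL j.+1 W a' -> a != a' ->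
  exists (Q : seq hset) N0, (forall v, v \in Q -> W v /\ lev v <= j) /\
  forall Q' N, {subset Q <= Q'} -> N0 <= N -> info N Q' a != info N Q' a'.
Proof.
case: a a' => [P [r b]] [P' [r' b']] La La' ne.
have [[er eb]|h] := pselect (r = r' /\ b = b'); last first.
  exists [::], 0; split=> // Q' N _ _; apply/eqP => -[e1 e2 _]; apply: h; split=> //.
  by have := congr1 (@unpickle body) e2; rewrite !pickleK => -[].
subst r' b'; have {}ne : P != P' by apply: contraNneq ne => ->.
have [sz|sz] := eqVneq (size P) (size P'); last first.
  exists [::], 0; split=> // Q' N _ _; apply/eqP => -[e]; case/eqP: sz.
  by move/(congr1 size): e; rewrite !size_map.
pose u0 : hset := existT V 0 (fun _ => false).
have [i iP ni] : exists2 i, i < size P & nth u0 P i != nth u0 P' i.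
  apply: contrapT => h; case/eqP: ne; apply: (@eq_from_nth _ u0) => // i iP.
  by apply/eqP; apply: contrapT => /negP ni; apply: h; exists i.
set u := nth u0 P i in ni; set u' := nth u0 P' i in ni.
have [Wu lu] : W u /\ lev u <= j.+1 by apply: La; exact: mem_nth.
have [Wu' lu'] : W u' /\ lev u' <= j.+1 by apply: La'; apply: mem_nth; rewrite -sz.
have nthi N Q : info N Q (P, (r, b)) = info N Q (P', (r, b)) ->
    (lev u, mkseq (rbit u) N, [seq umem u v | v <- Q]) =
    (lev u', mkseq (rbit u') N, [seq umem u' v | v <- Q]).
  move=> [e]; have := congr1 (fun s => nth (0, [::], [::]) s i) e.
  by rewrite !(nth_map u0) // -sz.
have [e|nl] := eqVneq (lev u) (lev u'); last first.
  by exists [::], 0; split=> // Q' N _ _; apply/eqP => /nthi[h]; rewrite h eqxx in nl.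
have [[_ [t nt]]|[w [Ww lw nw]]] := sepW Wu Wu' e ni.
  exists [::], t.+1; split=> // Q' N _ tN; apply/eqP => /nthi[_ h _].
  case/eqP: nt; have := congr1 (fun s => nth false s t) h.
  by rewrite !nth_mkseq.
exists [:: w], 0; split.
  by move=> v; rewrite inE => /eqP ->; split=> //; rewrite -ltnS lw.
move=> Q' N wQ _; apply/eqP => /nthi[_ _ h]; case/eqP: nw.
have wQ' : w \in Q' by apply: wQ; exact: mem_head.
have := congr1 (fun s => nth false s (index w Q')) h.
by rewrite !(nth_map u0) ?index_mem // nth_index.
Qed.

Lemma info_inj j (s : seq elt) : (forall a, a \in s -> inL j.+1 W a) ->
  exists (Q : seq hset) N, (forall v, v \in Q -> W v /\ lev v <= j) /\
  forall Q', {subset Q <= Q'} -> {in s &, injective (info N Q')}.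
Proof.
move=> Ls.
have step (ps : seq (elt * elt)) : (forall p, p \in ps -> p.1 \in s /\ p.2 \in s) ->
    exists (Q : seq hset) N0, (forall v, v \in Q -> W v /\ lev v <= j) /\
    forall Q' N, {subset Q <= Q'} -> N0 <= N -> forall p, p \in ps ->
      p.1 != p.2 -> info N Q' p.1 != info N Q' p.2.
  elim: ps => [|p ps IH] h; first by exists [::], 0.
  have [|Q1 [N1 [W1 P1]]] := IH; first by move=> q qs; apply: h; rewrite inE qs orbT.
  have [p1 p2] := h p (mem_head _ _).
  have [e|ne] := eqVneq p.1 p.2.
    exists Q1, N1; split=> // Q' N QQ NN q; rewrite inE => /orP[/eqP ->|]; last exact: P1.
    by rewrite e eqxx.
  have [Q2 [N2 [W2 P2]]] := info_neq (Ls _ p1) (Ls _ p2) ne.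
  exists (Q1 ++ Q2), (maxn N1 N2); split.
    by move=> v; rewrite mem_cat => /orP[/W1|/W2].
  move=> Q' N QQ; rewrite geq_max => /andP[l1 l2] q; rewrite inE => /orP[/eqP -> _|].
    by apply: P2 => // v vQ; apply: QQ; rewrite mem_cat vQ orbT.
  by apply: P1 => // v vQ; apply: QQ; rewrite mem_cat vQ.
have [|Q [N [WQ P]]] := step [seq (a, b) | a <- s, b <- s].
  by move=> _ /allpairsP[[a b] [/= ? ? ->]].
exists Q, N; split=> // Q' QQ a b as' bs e; apply/eqP; apply: contrapT => /negP ne.
have := P Q' N QQ (leqnn _) (a, b); rewrite e eqxx => /(_ _ ne); case/(_ _)/notF => //.
exact: allpairs_f.
Qed.

(** A rank above all others gives the new element every decision; [Q] and [N] make the views of the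
    given elements distinct, and its tables list the views to be accepted. *)
Lemma extension j (ups downs : seq elt) (eta theta : elt -> bool) (extra : seq hset)
    (st : seq bool) (r : nat) :
  (forall a, a \in ups -> inL j.+1 W a) -> (forall d, d \in downs -> inL j.+1 W d) ->
  (forall a, a \in ups ++ downs -> rank a < r) ->
  (forall u, u \in extra -> W u /\ lev u <= j) ->
  exists e, [/\ inL j W e, {subset extra <= par e}, rank e = r /\ start e = st,
    forall a, a \in ups -> memEl e a = eta a & forall d, d \in downs -> memEl d e = theta d].
Proof.
move=> Lu Ld rk Wx.
have [|Q [N [WQ inj]]] := @info_inj j (ups ++ downs).
  by move=> a; rewrite mem_cat => /orP[/Lu|/Ld].
pose P := extra ++ Q.
have {}inj : {in ups ++ downs &, injective (info N P)}.
  by apply: inj => v vQ; rewrite mem_cat vQ orbT.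
have tab (s : seq elt) (h : elt -> bool) a : {subset s <= ups ++ downs} -> a \in s ->
    (info N P a \in [seq info N P b | b <- s & h b]) = h a.
  move=> sub as'; apply/mapP/idP => [[b]|ha]; last by exists a; rewrite // mem_filter ha.
  by rewrite mem_filter => /andP[hb bs] /inj -> //; exact: sub.
exists (P, (r, (N, st, [seq info N P a | a <- ups & eta a],
                      [seq info N P d | d <- downs & theta d]))).
split=> //.
- by move=> u; rewrite /par /= mem_cat => /orP[/Wx|/WQ].
- by move=> u ux; rewrite /par /= mem_cat ux.
- move=> a au; rewrite /memEl /rank /= ltnW; last by apply: rk; rewrite mem_cat au.
  by rewrite tab // => b bs; rewrite mem_cat bs.
- move=> d dd; have rd : rank d < r by apply: rk; rewrite mem_cat dd orbT.
  rewrite /memEl {1}/rank /= leqNgt rd /=.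
  by rewrite tab // => b bs; rewrite mem_cat bs orbT.
Qed.
End Extension.

Lemma ppre_size ss ss' : ppre ss ss' -> size ss = size ss'.
Proof. by rewrite /ppre all2E => /andP[/eqP]. Qed.

Lemma prefix_nth (s s' : seq bool) t : prefix s s' -> t < size s ->
  t < size s' /\ nth false s' t = nth false s t.
Proof.
move=> /prefixP[r ->] ts; rewrite nth_cat ts size_cat; split=> //.
exact: leq_trans ts (leq_addr _ _).
Qed.

Lemma ppreI ss ss' : size ss = size ss' ->
  (forall i, i < size ss -> prefix (nth [::] ss i) (nth [::] ss' i)) -> ppre ss ss'.
Proof.
elim: ss ss' => [|s ss IH] [|s' ss'] //= [e] h; rewrite /ppre /= (h 0) //=.
by apply: IH => // i; exact: (h i.+1).
Qed.

(** Compatibility replaces refinement because conditions trimmed to some coordinates need not refine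
    the given one. *)
Definition predense (D : cd PS -> Prop) := forall s, ne s -> exists2 d, D d & ne (meet s d).

(** * Generic labels for level 0 *)

Section Labels.
Variable D : nat -> cd PS -> Prop.
Hypothesis preD : forall i, predense (D i).

Definition upper (tau : cd PS) : cd PS := [seq cv <- tau | cv.1.1.1 != 0].

(* The strings ss are long enough as initial segments of the level 0 rows to be compatible
   with some condition of D i extending tau, whatever comes after them. *)
Definition meets i (tau : cd PS) (ss : seq (seq bool)) := ne tau ->
  exists (d : cd PS) (y : Pt), [/\ D i d, sat d y, sat (upper tau) y,
    forall c, c \in dom d -> c.1.1 = 0 -> c.1.2 < size ss -> c.2 < size (nth [::] ss c.1.2) &
    forall l t, l < size ss -> t < size (nth [::] ss l) -> y 0 l t = nth false (nth [::] ss l) t].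

Definition put (ss : seq (seq bool)) (y : Pt) : Pt := fun j l t =>
  if [&& j == 0, l < size ss & t < size (nth [::] ss l)] then nth false (nth [::] ss l) t
  else y j l t.

Lemma put_upper ss y tau : sat (upper tau) y -> sat (upper tau) (put ss y).
Proof.
move=> ty; apply: sat_eq ty _ => -[[j l] t] /mapP[cv]; rewrite mem_filter => /andP[+ _] ->.
by rewrite /evPt /put => /negbTE ->.
Qed.

Lemma meets_mono i tau ss ss' : meets i tau ss -> ppre ss ss' -> meets i tau ss'.
Proof.
move=> h pss net; have [d [y [Dd dy ty dss yss]]] := h net.
have sz := ppre_size pss.
have nthp l t : l < size ss -> t < size (nth [::] ss l) ->
    t < size (nth [::] ss' l) /\ nth false (nth [::] ss' l) t = nth false (nth [::] ss l) t.
  by move=> ls ts; apply: prefix_nth ts; exact: ppre_nth.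
exists d, (put ss' y); split=> //.
- apply: sat_eq dy _ => -[[j l] t] cd0; rewrite /evPt /put /=.
  case: ifP => // /and3P[/eqP j0 ls _]; rewrite -sz in ls; subst j.
  have ts := dss _ cd0 erefl ls.
  by rewrite yss // (nthp l t ls ts).2.
- exact: put_upper.
- by move=> c cd0 c0; rewrite -sz => ls; have [] := nthp _ _ ls (dss _ cd0 c0 ls).
- by move=> l t ls ts; rewrite /put ls ts.
Qed.

Lemma meets_dense i tau ss : exists2 ss', ppre ss ss' & meets i tau ss'.
Proof.
have [[y0 ty0]|nt] := pselect (ne tau); last first.
  by exists ss => [|/nt //]; apply: ppreI => // j _; exact: prefix_refl.
have uy0 : sat (upper tau) y0.
  by move/psatP: ty0 => ty0; apply/psatP => c v; rewrite mem_filter => /andP[_]; exact: ty0.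
pose L := [seq ((0, l), t) | l <- iota 0 (size ss), t <- iota 0 (size (nth [::] ss l))].
pose s : cd PS := meet (upper tau) (cond_of (put ss y0) L).
have nes : ne s.
  by exists (put ss y0); apply/satI; split; [exact: put_upper|exact: sat_cond_of].
have [d Dd [y /satI[/satI[uy /cond_ofP ye] dy]]] := preD i nes.
have yss l t : l < size ss -> t < size (nth [::] ss l) -> y 0 l t = nth false (nth [::] ss l) t.
  move=> ls ts; have := ye (0, l, t); rewrite /evPt /= => ->; first by rewrite /put ls ts.
  by apply/allpairsPdep; exists l, t; rewrite !mem_iota.
pose M l := maxn (size (nth [::] ss l)) (bound (dom d)).
pose ss' := mkseq (fun l => mkseq (y 0 l) (M l)) (size ss).
exists ss'.
  apply: ppreI; rewrite ?size_mkseq // => l ls; rewrite nth_mkseq //.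
  rewrite prefixE; apply/eqP/(@eq_from_nth _ false).
    by rewrite size_takel // size_mkseq leq_maxl.
  move=> t; rewrite size_takel ?size_mkseq ?leq_maxl // => ts.
  by rewrite nth_take // nth_mkseq ?yss // (leq_trans ts) // leq_maxl.
move=> _; exists d, y; split=> //.
- move=> c cd0 _; rewrite size_mkseq => ls; rewrite nth_mkseq // size_mkseq.
  by have [_ _ h] := boundP cd0; rewrite (leq_trans h) // leq_maxr.
- move=> l t; rewrite size_mkseq => ls; rewrite nth_mkseq // size_mkseq => ts.
  by rewrite nth_mkseq.
Qed.

Definition apart (ss : seq (seq bool)) := 1 < size ss -> exists t,
  [/\ t < size (nth [::] ss 0), t < size (nth [::] ss 1) &
      nth false (nth [::] ss 0) t != nth false (nth [::] ss 1) t].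

Lemma apart_mono ss ss' : apart ss -> ppre ss ss' -> apart ss'.
Proof.
move=> h pss; rewrite /apart -(ppre_size pss) => s1; have [t [t0 t1 ne]] := h s1.
have [u0 e0] := prefix_nth (ppre_nth 0 pss) t0.
have [u1 e1] := prefix_nth (ppre_nth 1 pss) t1.
by exists t; rewrite u0 u1 e0 e1.
Qed.

Lemma apart_dense ss : exists2 ss', ppre ss ss' & apart ss'.
Proof.
have triv s : size s <= 1 -> exists2 ss', ppre s ss' & apart ss'.
  move=> s1; exists s; first by apply: ppreI => // j _; exact: prefix_refl.
  by move=> h; move: (leq_trans h s1); rewrite ltnn.
case: ss => [|s [|s' ss]]; try exact: triv.
pose t := maxn (size s) (size s').
pose pad (r : seq bool) b := r ++ rcons (nseq (t - size r) false) b.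
have szp r b : size r <= t -> size (pad r b) = t.+1 /\ nth false (pad r b) t = b.
  move=> rt; split; first by rewrite size_cat size_rcons size_nseq addnS subnKC.
  by rewrite nth_cat ltnNge rt /= nth_rcons size_nseq ltnn eqxx.
have [sz e] := szp s true (leq_maxl _ _); have [sz' e'] := szp s' false (leq_maxr _ _).
exists (pad s true :: pad s' false :: ss).
  apply: ppreI => // -[|[|i]] _ /=; [exact: prefix_prefix|exact: prefix_prefix|exact: prefix_refl].
by move=> _; exists t; rewrite /= sz sz' e e' !ltnSn.
Qed.

Definition startS (c : nat) : seq bool :=
  if @unpickle (nat * (nat * body))%type c is Some d then d.2.2.1.1.2 else [::].

(** The clauses serve, in order, to prescribe the start of a new label, to keep the reduction Borel,
    to keep rows of level 0 distinct, and to find conditions of each [D i] compatible with finitely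
    many complete labels. *)
Definition labelling (phi : nat -> (nat -> bool) -> nat -> bool) :=
  [/\ forall c xi t, t < size (startS c) -> phi c xi t = nth false (startS c) t,
      forall c t, exists N, forall xi xi', (forall i, i < N -> xi i = xi' i) ->
        phi c xi t = phi c xi' t,
      forall k k' : nat * (nat -> bool), k != k' -> exists t, phi k.1 k.2 t != phi k'.1 k'.2 t &
      forall ks i tau, uniq ks -> exists N, meets i tau [seq mkseq (phi k.1 k.2) N | k <- ks]].

Lemma labelling_ex : exists phi, labelling phi.
Proof.
(* One sequence of requirements: [None] codes distinctness of labels, [Some (i, tau)] codes
   [meets i tau]. *)
pose O (m : nat) := if @unpickle (option (nat * seq (I3 * bool)))%type m is Some (Some it)
  then meets it.1 it.2 else apart.
have Om m ss ss' : O m ss -> ppre ss ss' -> O m ss'.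
  by rewrite /O; case: unpickle => [[it|]|]; [exact: meets_mono|exact: apart_mono|exact: apart_mono].
have Od m ss : exists2 ss', ppre ss ss' & O m ss'.
  by rewrite /O; case: unpickle => [[it|]|]; [exact: meets_dense|exact: apart_dense|exact: apart_dense].
have [phi [p1 p2 p3]] := mycielski Om Od startS.
exists phi; split=> //.
- move=> k k' ne; have [|N] := p3 [:: k; k'] (pickle (None : option (nat * seq (I3 * bool)))).
    by rewrite /= inE ne.
  rewrite /O pickleK => /(_ isT)[t [/= t1 t2]]; rewrite size_mkseq in t1.
  by rewrite !nth_mkseq // => h; exists t.
- move=> ks i tau uks; have [N] := p3 ks (pickle (Some (i, tau) : option (nat * seq (I3 * bool)))) uks.
  by rewrite /O pickleK => h; exists N.
Qed.
End Labels.

(** * Finite approximations to generic enumerations *)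

Section States.
Variables (D : nat -> cd PS -> Prop) (phi : nat -> (nat -> bool) -> nat -> bool).
Hypothesis hphi : labelling D phi.

Definition u0 : hset := existT V 0 (fun _ => false).
Definition e0 : elt := ([::], (0, (0, [::], [::], [::]))).

(** The finite data form the tag and the bits of all parameters the branch. At level 0 the
    parameters are reals, so the key determines the element. *)
Definition lkey (e : elt) : nat * (nat -> bool) :=
  (pickle (size (par e), e.2 : nat * body),
   fun n => if @unpickle (nat * nat)%type n is Some it then rbit (nth u0 (par e) it.1) it.2
            else false).
Definition lab (e : elt) : nat -> bool := phi (lkey e).1 (lkey e).2.

Definition point (eps : nat -> nat -> elt) : Pt := fun j l m =>
  match j with 0 => lab (eps 0 l) m | j'.+1 => memEl (eps j' m) (eps j'.+1 l) end.

Lemma lkey_inj W e e' : inL 0 W e -> inL 0 W e' -> lkey e = lkey e' -> e = e'.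
Proof.
case: e e' => [P r] [P' r'] Le Le' [/(congr1 (@unpickle (nat * (nat * body))%type))].
rewrite !pickleK => -[sz ->] e; congr (_, _).
apply: (@eq_from_nth _ u0) => // i iP; apply/eqP; apply: contrapT => /negP ni.
have [_ l] := Le _ (mem_nth u0 iP); rewrite /par /= sz in iP.
have [_ l'] := Le' _ (mem_nth u0 iP).
rewrite !leqn0 in l l'; have [t /eqP nt] := rbit_inj (eqP l) (eqP l') ni.
by apply: nt; have := congr1 (@^~ (pickle (i, t))) e; rewrite /= pickleK.
Qed.

Lemma lab_start e t : t < size (start e) -> lab e t = nth false (start e) t.
Proof.
have [h _ _ _] := hphi; have := h (lkey e).1 (lkey e).2 t.
by rewrite /startS /lkey pickleK.
Qed.

Lemma lab_neq W e e' : inL 0 W e -> inL 0 W e' -> e != e' -> exists t, lab e t != lab e' t.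
Proof.
move=> Le Le' /eqP ne; have [_ _ h _] := hphi; apply: h.
by apply/eqP => /(lkey_inj Le Le').
Qed.

Definition state := nat -> seq elt.
Implicit Types E : state.
Definition nthE E j l := nth e0 (E j) l.
(** The bits fixed by a state. An element of level 0 fixes its whole row, whereas above level 0 only
    pairs of listed elements are decided, which leaves finitely many bits. *)
Definition det E (c : I3) :=
  (c.1.2 < size (E c.1.1)) && (if c.1.1 is j.+1 then c.2 < size (E j) else true).
Definition valid W E := [/\ forall j, uniq (E j), forall j e, e \in E j -> inL j W e &
  exists J, forall j, J <= j -> E j = [::]].
Definition agree E (d : cd PS) := forall c v, (c, v) \in (d : seq (I3 * bool)) -> det E c ->
  evPt (point (nthE E)) c = v.
Definition holds E (d : cd PS) := forall c v, (c, v) \in (d : seq (I3 * bool)) ->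
  det E c /\ evPt (point (nthE E)) c = v.
Definition extends E E' := forall j, exists s, E' j = E j ++ s.

Lemma ext_refl E : extends E E.
Proof. by move=> j; exists [::]; rewrite cats0. Qed.

Lemma ext_trans E1 E2 E3 : extends E1 E2 -> extends E2 E3 -> extends E1 E3.
Proof.
by move=> h1 h2 j; have [s e] := h1 j; have [s' ->] := h2 j; exists (s ++ s'); rewrite e catA.
Qed.

Lemma ext_size E E' j : extends E E' -> size (E j) <= size (E' j).
Proof. by move=> /(_ j)[s ->]; rewrite size_cat leq_addr. Qed.

Lemma ext_nth E E' j l : extends E E' -> l < size (E j) -> nthE E' j l = nthE E j l.
Proof. by move=> /(_ j)[s e] lj; rewrite /nthE e nth_cat lj. Qed.

Lemma det_point E eps c : (forall j l, l < size (E j) -> eps j l = nthE E j l) -> det E c ->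
  evPt (point eps) c = evPt (point (nthE E)) c.
Proof.
by case: c => [[[|j] l] m] h /andP[/= lj mj]; rewrite /evPt /= !h.
Qed.

Definition upd E j e : state := fun i => if i == j then rcons (E i) e else E i.

Lemma nth_upd E j e i l : nthE (upd E j e) i l =
  if (i == j) && (l == size (E j)) then e else nthE E i l.
Proof.
rewrite /nthE /upd; case: eqP => [->|//]; rewrite nth_rcons.
by case: ltngtP => // h; rewrite nth_default // ltnW.
Qed.

Lemma size_upd E j e i : size (upd E j e i) = size (E i) + (i == j).
Proof. by rewrite /upd; case: eqP => _; rewrite ?size_rcons ?addn1 ?addn0. Qed.

Lemma ext_upd E j e : extends E (upd E j e).
Proof.
move=> i; rewrite /upd; case: (i == j); last by exists [::]; rewrite cats0.
by exists [:: e]; rewrite cats1.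
Qed.

Lemma valid_upd W E j e : valid W E -> inL j W e -> e \notin E j -> valid W (upd E j e).
Proof.
move=> [un inl [J JP]] Le ne; split.
- move=> i; rewrite /upd; case: eqP => [->|_] //; by rewrite rcons_uniq ne un.
- move=> i a; rewrite /upd; case: eqP => [->|_]; last exact: inl.
  by rewrite mem_rcons inE => /orP[/eqP -> //|]; exact: inl.
- exists (maxn J j.+1) => i; rewrite geq_max => /andP[Ji ji]; rewrite /upd.
  by rewrite JP //; case: eqP ji => // ->; rewrite ltnn.
Qed.

Section World.
Variable W : hset -> Prop.
Hypothesis sepW : separates W.

(** A point [y] satisfying [d] dictates the new element: its relations to the listed elements of the
    two adjacent levels and, at level 0, an initial segment long enough for [d]. *)
Lemma add1 E d j (extra : seq hset) : valid W E -> agree E d -> ne d ->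
  (forall u, u \in extra -> W u /\ lev u <= j) ->
  exists e, [/\ inL j W e, {subset extra <= par e}, e \notin E j & agree (upd E j e) d].
Proof.
move=> [un inl _] ag [y yd] Wx.
pose lj := size (E j); pose T := bound (dom d).
pose downs := if j is j'.+1 then E j' else [::].
pose all_el := E j.+1 ++ E j ++ downs.
pose r := (\max_(a <- all_el) rank a).+1.
have rk a : a \in all_el -> rank a < r.
  by move=> h; rewrite ltnS; exact: (@leq_bigmax_seq _ _ predT rank).
have [|||e [Le xe [re se] eta theta]] := @extension W sepW j (E j.+1) downs
  (fun a => evPt y (j.+1, index a (E j.+1), lj))
  (fun a => evPt y (j, lj, index a downs)) extra (mkseq (y 0 lj) T) r _ _ _ Wx.
- exact: inl.
- move=> a; rewrite /downs; case: (j) => // j' /inl; apply: inL_leq.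
  exact: leqW.
- by move=> a; rewrite mem_cat => h; apply: rk; rewrite !mem_cat; case/orP: h => ->; rewrite ?orbT.
exists e; split=> //.
  by apply/negP => h; have := rk e; rewrite re ltnn !mem_cat h orbT => /(_ isT).
move/psatP: yd => yd [[i l] m] v cd0; rewrite -(yd _ _ cd0) => /andP[/= li mi].
have [_ _ /= mT] := @boundP (dom d) _ (map_f fst cd0).
rewrite size_upd in li.
have old : det E (i, l, m) -> nthE (upd E j e) i l = nthE E i l ->
    (forall i', i = i'.+1 -> nthE (upd E j e) i' m = nthE E i' m) ->
    evPt (point (nthE (upd E j e))) (i, l, m) = evPt y (i, l, m).
  move=> dc h1 h2; rewrite (yd _ _ cd0) -(ag _ _ cd0 dc).
  by case: i {cd0 li mi dc} h1 h2 => [|i'] h1 h2; rewrite /evPt /= ?h1 ?(h2 i').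
have [/andP[/eqP ei /eqP el]|nrow] := boolP ((i == j) && (l == lj)).
  subst i l; case: j => [|j'] in Wx lj downs all_el r rk Le xe re se eta theta cd0 li mi old *.
    rewrite /evPt /= nth_upd !eqxx /= lab_start se ?size_mkseq //.
    by rewrite nth_mkseq.
  rewrite size_upd (ltn_eqF (ltnSn j')) addn0 in mi.
  rewrite /evPt /= !nth_upd !eqxx (ltn_eqF (ltnSn j')) /=.
  by rewrite theta ?mem_nth // /downs index_uniq.
have lE : l < size (E i).
  move: li nrow; rewrite negb_and; case: eqP => [->|_] /=; last by rewrite addn0.
  by rewrite addn1 ltnS leq_eqVlt => /orP[/eqP -> /=|//]; rewrite eqxx.
have hl : nthE (upd E j e) i l = nthE E i l by rewrite nth_upd (negbTE nrow).
case: i => [|i] in cd0 li mi old nrow lE hl *.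
  by apply: old => //; rewrite /det /= lE.
rewrite size_upd in mi.
have [/andP[/eqP ei /eqP em]|ncol] := boolP ((i == j) && (m == lj)).
  subst i m; rewrite /evPt /= nth_upd !eqxx /= hl /nthE eta ?mem_nth //.
  by rewrite index_uniq.
have mE : m < size (E i).
  move: mi ncol; rewrite negb_and; case: eqP => [->|_] /=; last by rewrite addn0.
  by rewrite addn1 ltnS leq_eqVlt => /orP[/eqP -> /=|//]; rewrite eqxx.
apply: old => //; first by rewrite /det /= lE.
by move=> _ [<-]; rewrite nth_upd (negbTE ncol).
Qed.

Lemma fill_level E d j (extra : seq hset) n : valid W E -> agree E d -> ne d ->
  (forall u, u \in extra -> W u /\ lev u <= j) ->
  exists E', [/\ valid W E', agree E' d, extends E E', n <= size (E' j) &
    (forall i, i != j -> E' i = E i) /\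
    forall a, a \in E' j -> a \in E j \/ {subset extra <= par a}].
Proof.
move=> vE aE ned Wx; elim: n => [|n [E1 [v1 a1 x1 s1 [o1 m1]]]].
  by exists E; split=> //; [exact: ext_refl|split=> // a; left].
have [e [Le xe ne ae]] := add1 v1 a1 ned Wx.
exists (upd E1 j e); split=> //.
- exact: valid_upd.
- exact: ext_trans x1 (ext_upd _ _ _).
- by rewrite size_upd eqxx addn1.
- split=> [i ij|a]; first by rewrite /upd (negbTE ij) o1.
  by rewrite /upd eqxx mem_rcons inE => /orP[/eqP ->|/m1 //]; right.
Qed.

Lemma fill E d (X : nat -> seq hset) B n : valid W E -> agree E d -> ne d ->
  (forall j u, u \in X j -> W u /\ lev u <= j) ->
  exists E', [/\ valid W E', agree E' d, extends E E',
    forall j, j < B -> n <= size (E' j) &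
    forall j a, a \in E' j -> a \in E j \/ {subset X j <= par a}].
Proof.
move=> vE aE ned WX; elim: B => [|B [E1 [v1 a1 x1 s1 m1]]].
  by exists E; split=> //; [exact: ext_refl|move=> j a; left].
have [E2 [v2 a2 x2 s2 [o2 m2]]] := @fill_level E1 d B (X B) n v1 a1 ned (WX B).
exists E2; split=> //; first exact: ext_trans x1 x2.
- move=> j; rewrite ltnS leq_eqVlt => /orP[/eqP -> //|jB].
  by rewrite o2 ?(ltn_eqF jB) //; exact: s1.
- move=> j a; have [->|jB] := eqVneq j B.
    by move=> /m2[|]; [exact: m1|right].
  by rewrite o2 //; exact: m1.
Qed.

Lemma fill_holds E d (X : nat -> seq hset) B : valid W E -> agree E d -> ne d ->
  (forall j u, u \in X j -> W u /\ lev u <= j) ->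
  exists E', [/\ valid W E', holds E' d, extends E E',
    forall j, j < B -> B <= size (E' j) &
    forall j a, a \in E' j -> a \in E j \/ {subset X j <= par a}].
Proof.
move=> vE aE ned WX; pose N := maxn B (bound (dom d)).
have [E' [v a x s m]] := fill N N vE aE ned WX.
exists E'; split=> //.
  move=> c w cd0; have dc : det E' c.
    have [h1 h2 h3] := @boundP (dom d) _ (map_f fst cd0).
    have le k : k < bound (dom d) -> k < N by move=> h; rewrite (leq_trans h) // leq_maxr.
    case: c {cd0} h1 h2 h3 => [[j l] k] /= h1 h2 h3; rewrite /det /=.
    rewrite (leq_trans (le _ h2)) ?s ?le //=.
    by case: j h1 => // j h1; rewrite (leq_trans (le _ h3)) ?s ?le // ltnW.
  by split=> //; exact: a.
by move=> j jB; rewrite (leq_trans (leq_maxl B (bound (dom d)))) ?s // (leq_trans jB) ?leq_maxl.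
Qed.

(** The finitely many bits fixed above level 0 form [tau]. Genericity of the labels then provides a
    [d] in [D i] that agrees with [E], and new elements make the rest of [d] true. *)
Lemma step E i : valid W E ->
  exists E' d, [/\ valid W E', extends E E', D i d & holds E' d].
Proof.
move=> vE; have [un inl [J JP]] := vE.
pose Z := \max_(j <- iota 0 J) size (E j).
have szZ j : size (E j) <= Z.
  case: (leqP J j) => Jj; first by rewrite JP.
  by apply: (@leq_bigmax_seq _ _ predT (fun j => size (E j))); rewrite ?mem_iota.
pose L : seq I3 := [seq (jl, m) | jl <- [seq (j, l) | j <- iota 0 J, l <- iota 0 Z], m <- iota 0 Z].
pose tau : cd PS := cond_of (point (nthE E)) L.
have [_ _ _ hm] := hphi.
have [|N] := hm (map lkey (E 0)) i tau.
  by rewrite map_inj_in_uniq // => a b /inl La /inl Lb; exact: lkey_inj La Lb.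
case; first by exists (point (nthE E)); exact: sat_cond_of.
move=> d [y [Dd dy ty dss yss]].
rewrite !size_map in dss yss.
have lt l : l < size (E 0) -> size (nth [::] [seq mkseq (phi k.1 k.2) N | k <- map lkey (E 0)] l) = N.
  by move=> l0; rewrite (nth_map (0, fun _ => false)); [rewrite size_mkseq|rewrite size_map].
have aE : agree E d.
  move=> [[j l] m] v cd0; move/psatP: dy => dy; rewrite -(dy _ _ cd0) => /andP[/= lj mj].
  have cdom : (j, l, m) \in dom d by exact: (map_f fst cd0).
  case: j lj mj cdom {cd0} => [|j] lj mj cdom.
    have mN := dss _ cdom erefl lj; rewrite /= lt // in mN.
    rewrite /evPt /= yss ?lt // (nth_map (0, fun _ => false)) ?size_map //.
    by rewrite nth_mkseq // (nth_map e0).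
  symmetry; move/psatP: ty => ty; apply: ty.
  rewrite mem_filter /=; apply: (map_f (fun c => (c, evPt (point (nthE E)) c))).
  have jJ : j.+1 < J by rewrite ltnNge; apply: contraL lj => /JP ->.
  apply: allpairs_f; last by rewrite mem_iota; exact: leq_trans mj (szZ j).
  by apply: allpairs_f; rewrite mem_iota //; exact: leq_trans lj (szZ _).
have ned : ne d by exists y.
have [|E' [v h x _ _]] := @fill_holds E d (fun _ => [::]) 0 vE aE ned; first by [].
by exists E', d.
Qed.
End World.
End States.

(** * The reduction *)

(** Places of a level above [j] or not below [n] are dropped, and non-codes give [e0], so that every
    number names an element of level [j]. *)
Definition el n x j (c : nat) : elt :=
  if @unpickle (seq (nat * nat) * (nat * body))%type c is Some pd
  then ([seq uval x il.1 il.2 | il <- pd.1 & (il.1 <= j) && ltb il.1 n], pd.2) else e0.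

Definition enumerates (W : hset -> Prop) (eps : nat -> nat -> elt) :=
  forall j e, inL j W e <-> exists l, eps j l = e.

Lemma el_enumerates n x : enumerates (world n x) (el n x).
Proof.
move=> j e; split=> [Le|[c <-]].
  have [il ilP] : exists il : seq (nat * nat),
      [seq uval x il.1 il.2 | il <- il & (il.1 <= j) && ltb il.1 n] = par e.
    move: Le; rewrite /inL; elim: (par e) => [|u P IH] h; first by exists [::].
    have [|il ilP] := IH; first by move=> w wP; apply: h; rewrite inE wP orbT.
    have [[i [l [ln ue]]] lj] := h u (mem_head _ _).
    exists ((i, l) :: il); rewrite /= ln andbT.
    by rewrite ue in lj *; rewrite /lev /= in lj; rewrite lj /= ilP.
  by exists (pickle (il, e.2)); rewrite /el pickleK /= ilP; case: (e).
move=> u; rewrite /el; case: unpickle => [[il d]|] //= /mapP[[i l]].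
rewrite mem_filter => /andP[/andP[/= ij ln] _] ->; split=> //.
by exists i, l.
Qed.

Section Reduction.
Variables (D : nat -> cd PS -> Prop) (phi : nat -> (nat -> bool) -> nat -> bool).
Hypothesis hphi : labelling D phi.
Variable n : natinf.

Definition red x : Pt := tr n (point phi (el n x)).

Lemma hval_point eps eps' j : (forall i, i < j -> forall l, exists l', eps i l = eps' i l') ->
  (forall i, i < j -> forall l, exists l', eps' i l = eps i l') ->
  forall l l', eps j l = eps' j l' -> hval (point phi eps) j l = hval (point phi eps') j l'.
Proof.
elim: j => [|j IH] h1 h2 l l' e /=; first by apply/funext => m; rewrite /point e.
have {}IH := IH (fun i ij => h1 i (ltnW ij)) (fun i ij => h2 i (ltnW ij)).
apply/funext => z; apply/propext; split=> -[k [hk ->]].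
  have [k' ek] := h1 j (ltnSn j) k; exists k'; rewrite -e -ek; split=> //.
  exact: IH.
have [k' ek] := h2 j (ltnSn j) k; exists k'; rewrite e -ek; split=> //.
by symmetry; apply: IH.
Qed.

(** The coded sets depend only on which elements are listed at each level. Hence a generic
    enumeration may replace the one in [red]. *)
Lemma AA_point W eps eps' j : enumerates W eps -> enumerates W eps' ->
  AA (point phi eps) j = AA (point phi eps') j.
Proof.
move=> en en'.
have h (e1 e2 : nat -> nat -> elt) : enumerates W e1 -> enumerates W e2 ->
    forall i l, exists l', e1 i l = e2 i l'.
  move=> en1 en2 i l; have [l' l'P] := (en2 i (e1 i l)).1 ((en1 i _).2 (ex_intro _ l erefl)).
  by exists l'.
have H1 := h _ _ en en'; have H2 := h _ _ en' en.
apply: AA_eq => l.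
  have [l' e] := H1 j l; exists l'; by apply: hval_point => // i _.
have [l' e] := H2 j l; exists l'; by apply: hval_point => // i _.
Qed.

(** Independence yields a set containing a given element, a member of a given element, and a member
    of just one of two elements. So distinct elements have distinct rows, at level 0 by their
    labels, and (3) follows. *)
Lemma point_Xn W eps : separates W -> enumerates W eps -> Xn n (tr n (point phi eps)).
Proof.
move=> sW en.
have inl j l : inL j W (eps j l) by apply/en; exists l.
split=> [i /ltbP/negP|[//|i] _ /ltbP lin]; first exact: tr_out.
have lin' : ltb i n by exact: ltb_leq (leqnSn i) lin.
rewrite /tr /= lin lin'; split; [|split].
- move=> m.
  have [||||e [Le _ _ _ h]] := @extension W sW i.+1 [::] [:: eps i m] (fun _ => true)
    (fun _ => true) [::] [::] (rank (eps i m)).+1; try by [].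
  + by move=> d; rewrite inE => /eqP ->; apply: inL_leq (inl i m); exact: leqW.
  + by move=> d; rewrite inE => /eqP ->.
  have [k ek] := (en i.+1 e).1 Le.
  by exists k; rewrite /point ek h // mem_head.
- move=> k.
  have [||||e [Le _ _ h _]] := @extension W sW i [:: eps i.+1 k] [::] (fun _ => true)
    (fun _ => true) [::] [::] (rank (eps i.+1 k)).+1; try by [].
  + by move=> d; rewrite inE => /eqP ->.
  + by move=> d; rewrite inE => /eqP ->.
  have [m em] := (en i e).1 Le.
  by exists m; rewrite /point em h // mem_head.
- move=> k l1 l2 e; suff ee : eps i l1 = eps i l2 by rewrite /point ee.
  apply/eqP; apply: contrapT => /negP ne; case: i lin lin' e ne => [|i] lin lin' e ne.
    have [t /eqP] := lab_neq hphi (inl 0 l1) (inl 0 l2) ne; apply.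
    by have := congr1 (@^~ t) e.
  have [||||d [Ld _ _ h _]] := @extension W sW i [:: eps i.+1 l1; eps i.+1 l2] [::]
    (fun a => a == eps i.+1 l1) (fun _ => true) [::] [::]
    (maxn (rank (eps i.+1 l1)) (rank (eps i.+1 l2))).+1; try by [].
  + by move=> a; rewrite !inE => /orP[] /eqP ->.
  + by move=> a; rewrite !inE => /orP[] /eqP ->; rewrite ltnS leq_max leqnn ?orbT.
  have [m em] := (en i d).1 Ld.
  have := congr1 (@^~ m) e; rewrite /point em !h ?inE ?eqxx ?orbT //.
  by move=> /esym/eqP h'; rewrite h' eqxx in ne.
Qed.

Lemma red_Xn x : Xn n (red x).
Proof. exact: point_Xn (@separates_world n x) (@el_enumerates n x). Qed.

Lemma world_sub x y j : (forall i, i <= j -> AA x i = AA y i) ->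
  forall u, world n x u -> lev u <= j -> world n y u.
Proof.
move=> e u [i [l [ln ->]]] /= lj; have [l' el] := AA_ex l (e i lj).
by exists i, l'; rewrite /uval el.
Qed.

Lemma red_Frel x y : Xn n x -> Xn n y -> Frel n x y -> Frel n (red x) (red y).
Proof.
move=> Xx Xy /(FrelP Xx Xy) e; apply/(FrelP (red_Xn x) (red_Xn y)) => j jn.
rewrite !AA_tr //; apply: (@AA_point (world n x)); first exact: el_enumerates.
have sub u v w : (forall i, ltb i n -> AA u i = AA v i) -> world n u w -> world n v w.
  move=> h [i [l [ln ->]]]; have [l' el] := AA_ex l (h i ln).
  by exists i, l'; rewrite /uval el.
move=> i a; rewrite -(el_enumerates n y); split; apply: inL_sub => w ww _.
  exact: sub e ww.
by apply: sub ww => i' li; rewrite e.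
Qed.

(** * The reduction is Borel *)

Lemma borel_iff (T : Type) (C : (T -> Prop) -> Prop) S S' :
  (forall t, S t <-> S' t) -> borel C S -> borel C S'.
Proof. by move=> e; have -> : S = S' by apply/funext => t; apply/propext; exact: e. Qed.

Lemma borel_const (P : Prop) : borel cylPt (fun _ => P).
Proof.
pose S0 (x : Pt) := x 0 0 0 = true.
have b0 : borel cylPt S0 by apply: borel_gen; exists 0, 0, 0, true.
have bU : borel cylPt (fun x => exists m : nat, if m is 0 then S0 x else ~ S0 x).
  by apply: borel_cup => -[|m] //; exact: borel_compl.
have tU x : exists m : nat, if m is 0 then S0 x else ~ S0 x.
  by have [h|h] := pselect (S0 x); [exists 0|exists 1].
have [p|p] := pselect P; first by apply: borel_iff bU => x; split.
by apply: borel_iff (borel_compl bU) => x; split=> // h; case: h.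
Qed.

Lemma borel_and (S S' : Pt -> Prop) : borel cylPt S -> borel cylPt S' ->
  borel cylPt (fun x => S x /\ S' x).
Proof.
move=> b b'; have bc : borel cylPt (fun x => exists m : nat, if m is 0 then ~ S x else ~ S' x).
  by apply: borel_cup => -[|m]; exact: borel_compl.
apply: borel_iff (borel_compl bc) => x; split=> [h|[Sx S'x] [[|m]]] //.
by split; apply: contrapT => h'; apply: h; [exists 0|exists 1].
Qed.

Lemma borel_values (cs : seq I3) (s : seq bool) :
  borel cylPt (fun x => [seq evPt x c | c <- cs] = s).
Proof.
elim: cs s => [|c cs IH] s; first exact: (borel_const ([::] = s)).
case: s => [|b s]; first by apply: borel_iff (borel_const False) => x; split.
have bg : borel cylPt (fun x => evPt x c = b).
  by apply: borel_gen; exists c.1.1, c.1.2, c.2, b.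
by apply: borel_iff (borel_and bg (IH s)) => x; split=> [[<- <-]|[<- <-]].
Qed.

Lemma borel_finite_support (X : Pt -> Prop) (F : Pt -> bool) (cs : seq I3) b :
  (forall x y, X x -> X y -> (forall c, c \in cs -> evPt x c = evPt y c) -> F x = F y) ->
  exists B, borel cylPt B /\ forall x, X x -> (F x = b <-> B x).
Proof.
move=> dep.
pose vals (x : Pt) := [seq evPt x c | c <- cs].
exists (fun x => exists m, (exists2 x0, X x0 & F x0 = b /\ vals x0 = odflt [::] (unpickle m)) /\
  vals x = odflt [::] (unpickle m)); split.
  by apply: borel_cup => m; apply: borel_and; [exact: borel_const|exact: borel_values].
move=> x Xx; split=> [Fx|[m [[x0 Xx0 [<- v0]] vx]]].
  by exists (pickle (vals x)); rewrite pickleK /=; split=> //; exists x.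
apply: dep => // c cin; have : vals x = vals x0 by rewrite vx.
by move/eq_in_map; apply.
Qed.

Definition coords (P Q : seq (nat * nat)) N : seq I3 :=
  [seq (ul.1, ul.2, t) | ul <- P, t <- iota 0 N] ++
  [seq (ul.1, ul.2, wl.2) | ul <- P, wl <- Q].

Lemma info_dep x y P Q N d d' :
  Xn n x -> Xn n y -> (forall ul, ul \in P -> ltb ul.1 n) ->
  (forall c, c \in coords P Q N -> evPt x c = evPt y c) ->
  info N [seq uval x wl.1 wl.2 | wl <- Q] ([seq uval x ul.1 ul.2 | ul <- P], d) =
  info N [seq uval y wl.1 wl.2 | wl <- Q] ([seq uval y ul.1 ul.2 | ul <- P], d') \/ d != d'.
Proof.
move=> Xx Xy Pn e; have [<-|] := eqVneq d d'; [left|by right].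
rewrite /info /par /=; congr (_, _, _).
rewrite -!map_comp; apply/eq_in_map => -[i l] ilP /=; congr (_, _, _).
  apply/eq_in_map => t; rewrite mem_iota => /andP[_ tN].
  rewrite /rbit /uval; case: i ilP => [|i] ilP //=.
  have := e (0, l, t); rewrite /evPt /=; apply; rewrite mem_cat; apply/orP; left.
  apply: (@allpairs_f _ _ _ (fun (ul : nat * nat) t => (ul.1, ul.2, t)) _ _ (0, l)) => //.
  by rewrite mem_iota.
rewrite -!map_comp; apply/eq_in_map => -[i' l'] ilQ /=.
have [ei|ni] := eqVneq i i'.+1.
  subst i; have ln := Pn _ ilP; rewrite /= in ln.
  rewrite (umem_uval l l' Xx ln) (umem_uval l l' Xy ln).
  have := e (i'.+1, l, l'); rewrite /evPt /=; apply; rewrite mem_cat; apply/orP; right.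
  exact: (@allpairs_f _ _ _ (fun ul wl : nat * nat => (ul.1, ul.2, wl.2)) _ _ (i'.+1, l) (i', l')).
transitivity false; [|symmetry]; apply/negP => /umem_lev /= h; case/eqP: ni; exact: h.
Qed.

(** The tables are part of the codes [a] and [c]; the views involve finitely many bits of reals and
    finitely many memberships, and on X_n the latter are bits of the code. *)
Lemma memEl_dep j j' a c : exists cs : seq I3, forall x y, Xn n x -> Xn n y ->
  (forall c, c \in cs -> evPt x c = evPt y c) ->
  memEl (el n x j a) (el n x j' c) = memEl (el n y j a) (el n y j' c).
Proof.
rewrite /el; case: (unpickle a) => [[P d]|]; case: (unpickle c) => [[P' d']|].
- set I := [seq il <- P | _]; set I' := [seq il <- P' | _].
  have In ul : ul \in I -> ltb ul.1 n by rewrite mem_filter => /andP[/andP[]].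
  have In' ul : ul \in I' -> ltb ul.1 n by rewrite mem_filter => /andP[/andP[]].
  exists (coords I' I d.2.1.1.1 ++ coords I I' d'.2.1.1.1) => x y Xx Xy e.
  rewrite /memEl /rank /prec /up /down /par /=.
  have [|->|] := @info_dep x y I' I d.2.1.1.1 d' d' Xx Xy In'; last by rewrite eqxx.
    by move=> cc h; apply: e; rewrite mem_cat h.
  have [|->|] := @info_dep x y I I' d'.2.1.1.1 d d Xx Xy In; last by rewrite eqxx.
    by move=> cc h; apply: e; rewrite mem_cat h orbT.
  by [].
- by exists [::].
- by exists [::] => x y _ _ _; rewrite /memEl /rank /=; case: ifP.
- by exists [::].
Qed.

Lemma lab_dep a t : exists cs : seq I3, forall x y, Xn n x -> Xn n y ->
  (forall c, c \in cs -> evPt x c = evPt y c) ->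
  lab phi (el n x 0 a) t = lab phi (el n y 0 a) t.
Proof.
rewrite /el; case: (unpickle a) => [[P d]|]; last by exists [::].
set I := [seq il <- P | _]; have [_ cont _ _] := hphi.
have [N NP] := cont (pickle (size I, d : nat * body)) t.
exists [seq (0, ul.2, (odflt (0, 0) (@unpickle (nat * nat)%type m)).2) | ul <- I, m <- iota 0 N].
move=> x y Xx Xy e; rewrite /lab /lkey /par /= !size_map; apply: NP => m mN.
case em : (@unpickle (nat * nat)%type m) => [[i s]|] //=.
have [iI|iI] := ltnP i (size I); last by rewrite !nth_default ?size_map.
rewrite !(nth_map (0, 0)) //; set ul := nth (0, 0) I i.
have ulI : ul \in I by exact: mem_nth.
have := e (0, ul.2, s).
have : ul.1 = 0 by move: ulI; rewrite mem_filter leqn0 => /andP[/andP[/eqP]].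
case: (ul) ulI => [i' l'] /= ulI -> /=; rewrite /evPt /=; apply.
apply/allpairsP; exists ((i', l'), m); split=> //=; first by rewrite mem_iota.
by rewrite em.
Qed.

Lemma red_borel : borel_fun_on cylPt (Xn n) red.
Proof.
move=> S; elim=> {S} [S [i [l [k [b ->]]]]|S _ [B [bB BP]]|S _ /choice[B BP]].
- rewrite /red /tr; case: (ltb i n); last first.
    by exists (fun _ => false = b); split; first exact: borel_const.
  case: i => [|i].
    by have [cs csP] := lab_dep l k; exact: (borel_finite_support b csP).
  by have [cs csP] := memEl_dep i i.+1 k l; exact: (borel_finite_support b csP).
- exists (fun t => ~ B t); split; first exact: borel_compl.
  by move=> x Xx; rewrite BP.
- exists (fun t => exists m, B m t); split.
    by apply: borel_cup => m; have [] := BP m.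
  by move=> x Xx; split=> -[m hm]; exists m; apply/(BP m).2.
Qed.

Definition lmask k m (c : I3) := (c.1.1 < k) || (c.1.1 == k) && (c.1.2 < m).

(** * Generic enumerations of two images with a common base *)

Section Pair.
Variables (k M0 : nat) (x y : Pt) (vv : hset) (Dv : nat -> nat -> cd PS -> Prop).
Variables (q0 : cd PS) (im : I3 -> nat) (iv : nat -> nat -> nat).
Hypothesis im_mention : forall c d, D (im c) d -> c \in dom d.
Hypothesis iv_Dv : forall M' i, D (iv M' i) = Dv M' i.
Hypothesis Dv_mask : forall M' i d c, Dv M' i d -> c \in dom d -> lmask k (M0 + M') c.
Hypothesis preD : forall i, predense (D i).
Hypothesis low : forall i, i < k -> AA x i = AA y i.
Hypotheses (vx : world n x vv) (vy : ~ world n y vv) (vk : lev vv = k).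
Hypothesis neq0 : ne q0.

Let Wx := world n x.
Let Wy := world n y.
Let Wxy u := Wx u \/ Wy u.

Lemma low_xy j e : j < k -> inL j Wx e -> inL j Wy e.
Proof.
move=> jk; apply: inL_sub => u; apply: world_sub => i ij.
by apply: low; exact: leq_ltn_trans jk.
Qed.

Lemma low_yx j e : j < k -> inL j Wy e -> inL j Wx e.
Proof.
move=> jk; apply: inL_sub => u; apply: world_sub => i ij.
by rewrite low //; exact: leq_ltn_trans jk.
Qed.

Lemma low_both j e : j < k -> inL j Wxy e -> inL j Wx e.
Proof.
move=> jk Le u ue; have [[?|h] l] := Le u ue; first by [].
split=> //; apply: (world_sub _ h l) => i ij.
by rewrite low //; exact: leq_ltn_trans jk.
Qed.

Definition pstate := (state * state)%type.
(** Below [k] the two worlds have the same elements, so the states can share them. The first [M0]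
    elements of level [k] carry [vv], which is not in the world of [y], so they never occur in the
    second state. *)
Definition pvalid (s : pstate) := [/\ valid Wx s.1, valid Wy s.2,
  forall j, j < k -> s.1 j = s.2 j, M0 <= size (s.1 k) &
  forall e, e \in take M0 (s.1 k) -> vv \in par e].
Definition pext (s s' : pstate) := extends s.1 s'.1 /\ extends s.2 s'.2.

Lemma pext_trans s1 s2 s3 : pext s1 s2 -> pext s2 s3 -> pext s1 s3.
Proof. by move=> [? ?] [? ?]; split; apply: ext_trans; eassumption. Qed.

Definition base (E F : state) : state := fun j => if j < k then E j else F j.

Lemma valid_base (W W' : hset -> Prop) E F : (forall j e, j < k -> inL j W e -> inL j W' e) ->
  valid W E -> valid W' F -> valid W' (base E F).
Proof.
move=> WW [u1 l1 [J1 h1]] [u2 l2 [J2 h2]]; split.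
- by move=> j; rewrite /base; case: ifP.
- by move=> j e; rewrite /base; case: ifP => jk; [move=> /l1; exact: WW|exact: l2].
- exists (maxn J1 J2) => j; rewrite geq_max => /andP[j1 j2].
  by rewrite /base h1 // h2 // if_same.
Qed.

Lemma take_ext E E' : extends E E' -> M0 <= size (E k) -> take M0 (E' k) = take M0 (E k).
Proof. by move=> /(_ k)[s ->] h; rewrite takel_cat. Qed.

Lemma push_x s E' : pvalid s -> valid Wx E' -> extends s.1 E' ->
  pvalid (E', base E' s.2) /\ pext s (E', base E' s.2).
Proof.
move=> [v1 v2 b sz tk] v' ex; split; last first.
  split=> //= j; rewrite /base; case: ifP => jk; last by exists [::]; rewrite cats0.
  by rewrite -b.
split=> //=.
- exact: valid_base low_xy v' v2.
- by move=> j jk; rewrite /base jk.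
- exact: leq_trans sz (ext_size k ex).
- by rewrite (take_ext ex).
Qed.

Lemma push_y s E' : pvalid s -> valid Wy E' -> extends s.2 E' ->
  pvalid (base E' s.1, E') /\ pext s (base E' s.1, E').
Proof.
move=> [v1 v2 b sz tk] v' ex; split; last first.
  split=> //= j; rewrite /base; case: ifP => jk; last by exists [::]; rewrite cats0.
  by rewrite b.
split=> //=.
- exact: valid_base low_yx v' v1.
- by move=> j jk; rewrite /base jk.
- by rewrite /base ltnn.
- by rewrite /base ltnn.
Qed.

(** Only the part of [E'] below [k] is kept; there the union of the worlds has no elements beyond
    those of either one. *)
Lemma push_both s E' : pvalid s -> valid Wxy E' -> (forall j, j < k -> exists r, E' j = s.1 j ++ r) ->
  pvalid (base E' s.1, base E' s.2) /\ pext s (base E' s.1, base E' s.2).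
Proof.
move=> [v1 v2 b sz tk] v' ex; split; last first.
  split=> j /=; rewrite /base; case: ifP => jk; try by exists [::]; rewrite cats0.
    exact: ex.
  by rewrite -b //; exact: ex.
split=> //=.
- exact: valid_base low_both v' v1.
- by apply: valid_base v' v2 => j e jk /(low_both jk); exact: low_xy.
- by move=> j jk; rewrite /base jk.
- by rewrite /base ltnn.
- by rewrite /base ltnn.
Qed.

(* The part of the structure of [mrg k M0 u w] given by the base and M0 + M' rows of level k. *)
Definition virt M' (s : pstate) : state := fun j =>
  if j < k then s.1 j else if j == k then take M0 (s.1 k) ++ take M' (s.2 k) else [::].

Lemma valid_virt M' s : pvalid s -> valid Wxy (virt M' s).
Proof.
move=> [[u1 l1 _] [u2 l2 _] b sz tk]; split.
- move=> j; rewrite /virt; case: ifP => // _; case: ifP => // _.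
  rewrite cat_uniq !take_uniq // andbT /=; apply/hasP => -[e /mem_take /l2 Le /tk ve].
  by have [] := Le _ ve.
- move=> j e; rewrite /virt; case: ifP => jk.
    by move=> /l1; apply: inL_sub => u; left.
  case: eqP => // ->; rewrite mem_cat => /orP[] /mem_take h.
    by apply: inL_sub (l1 _ _ h) => u; left.
  by apply: inL_sub (l2 _ _ h) => u; right.
- exists k.+1 => j kj; rewrite /virt ltnNge (ltnW kj) /=.
  by rewrite (gtn_eqF kj).
Qed.

Definition task : countType := (nat + nat + nat * nat + nat * nat + nat * nat)%type.
Definition done (t : task) (s : pstate) : Prop :=
  match t with
  | inl (inl (inl (inl i))) => exists2 d, D i d & holds phi s.1 d
  | inl (inl (inl (inr i))) => exists2 d, D i d & holds phi s.2 d
  | inl (inl (inr (M', i))) => M' <= size (s.2 k) /\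
      exists2 d, Dv M' i d & holds phi (virt M' s) d
  | inl (inr (j, c)) => el n x j c \in s.1 j
  | inr (j, c) => el n y j c \in s.2 j
  end.

Lemma add_el W E j e : valid W E -> inL j W e -> exists E',
  [/\ valid W E', extends E E' & e \in E' j].
Proof.
move=> vE Le; have [h|h] := boolP (e \in E j).
  by exists E; split=> //; exact: ext_refl.
exists (upd E j e); split; [exact: valid_upd|exact: ext_upd|].
by rewrite /upd eqxx mem_rcons mem_head.
Qed.

(** For the merged rows, the virtual state is extended inside the union of the two worlds and only
    its new base elements are retained. The condition met looks at the base and the [M0 + M'] merged
    rows alone, so it stays true. *)
Lemma do_task t s : pvalid s -> exists s', [/\ pvalid s', pext s s' & done t s'].
Proof.
move=> vs; have [v1 v2 b sz tk] := vs.
case: t => [[[[i|i]|[M' i]]|[j c]]|[j c]] /=.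
- have [E' [d [v' ex Dd h]]] := step hphi (@separates_world n x) i v1.
  have [v'' ex''] := push_x vs v' ex.
  by exists (E', base E' s.2); split=> //; exists d.
- have [E' [d [v' ex Dd h]]] := step hphi (@separates_world n y) i v2.
  have [v'' ex''] := push_y vs v' ex.
  by exists (base E' s.1, E'); split=> //; exists d.
(* Making a condition that mentions row [M'] of level [k] hold requires more than [M'] elements
   there. *)
- have [E1 [d1 [v1' ex1 Dd1 h1]]] := step hphi (@separates_world n y) (im (k, M', 0)) v2.
  have [vs1 exs1] := push_y vs v1' ex1; set s1 := (base E1 s.1, E1) in vs1 exs1.
  have szM : M' <= size (s1.2 k).
    have /mapP[[c v] cd1 /= ec] := im_mention Dd1.
    have [] := h1 _ _ cd1; rewrite -ec => /andP[/= + _] _.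
    exact: ltnW.
  have [E2 [d [v2' ex2 Dd h2]]] := step hphi (@separates_world2 n x y) (iv M' i)
    (valid_virt M' vs1).
  have exl j : j < k -> exists r, E2 j = s1.1 j ++ r.
    by move=> jk; have [r ->] := ex2 j; exists r; rewrite /virt jk.
  have [vs2 exs2] := push_both vs1 v2' exl.
  set s2 := (base E2 s1.1, base E2 s1.2) in vs2 exs2.
  exists s2; split=> //; first exact: pext_trans exs1 exs2.
  split; first exact: leq_trans szM (ext_size k exs2.2).
  rewrite iv_Dv in Dd; exists d => // c v cd0.
  have [dc ev] := h2 _ _ cd0; rewrite -ev.
  have szv : size (virt M' s1 k) = M0 + M'.
    have [_ _ _ sz1 _] := vs1.
    by rewrite /virt ltnn eqxx size_cat !size_takel.
  have vlow j : j < k -> virt M' s2 j = E2 j by move=> jk; rewrite /virt jk /s2 /base /= jk.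
  have vk' : virt M' s2 k = virt M' s1 k by rewrite /virt ltnn eqxx /s2 /base /= ltnn.
  have mc := Dv_mask Dd (map_f fst cd0); rewrite /= in mc.
  have nlow j l : j < k -> nthE (virt M' s2) j l = nthE E2 j l by move=> jk; rewrite /nthE vlow.
  have nk l : l < M0 + M' -> nthE (virt M' s2) k l = nthE E2 k l.
    by move=> lM; rewrite (ext_nth ex2) ?szv // /nthE vk'.
  case: c {cd0 ev} dc mc => [[j l] m] /andP[/= lj mj]; rewrite /lmask /= => mc.
  have nl : nthE (virt M' s2) j l = nthE E2 j l.
    by case/orP: mc => [jk|/andP[/eqP -> lM]]; [exact: nlow|exact: nk].
  have jk : j <= k by case/orP: mc => [/ltnW //|/andP[/eqP -> _]].
  split; last by case: (j) nl jk {mj lj mc} => [|j'] nl jk; rewrite /evPt /= nl ?nlow.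
  rewrite /det /=; apply/andP; split.
    by case/orP: mc => [jk'|/andP[/eqP -> lM]]; [rewrite vlow|rewrite vk' szv].
  by case: (j) jk mj => // j' jk mj; rewrite vlow.
- have Le : inL j Wx (el n x j c) by apply/(@el_enumerates n x); exists c.
  have [E' [v' ex h]] := add_el v1 Le; have [v'' ex''] := push_x vs v' ex.
  by exists (E', base E' s.2).
- have Le : inL j Wy (el n y j c) by apply/(@el_enumerates n y); exists c.
  have [E' [v' ex h]] := add_el v2 Le; have [v'' ex''] := push_y vs v' ex.
  by exists (base E' s.1, E').
Qed.

(** While [q0] is being met, every new element of level at least [k] receives [vv] as an extra
    parameter; the level of [vv] allows this. *)
Lemma initial : exists s, pvalid s /\ holds phi s.1 q0.
Proof.
have vemp W : valid W (fun _ => [::]) by split=> //; exists 0.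
have ag : agree phi (fun _ => [::]) q0 by move=> c v _ /andP[].
have [|E [v h _ sz m]] := fill_holds hphi (@separates_world n x)
  (X := fun j => if k <= j then [:: vv] else [::]) (maxn k.+1 M0) (vemp _) ag neq0.
  move=> j u; case: ifP => // kj; rewrite inE => /eqP ->; split=> //.
  by rewrite vk.
exists (E, base E (fun _ => [::])); split=> //; split=> //=.
- exact: valid_base low_xy v (vemp _).
- by move=> j jk; rewrite /base jk.
- by apply: leq_trans (leq_maxr k.+1 M0) (sz k _); rewrite leq_max leqnn.
- move=> e /mem_take /m[//|]; rewrite leqnn; apply; exact: mem_head.
Qed.

(** States only grow and [holds] persists, so each task is performed once, at the stage given by its
    code. *)
Lemma limit : exists eps eps' : nat -> nat -> elt,
  [/\ enumerates Wx eps, enumerates Wy eps', forall j, j < k -> eps j = eps' j &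
  let u := point phi eps in let w := point phi eps' in
  [/\ sat q0 u, forall i, exists2 d, D i d & sat d u, forall i, exists2 d, D i d & sat d w &
  forall M' i, exists2 d, Dv M' i d & sat d (mrg k M0 u w)]].
Proof.
have [s0 [vs0 hq0]] := initial.
pose st := {s : pstate | pvalid s}.
have /choice[nx nxP] : forall is_ : nat * st, exists s' : st,
    pext (proj1_sig is_.2) (proj1_sig s') /\
    forall t : task, unpickle is_.1 = Some t -> done t (proj1_sig s').
  move=> [i [s vs]] /=; case: (unpickle i) => [t|]; last first.
    by exists (exist _ s vs); split=> //; split; exact: ext_refl.
  have [s' [vs' es dn]] := do_task t vs.
  by exists (exist _ s' vs'); split=> // t' [<-].
pose c := fix c i : st := if i is j.+1 then nx (j, c j) else exist _ s0 vs0.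
pose S i := proj1_sig (c i).
have vS i : pvalid (S i) := proj2_sig (c i).
have eS i j : i <= j -> pext (S i) (S j).
  elim: j => [|j IH]; first by rewrite leqn0 => /eqP ->; split; exact: ext_refl.
  rewrite leq_eqVlt => /orP[/eqP ->|/IH h]; first by split; exact: ext_refl.
  exact: pext_trans h (nxP (j, c j)).1.
have dS (t : task) : done t (S (pickle t).+1).
  by apply: (nxP (pickle t, c (pickle t))).2; rewrite pickleK.
(* Meeting the conditions that mention row [l] of level [j] makes that row exist at some stage. *)
have sz1 j l : exists i, l < size ((S i).1 j).
  have [d Dd h] := dS (inl (inl (inl (inl (im (j, l, 0)))))).
  have /mapP[[cc v] cd1 /= ec] := im_mention Dd.
  have [] := h _ _ cd1; rewrite -ec => /andP[/= + _] _ => hl.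
  by eexists; exact: hl.
have sz2 j l : exists i, l < size ((S i).2 j).
  have [d Dd h] := dS (inl (inl (inl (inr (im (j, l, 0)))))).
  have /mapP[[cc v] cd1 /= ec] := im_mention Dd.
  have [] := h _ _ cd1; rewrite -ec => /andP[/= + _] _ => hl.
  by eexists; exact: hl.
have [N1 N1P] := choice (fun jl : nat * nat => sz1 jl.1 jl.2).
have [N2 N2P] := choice (fun jl : nat * nat => sz2 jl.1 jl.2).
pose eps j l := nthE (S (N1 (j, l))).1 j l.
pose eps' j l := nthE (S (N2 (j, l))).2 j l.
have epsE i j l : l < size ((S i).1 j) -> eps j l = nthE (S i).1 j l.
  move=> li; have := N1P (j, l); rewrite /eps /= => lN.
  case: (leqP (N1 (j, l)) i) => h; first by rewrite (ext_nth (eS _ _ h).1).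
  by rewrite -(ext_nth (eS _ _ (ltnW h)).1).
have epsE' i j l : l < size ((S i).2 j) -> eps' j l = nthE (S i).2 j l.
  move=> li; have := N2P (j, l); rewrite /eps' /= => lN.
  case: (leqP (N2 (j, l)) i) => h; first by rewrite (ext_nth (eS _ _ h).2).
  by rewrite -(ext_nth (eS _ _ (ltnW h)).2).
have satu i d : holds phi (S i).1 d -> @sat PS d (point phi eps).
  move=> h; apply/psatP => cc v cd0; have [dc <-] := h _ _ cd0.
  by apply: det_point dc => j l; exact: epsE.
have satw i d : holds phi (S i).2 d -> @sat PS d (point phi eps').
  move=> h; apply/psatP => cc v cd0; have [dc <-] := h _ _ cd0.
  by apply: det_point dc => j l; exact: epsE'.
have lowE j : j < k -> eps j = eps' j.
  move=> jk; apply/funext => l.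
  have [_ _ b _ _] := vS (N1 (j, l)); have lN := N1P (j, l).
  by rewrite (epsE _ _ _ lN) (epsE' (N1 (j, l))) -?b // /nthE b.
exists eps, eps'; split=> //.
- move=> j e; split=> [Le|[l <-]].
    have [cc ecc] := (@el_enumerates n x j e).1 Le.
    have := dS (inl (inr (j, cc))); rewrite /done ecc => h.
    exists (index e ((S (pickle (inl (inr (j, cc)) : task)).+1).1 j)).
    by rewrite (epsE (pickle (inl (inr (j, cc)) : task)).+1) ?index_mem // /nthE nth_index.
  have [[_ inl _] _ _ _ _] := vS (N1 (j, l)).
  by apply: inl; apply: mem_nth; exact: (N1P (j, l)).
- move=> j e; split=> [Le|[l <-]].
    have [cc ecc] := (@el_enumerates n y j e).1 Le.
    have := dS (inr (j, cc)); rewrite /done ecc => h.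
    exists (index e ((S (pickle (inr (j, cc) : task)).+1).2 j)).
    by rewrite (epsE' (pickle (inr (j, cc) : task)).+1) ?index_mem // /nthE nth_index.
  have [_ [_ inl _] _ _ _] := vS (N2 (j, l)).
  by apply: inl; apply: mem_nth; exact: (N2P (j, l)).
move=> u w; split.
- by apply: (satu 0).
- by move=> i; have [d Dd /satu] := dS (inl (inl (inl (inl i)))); exists d.
- by move=> i; have [d Dd /satw] := dS (inl (inl (inl (inr i)))); exists d.
move=> M' i; have [szM [d Dd h]] := dS (inl (inl (inr (M', i)))).
set N := (_ : nat).+1 in szM h; exists d => //.
pose epsv j l := if j < k then eps j l else if l < M0 then eps j l else eps' j (l - M0).
have epsvE j l : l < size (virt M' (S N) j) -> epsv j l = nthE (virt M' (S N)) j l.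
  have [_ _ _ szN _] := vS N.
  rewrite /nthE /epsv /virt; case: ifP => jk; first exact: epsE.
  case: eqP => // ->; rewrite size_cat !size_takel // nth_cat size_takel // => lM.
  case: ifP => lM0; first by rewrite nth_take // (epsE N) // (leq_trans lM0).
  have lM' : l - M0 < M' by rewrite ltn_subLR // leqNgt lM0.
  by rewrite nth_take // (epsE' N) // (leq_trans lM').
apply/psatP => -[[j l] m] v cd0; have [dc <-] := h _ _ cd0.
rewrite -(det_point phi epsvE dc).
have jk : j <= k.
  by have /orP[/ltnW //|/andP[/eqP /= -> _]] := Dv_mask Dd (map_f fst cd0).
rewrite /evPt /mrg /u /w /epsv /=; case: j {cd0 dc} jk => [|j] jk /=.
  by case: ifP => // _; case: ifP.
by rewrite jk; case: ifP => // _; case: ifP => // _; rewrite lowE.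
Qed.
End Pair.
End Reduction.

(** * The dichotomy *)

Lemma dense_predense (D : cd PS -> Prop) : dense D -> predense D.
Proof.
move=> dD s nes; have [t [[u tu] ts Dt]] := dD s nes.
by exists t => //; exists u; apply/satI; split=> //; exact: ts.
Qed.

Lemma comeager_predense (S : Pt -> Prop) : @comeager PS S ->
  exists D : nat -> cd PS -> Prop, (forall i, predense (D i)) /\
    forall u, (forall i, exists2 d, D i d & sat d u) -> S u.
Proof.
move=> [D [dD DS]]; exists D; split=> [i|u h]; first exact: dense_predense.
by apply: DS => i; have [d] := h i; exists d.
Qed.

(** By Kuratowski-Ulam, a comeager set depending only on masked coordinates is comeager in the
    masked space, so its conditions can be trimmed to the mask. *)
Lemma comeager_predense_mask k m (S : Pt -> Prop) : @comeager PS S ->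
  (forall v w, (forall j, j < k -> v j = w j) -> (forall l, l < m -> v k l = w k l) ->
    S v -> S w) ->
  exists D : nat -> cd PS -> Prop, [/\ forall i, predense (D i),
    forall i d c, D i d -> c \in dom d -> lmask k m c &
    forall u, (forall i, exists2 d, D i d & sat d u) -> S u].
Proof.
move=> cS cong; have := kuratowski_ulam (@cm_glue (lmask k m) (lmask k m) S (fun _ => id) cS).
have : forall u : Pt, @comeager PS (fun v => S (glc (lmask k m) u v)) -> S u.
  move=> u /ne_top[|v]; first by exists (fun _ _ _ => false).
  apply: cong => [j jk|l lm].
    by apply/funext => l; apply/funext => t; rewrite /glc /lmask /= jk.
  by apply/funext => t; rewrite /glc /lmask /= eqxx lm orbT.
move=> imp [D [dD DS]].
exists (fun i d => exists2 t, D i t & d = [seq cv <- t | lmask k m cv.1]); split.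
- move=> i s [x sx].
  have [|t [[w wt] ts Dt]] := dD i s.
    by exists x; apply/fsatP => c v cs _; move/psatP: sx; apply.
  exists [seq cv <- t | lmask k m cv.1]; first by exists t.
  have /fsatP ws := ts _ wt; move/fsatP: wt => wt.
  have ev c : evPt (glc (lmask k m) w x) c = if lmask k m c then evPt w c else evPt x c.
    by case: c => [[j l] r].
  exists (glc (lmask k m) w x); apply/satI; split; apply/psatP => c v.
    move=> cs; rewrite ev; case: ifP => mc; first exact: ws.
    by move/psatP: sx; apply.
  by rewrite mem_filter /= => /andP[mc ct]; rewrite ev mc; exact: wt.
- move=> i d c [t _ ->] /mapP[[c' v]]; rewrite mem_filter /= => /andP[mc _] ->.
  exact: mc.
- move=> u h; apply: imp; apply: DS => i; have [_ [t Dt ->] /psatP tu] := h i.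
  exists t; split=> //; apply/fsatP => c v ct mc; apply: tu.
  by rewrite mem_filter mc.
Qed.

Section Main.
Variables (n : natinf) (E : Pt -> Pt -> Prop).
Hypothesis Eeq : equiv_on (Xn n) E.
Hypothesis Ecl : classifiable (Xn n) E.
Hypothesis EF : forall x y, Xn n x -> Xn n y -> Frel n x y -> E x y.
Hypothesis not_lower : forall k, ltb k n -> ~ exists C, comeager_in (Xn n) C /\
  forall x y, C x -> C y -> Frel (Fin k) (restr k x) (restr k y) -> E x y.

Definition kdata : Type :=
  ((nat -> cd PS -> Prop) * cd PS * nat * (nat -> nat -> cd PS -> Prop))%type.

(** Levels not below [n] receive trivial data, so that a single choice function covers all [k]. *)
Lemma level_data k : exists w : kdata, let: (Dk, q0, M0, Dv) := w in
  [/\ forall i, predense (Dk i), forall M' i, predense (Dv M' i),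
   forall M' i d c, Dv M' i d -> c \in dom d -> lmask k (M0 + M') c &
   ltb k n -> ne q0 /\ forall u v, (forall i, exists2 d, Dk i d & sat d u) ->
     (forall i, exists2 d, Dk i d & sat d v) -> (forall j, j < k -> u j = v j) -> sat q0 u ->
     (forall M' i, exists2 d, Dv M' i d & sat d (mrg k M0 u v)) -> ~ E (tr n u) (tr n v)].
Proof.
have triv : predense (fun d => d = [::]).
  by move=> s [u su]; exists [::] => //; exists u; apply/satI.
case kn : (ltb k n); last first.
  exists (fun _ d => d = [::], [::], 0, fun _ _ d => d = [::]); split=> //.
  by move=> M' i d c ->.
have [ar [g [gB gE]]] := Ecl.
have [gd [q0 [M0 [sp [cgd gstd neq hsp hE]]]]] :=
  level_witness Eeq gB gE EF kn (not_lower kn).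
have [Dk [pDk DkS]] := comeager_predense cgd.
have /choice[Dv DvP] : forall M', exists D : nat -> cd PS -> Prop, [/\ forall i, predense (D i),
    forall i d c, D i d -> c \in dom d -> lmask k (M0 + M') c &
    forall u, (forall i, exists2 d, D i d & sat d u) -> sp M' u].
  by move=> M'; have [c1 c2] := hsp M'; exact: comeager_predense_mask.
exists (Dk, q0, M0, Dv); split=> //.
- by move=> M'; have [] := DvP M'.
- by move=> M'; have [] := DvP M'.
- move=> _; split=> // u v hu hv uv qu hm; apply: hE => //; [exact: DkS|exact: DkS|].
  by move=> M'; have [_ _ h] := DvP M'; apply: h => i; exact: hm.
Qed.

Lemma reduction : borel_reducible (Xn n) (Frel n) E.
Proof.
have [w wP] := choice level_data.
pose Dk k := (w k).1.1.1; pose q0 k := (w k).1.1.2; pose M0 k := (w k).1.2; pose Dv k := (w k).2.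
have {}wP k : [/\ forall i, predense (Dk k i), forall M' i, predense (Dv k M' i),
   forall M' i d c, Dv k M' i d -> c \in dom d -> lmask k (M0 k + M') c &
   ltb k n -> ne (q0 k) /\ forall u v, (forall i, exists2 d, Dk k i d & sat d u) ->
     (forall i, exists2 d, Dk k i d & sat d v) -> (forall j, j < k -> u j = v j) ->
     sat (q0 k) u -> (forall M' i, exists2 d, Dv k M' i d & sat d (mrg k (M0 k) u v)) ->
     ~ E (tr n u) (tr n v)].
  by have := wP k; rewrite /Dk /q0 /M0 /Dv; case: (w k) => [[[? ?] ?] ?].
pose idx : countType := (I3 + nat * nat + nat * nat * nat)%type.
(* The requirements of all levels go into one sequence, because the labelling must be fixed before
   the level at which two given codes differ is known. *)
pose D (m : nat) : cd PS -> Prop := match @unpickle idx m with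
  | Some (inl (inl c)) => fun d => c \in dom d
  | Some (inl (inr ki)) => Dk ki.1 ki.2
  | Some (inr kMi) => Dv kMi.1.1 kMi.1.2 kMi.2
  | None => fun d => d = [::] end.
have preD m : predense (D m).
  rewrite /D; case: unpickle => [[[c|[k i]]|[[k M'] i]]|] /=.
  - move=> s [u su]; exists [:: (c, evPt u c)]; first by rewrite inE.
    exists u; apply/satI; split=> //; apply/psatP => c' v.
    by rewrite inE => /eqP[-> ->].
  - by have [] := wP k.
  - by have [] := wP k.
  - by move=> s [u su]; exists [::] => //; exists u; apply/satI.
have [phi hphi] := labelling_ex preD.
pose f := red phi n.
have Xf x : Xn n (f x) by exact: (red_Xn hphi).
have [_ Es Et] := Eeq.
have key k x y l : ltb k n -> (forall i, i < k -> AA x i = AA y i) ->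
    (forall l', hval x k l <> hval y k l') -> ~ E (f x) (f y).
  move=> kn low neq Exy; have [pDk pDv Dvm /(_ kn)[neq0 hE]] := wP k.
  pose vv := uval x k l.
  have vx : world n x vv by exists k, l.
  have vy : ~ world n y vv.
    move=> [i [l' [_ e]]]; have /= ei := congr1 (@projT1 _ _) e; subst i.
    by move/existT_inj: e; exact: neq.
  have imE (c : I3) d : D (pickle (inl (inl c) : idx)) d -> c \in dom d by rewrite /D pickleK.
  have ivE M' i : D (pickle (inr (k, M', i) : idx)) = Dv k M' i by rewrite /D pickleK.
  have [eps [eps' [en en' lw [hq hu hv hm]]]] := @limit D phi hphi n k (M0 k) x y vv
    (Dv k) (q0 k) (fun c => pickle (inl (inl c) : idx))
    (fun M' i => pickle (inr (k, M', i) : idx))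
    imE ivE Dvm low vx vy erefl neq0.
  have Dkp i u : (exists2 d, D (pickle (inl (inr (k, i)) : idx)) d & @sat PS d u) ->
      exists2 d, Dk k i d & @sat PS d u by rewrite /D pickleK.
  have Xu := point_Xn hphi n (@separates_world n x) en.
  have Xv := point_Xn hphi n (@separates_world n y) en'.
  apply: (hE _ _ (fun i => Dkp i _ (hu _)) (fun i => Dkp i _ (hv _)) _ hq hm).
    move=> j jk; apply/funext => r; apply/funext => m; rewrite /point.
    by case: j jk => [|j] jk; rewrite (lw _ jk) // (lw j (ltnW jk)).
  (* The generic enumerations code the same sets as the images, so [E] passes to them and
     contradicts the criterion of level [k]. *)
  have E1 : E (tr n (point phi eps)) (f x).
    apply: EF => //; apply/FrelP => // j jn; rewrite !AA_tr //.
    exact: AA_point en (@el_enumerates n x).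
  have E2 : E (f y) (tr n (point phi eps')).
    apply: EF => //; apply/FrelP => // j jn; rewrite !AA_tr //.
    exact: AA_point (@el_enumerates n y) en'.
  by apply: (Et _ (f x)) => //; exact: (Et _ (f y)).
exists f; split; first exact: (red_borel hphi).
split=> // x y Xx Xy; split=> [Fxy|Exy].
  by apply: EF => //; exact: (red_Frel hphi).
(* At the least level of difference one code has a set that the other lacks; [key] is applied in the
   corresponding order. *)
apply/(FrelP Xx Xy) => j; elim/ltn_ind: j => j IH jn; apply: contrapT => ne.
have low i : i < j -> AA x i = AA y i.
  by move=> ij; apply: IH => //; exact: ltb_leq (ltnW ij) jn.
have [[l h]|h1] := pselect (exists l, forall l', hval x j l <> hval y j l').
  exact: (key j x y l jn low h Exy).
have [[l h]|h2] := pselect (exists l, forall l', hval y j l <> hval x j l').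
  by apply: (key j y x l jn _ h (Es _ _ (Xf x) (Xf y) Exy)) => i /low.
apply: ne; apply: AA_eq => l; apply: contrapT => h.
  by apply: h1; exists l => l' e; apply: h; exists l'.
by apply: h2; exists l => l' e; apply: h; exists l'.
Qed.
End Main.

Theorem mainTheorem2 (n : natinf) (E : Pt -> Pt -> Prop) :
  n <> Fin 0 ->
  equiv_on (Xn n) E ->
  classifiable (Xn n) E ->
  (forall x y, Xn n x -> Xn n y -> Frel n x y -> E x y) ->
  borel_reducible (Xn n) (Frel n) E \/
  exists k : nat, ltinf k n /\
    exists C : Pt -> Prop, comeager_in (Xn n) C /\
      forall x y, C x -> C y -> Frel (Fin k) (restr k x) (restr k y) -> E x y.
Proof.
move=> _ Eeq Ecl EF.
have [h|nh] := pselect (exists k : nat, ltinf k n /\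
    exists C : Pt -> Prop, comeager_in (Xn n) C /\
      forall x y, C x -> C y -> Frel (Fin k) (restr k x) (restr k y) -> E x y); first by right.
left; apply: reduction => // k /ltbP kn [C hC].
by apply: nh; exists k; split=> //; exists C.
Qed.
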